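(* Let $w$ be an admissible weight on $\mathbb{R}^d$, let $\alpha,\beta>0$, and let $g\in W_{\mathbb{H}}(L^\infty,L^1_w)$. Suppose that the Gabor system $\mathcal{G}(g,\alpha,\beta)=\{M_{\beta n}T_{\alpha k}g:k,n\in\mathbb{Z}^d\}$ is a frame for $L^2(\mathbb{R}^d,\mathbb{H})$ with frame operator $S_g$. If the window function $g$ is continuous, then the dual window $\tilde g=S_g^{-1}(g)$ is also continuous.
   Context: $\mathbb{H}$ is a separable complex Hilbert space. $T_af(x)=f(x-a)$, $M_bf(x)=e^{2\pi i\langle b,x\rangle}f(x)$, $Q_\alpha=[0,\alpha)^d$, $\langle f,g\rangle=\int_{\mathbb{R}^d}\langle f(x),g(x)\rangle_{\mathbb{H}}dx$. A weight is a continuous function $w:\mathbb{R}^d\to(0,\infty)$ with $w(x)=w(-x)$. It is admissible if $w(x+y)\le w(x)w(y)$, $w(0)=1$, and $\lim_{k\to\infty}w(kx)^{1/k}=1$ for all $x$. $W_{\mathbb{H}}(L^\infty,L^1_w)$ is the Banach space of measurable $f:\mathbb{R}^d\to\mathbb{H}$ with $\|f\|=\sum_{k\in\mathbb{Z}^d}\|f\cdot T_{\alpha k}\chi_{Q_\alpha}\|_{L^\infty(\mathbb{R}^d,\mathbb{H})}w(\alpha k)<\infty$. $\mathcal{G}(g,\alpha,\beta)$ is a frame for $L^2(\mathbb{R}^d,\mathbb{H})$ if there are $A,B>0$ with $A\|f\|^2\le\sum_{k,n}|\langle f,M_{\beta n}T_{\alpha k}g\rangle|^2\le B\|f\|^2$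 for all $f\in L^2(\mathbb{R}^d,\mathbb{H})$; the frame operator $S_gf=\sum_{k,n}\langle f,M_{\beta n}T_{\alpha k}g\rangle M_{\beta n}T_{\alpha k}g$ is then bounded and invertible on $L^2(\mathbb{R}^d,\mathbb{H})$. Continuity of $\tilde g$ means that it agrees almost everywhere with a continuous function. *)

(* Defs.v *)
From HB Require Import structures.
From mathcomp Require Import all_boot all_order all_algebra finmap.
From mathcomp Require Import all_classical all_reals all_analysis.
From mathcomp Require Import complex sesquilinear.

Set Implicit Arguments.
Unset Strict Implicit.
Unset Printing Implicit Defensive.

Import Order.TTheory GRing.Theory Num.Theory Num.Def.
Import numFieldNormedType.Exports.

Local Open Scope classical_set_scope.
Local Open Scope ring_scope.
Local Open Scope complex_scope.

Section measurable_rV.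
Context {d} {T : measurableType d} {n : nat}.

Let coord (i : 'I_n) (x : 'rV[T]_n) : T := x ord0 i.

Let rV_set0 : g_sigma_preimage coord set0.
Proof. exact: sigma_algebra0. Qed.

Let rV_setC A : g_sigma_preimage coord A -> g_sigma_preimage coord (~` A).
Proof. exact: sigma_algebraC. Qed.

Let rV_bigcup (F : _^nat) : (forall i, g_sigma_preimage coord (F i)) ->
  g_sigma_preimage coord (\bigcup_i (F i)).
Proof. exact: sigma_algebra_bigcup. Qed.

(* The product sigma-algebra; over the Borel sets of a realType it is the Borel
   sigma-algebra of 'rV_n. *)
HB.instance Definition _ := @isMeasurable.Build (measure_tuple_display d)
  'rV[T]_n (g_sigma_preimage coord) rV_set0 rV_setC rV_bigcup.

End measurable_rV.

Section measurable_rV_theory.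
Context {d1 d2} {T1 : measurableType d1} {T2 : measurableType d2}.

Lemma measurable_coord n (i : 'I_n) :
  measurable_fun [set: 'rV[T2]_n] (fun x : 'rV[T2]_n => x ord0 i).
Proof.
move=> _ Y mY; rewrite setTI; apply: sub_sigma_algebra => /=.
rewrite -bigcup_seq/=; exists i => /=; first by rewrite mem_index_enum.
by exists Y => //; rewrite setTI.
Qed.

Lemma measurable_fun_rV n (f : T1 -> 'rV[T2]_n) :
  (forall i, measurable_fun [set: T1] (fun x => f x ord0 i)) ->
  measurable_fun [set: T1] f.
Proof.
move=> mf _ A mA; rewrite setTI.
have : <<s \big[setU/set0]_(i < n)
    preimage_set_system setT (fun x : 'rV[T2]_n => x ord0 i) measurable >>
    `<=` image_set_system setT f measurable.
  apply: smallest_sub.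
    exact/sigma_algebra_image/sigma_algebra_measurable.
  rewrite -bigcup_seq => B [i _ [C mC <-]].
  by rewrite /image_set_system/= !setTI; have := mf i measurableT C mC; rewrite setTI.
by move=> /(_ A mA); rewrite /image_set_system/= setTI.
Qed.

End measurable_rV_theory.

Lemma product_sigma_finite {d1 d2} {T1 : measurableType d1}
    {T2 : measurableType d2} {R : realType}
    (m1 : {sigma_finite_measure set T1 -> \bar R})
    (m2 : {sigma_finite_measure set T2 -> \bar R}) :
  sigma_finite setT (m1 \x m2)%E.
Proof.
have /sigma_finiteP[F [TF ndF Foo]] := sigma_finiteT m1.
have /sigma_finiteP[G [TG ndG Goo]] := sigma_finiteT m2.
exists (fun n => F n `*` G n).
  rewrite -setXTT TF TG predeqE => -[x y]; split.
    move=> [/= [n _ Fnx] [k _ Gky]]; exists (maxn n k) => //; split.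
    - by move: x Fnx; exact/subsetPset/ndF/leq_maxl.
    - by move: y Gky; exact/subsetPset/ndG/leq_maxr.
  by move=> [n _ []/= ? ?]; split; exists n.
move=> k; have [mF Fk] := Foo k; have [mG Gk] := Goo k.
split; first exact: measurableX.
by rewrite product_measure1E// lte_mul_pinfty// ge0_fin_numE.
Qed.

Section lebesgue_rV.
Context {R : realType}.

Definition consrV n (p : measurableTypeR R * 'rV[R]_n) : 'rV[R]_n.+1 :=
  \row_i oapp (p.2 ord0) p.1 (unlift ord0 i).

Let unconsrV n (x : 'rV[R]_n.+1) : measurableTypeR R * 'rV[R]_n :=
  (x ord0 ord0, \row_j x ord0 (lift ord0 j)).

Let unconsrVK n : cancel (@unconsrV n) (@consrV n).
Proof.
move=> x; apply/rowP => i; rewrite !mxE.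
by case: unliftP => [j|] -> //=; rewrite mxE.
Qed.

Let consrVK n : cancel (@consrV n) (@unconsrV n).
Proof.
case=> a x; rewrite /unconsrV /consrV mxE unlift_none/=; congr pair.
by apply/rowP => i; rewrite !mxE liftK.
Qed.

Lemma measurable_consrV n : measurable_fun setT (@consrV n).
Proof.
apply: measurable_fun_rV => i.
under eq_fun do rewrite mxE.
case: (unliftP ord0 i) => [j|] _ /=; last exact: measurable_fst.
by apply: (measurableT_comp (measurable_coord j)); exact: measurable_snd.
Qed.

Let measurable_unconsrV n : measurable_fun setT (@unconsrV n).
Proof.
apply/measurable_fun_pairP; split; first exact: measurable_coord.
apply: measurable_fun_rV => i.
under eq_fun do rewrite mxE.
exact: measurable_coord.
Qed.

Definition lebesgue_step n (m : {sigma_finite_measure set 'rV[R]_n -> \bar R}) :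
    set 'rV[R]_n.+1 -> \bar R :=
  pushforward (@lebesgue_measure R \x m)%E (@consrV n).

Section lebesgue_step.
Variables (n : nat) (m : {sigma_finite_measure set 'rV[R]_n -> \bar R}).
Local Open Scope ereal_scope.

Let mpre (A : set 'rV[R]_n.+1) : measurable A -> measurable (@consrV n @^-1` A).
Proof. by move=> mA; rewrite -[X in measurable X]setTI; exact: measurable_consrV. Qed.

Let step0 : lebesgue_step m set0 = 0.
Proof. by rewrite /lebesgue_step /pushforward preimage_set0 measure0. Qed.

Let step_ge0 A : 0 <= lebesgue_step m A.
Proof. by rewrite /lebesgue_step /pushforward measure_ge0. Qed.

Let step_sigma_additive : semi_sigma_additive (lebesgue_step m).
Proof.
move=> F mF tF mUF; rewrite /lebesgue_step /pushforward preimage_bigcup.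
apply: measure_semi_sigma_additive.
- by move=> k; exact: mpre.
- apply/trivIsetP => /= i j _ _ ij; rewrite -preimage_setI.
  by move/trivIsetP : tF => /(_ _ _ _ _ ij) ->//; rewrite preimage_set0.
- by rewrite -preimage_bigcup; exact: mpre.
Qed.

HB.instance Definition _ := isMeasure.Build _ _ _ (lebesgue_step m)
  step0 step_ge0 step_sigma_additive.

Let step_sigma_finite : sigma_finite setT (lebesgue_step m).
Proof.
have [F TF Foo] := product_sigma_finite (@lebesgue_measure R) m.
exists (fun k => @unconsrV n @^-1` F k) => [|k].
  by rewrite -preimage_bigcup -TF preimage_setT.
have [mF Fk] := Foo k; split.
  by rewrite -[X in measurable X]setTI; exact: measurable_unconsrV.
rewrite /lebesgue_step /pushforward -comp_preimage.
by rewrite (_ : _ \o _ = id)//; apply/funext => p; exact: consrVK.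
Qed.

HB.instance Definition _ := Measure_isSigmaFinite.Build _ _ _ (lebesgue_step m)
  step_sigma_finite.

End lebesgue_step.

Fixpoint lebesgue_rV n : {sigma_finite_measure set 'rV[R]_n -> \bar R} :=
  if n is n'.+1 then lebesgue_step (lebesgue_rV n') else \d_(0 : 'rV[R]_0).

Lemma lebesgue_rV_box n (A : 'I_n -> set (measurableTypeR R)) :
  (forall i, measurable (A i)) ->
  lebesgue_rV n [set x | forall i, A i (x ord0 i)] =
    (\big[*%E/1]_(i < n) (@lebesgue_measure R) (A i))%E.
Proof.
elim: n A => [|n IHn] A mA.
  by rewrite big_ord0 /= diracE mem_set// => -[].
rewrite big_ord_recl -IHn// /= /lebesgue_step /pushforward -product_measure1E//.
- congr (product_measure1 _ _ _); apply/seteqP; split => -[a x] /= Ax.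
    split => [|i]; first by have := Ax ord0; rewrite mxE unlift_none.
    by have := Ax (lift ord0 i); rewrite mxE liftK.
  move=> i; rewrite mxE; case: unliftP => [j|] -> /=; first exact: Ax.2.
  exact: Ax.1.
- rewrite [X in _ X](_ : _ =
    \bigcap_(i in setT) ((fun x : 'rV[R]_n => x ord0 i) @^-1` A (lift ord0 i))).
    apply: fin_bigcap_measurable => // i _.
    by rewrite -[X in measurable X]setTI; apply: measurable_coord => //; exact: mA.
  by apply/seteqP; split => x Ax i; [move=> _|]; exact: Ax.
Qed.

End lebesgue_rV.

Section weights.
Context {R : realType} {d : nat}.
Implicit Types w : 'rV[R]_d -> R.

Definition weight w :=
  [/\ continuous w, (forall x, 0 < w x) & (forall x, w (- x) = w x)].

Definition admissible w :=
  [/\ weight w, (forall x y, w (x + y) <= w x * w y), w 0 = 1 &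
    forall x, (w (k%:R *: x) `^ k%:R^-1 @[k --> \oo] --> (1 : R))].

End weights.

Definition separable (T : topologicalType) :=
  exists2 D : set T, countable D & dense D.

(* A complete normed space satisfying this is a Hilbert space; [dot] is linear in
   its first argument and conjugate-linear in its second one. *)
Definition hilbert_norm {R : realType} {H : completeNormedModType R[i]}
    (dot : {dot H for conjC}) :=
  forall v : H, `|v| ^+ 2 = dot v v.

(* Over R[i], `|v| is a (real) element of R[i]. *)
Definition rnorm {R : realType} {V : normedZmodType R[i]} (v : V) : R :=
  complex.Re `|v|.

Section function_spaces.
Context {R : realType} {H : completeNormedModType R[i]} {d : nat}.
Implicit Types (f g h : 'rV[R]_d -> H) (w : 'rV[R]_d -> R).
Local Notation mu := (@lebesgue_rV R d).

(* Borel measurability, which for separable H is strong measurability. L^2 and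
   W(L^oo, L^1_w) are not quotiented: elements are functions, and equality in
   these spaces is equality almost everywhere. *)
Definition Hmeasurable f := forall U : set H, open U -> measurable (f @^-1` U).

Definition L2norm f : \bar R := 'N[mu]_2%:E[EFin \o rnorm \o f]%E.
Definition Linfnorm f : \bar R := 'N[mu]_+oo[EFin \o rnorm \o f]%E.

Definition in_L2 f := Hmeasurable f /\ (L2norm f < +oo)%E.

Definition L2dot (dot : {dot H for conjC}) f g : R[i] :=
  Rintegral mu setT (fun x => complex.Re (dot (f x) (g x))) +i*
  Rintegral mu setT (fun x => complex.Im (dot (f x) (g x))).

Definition translate {T : Type} (a : 'rV[R]_d) (f : 'rV[R]_d -> T) :=
  fun x => f (x - a).

Definition cis (t : R) : R[i] := cos t +i* sin t.

Definition modulate (b : 'rV[R]_d) f :=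
  fun x : 'rV[R]_d => cis (2 * pi * \sum_i (b ord0 i * x ord0 i)) *: f x.

Definition cube (alpha : R) : set 'rV[R]_d :=
  [set x | forall i, 0 <= x ord0 i < alpha].

Definition lattice (a : R) (k : 'rV[int]_d) : 'rV[R]_d :=
  \row_i (a * (k ord0 i)%:~R).

Definition amalgam_norm w (alpha : R) f : \bar R :=
  (\esum_(k in [set: 'rV[int]_d])
     (Linfnorm (fun x =>
        (translate (lattice alpha k) \1_(cube alpha) x)%:C%C *: f x) *
      (w (lattice alpha k))%:E))%E.

Definition in_amalgam w (alpha : R) f :=
  Hmeasurable f /\ (amalgam_norm w alpha f < +oo)%E.

Definition ae_continuous f :=
  exists2 h, continuous h & {ae mu, forall x, f x = h x}.

End function_spaces.

Section gabor.
Context {R : realType} {H : completeNormedModType R[i]}.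
Variables (dot : {dot H for conjC}) (d : nat).
Implicit Types (f g h : 'rV[R]_d -> H) (alpha beta : R).

Definition gabor g alpha beta (kn : 'rV[int]_d * 'rV[int]_d) :=
  modulate (lattice beta kn.2) (translate (lattice alpha kn.1) g).

Definition gabor_frame g alpha beta :=
  exists A B : R, [/\ 0 < A, 0 < B & forall f, in_L2 f ->
    let s := (\esum_(kn in [set: 'rV[int]_d * 'rV[int]_d])
                (rnorm (L2dot dot f (gabor g alpha beta kn)) ^+ 2)%:E)%E in
    (A%:E * L2norm f ^+ 2 <= s)%E /\ (s <= B%:E * L2norm f ^+ 2)%E].

(* [h] is the unconditional sum, in L^2, of the family [u]; it is determined up
   to almost everywhere equality. *)
Definition has_L2sum {I : choiceType} (u : I -> 'rV[R]_d -> H) h :=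
  in_L2 h /\
  forall e : R, 0 < e -> exists F0 : {fset I}, forall F : {fset I},
    (F0 `<=` F)%fset ->
    (L2norm (fun x => h x - \sum_(i <- F) u i x)%R < e%:E)%E.

(* The graph of the frame operator: S_g f = h. *)
Definition frame_operator g alpha beta f h :=
  has_L2sum (fun kn x => L2dot dot f (gabor g alpha beta kn) *:
                         gabor g alpha beta kn x) h.

(* gtilde = S_g^-1 g; for a frame, S_g is a bijection of L^2, so that this
   determines gtilde up to almost everywhere equality. *)
Definition dual_window g alpha beta gtilde :=
  in_L2 gtilde /\ frame_operator g alpha beta gtilde g.

End gabor.

(* Main.v *)
(* Testing the frame operator S against Fejer-weighted finite sums shows that, on
   continuous functions h with summable bounds over the cells of the lattice
   beta^-1 Z^d, it is given by Walnut's absolutely convergent series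
     S h (y) = beta^-d sum_k sum_m <h, g_k>(y + m / beta) g_k(y),  g_k = T_(alpha k) g,
   so that S preserves such functions and commutes with beta^-1-periodic multipliers.
   Let r_0 = g and r_(N+1) = r_N - S r_N / B.  For rho = 1 - A / B the L^2 contraction
   |v - S v / B|^2 <= rho |v|^2 applies to v = chi r_N for every periodic chi; taking
   for chi Dirichlet kernels centred at x0, whose squared moduli are Fejer kernels,
   localises it to |r_N(x0)|^2 <= C rho^N, uniformly in x0.  Hence the partial sums of
   B^-1 sum_N r_N, which converge to S^-1 g in L^2, also converge uniformly. *)

(* The inverse of S_g lives on L^2, where functions have no values at points, so uniform convergence
   of the Neumann series needs more than the L^2 contraction. The extra information is that, by
   Walnut's series, S h on a coset x0 + beta^-1 Z^d depends only on h on that coset: S is a field of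
   operators on the l^2 spaces of the cosets. A periodic multiplier whose squared modulus is a Fejer
   kernel restricts an L^2 inequality to one coset. In the limit the sum over m of |r_N(x0 + m /
   beta)|^2 is at most rho^N times the same sum for g, and the latter is at most the square of an
   l^1 bound of g, uniform in x0. The cell bounds of the r_N themselves may grow with N; they serve
   only to give the pointwise series a meaning. Cesaro weights are used because the plain Fourier
   sums of a continuous function may diverge at a point, while Fejer means converge and are
   dominated. *)
From HB Require Import structures.
Require Import Defs.
From mathcomp Require Import all_boot all_order all_algebra finmap.
From mathcomp Require Import all_classical all_reals all_analysis.
From mathcomp Require Import measurable_realfun ess_sup_inf.
From mathcomp Require Import complex sesquilinear ring lra zify.
Set Implicit Arguments.
Unset Strict Implicit.
Unset Printing Implicit Defensive.
Import Order.TTheory GRing.Theory Num.Theory Num.Def.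
Import numFieldNormedType.Exports.
Local Open Scope classical_set_scope.
Local Open Scope ring_scope.
Local Open Scope complex_scope.

(** * Norms and inner products *)

Section rnorm.
Context {R : realType}.
Implicit Types (V : normedZmodType R[i]) (z : R[i]).

Lemma rnormE V (v : V) : `|v| = (rnorm v)%:C.
Proof. by rewrite /rnorm RRe_real. Qed.

Lemma rnorm_ge0 V (v : V) : 0 <= rnorm v.
Proof. by have := normr_ge0 v; rewrite rnormE lecR. Qed.

Lemma rnormD V (u v : V) : rnorm (u + v) <= rnorm u + rnorm v.
Proof. by have := ler_normD u v; rewrite !rnormE -rmorphD lecR. Qed.

Lemma rnormN V (v : V) : rnorm (- v) = rnorm v.
Proof. by rewrite /rnorm normrN. Qed.

Lemma rnorm0 V : rnorm (0 : V) = 0.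
Proof. by rewrite /rnorm normr0. Qed.

Lemma rnorm_eq0 V (v : V) : (rnorm v == 0) = (v == 0).
Proof. by rewrite -[RHS]normr_eq0 rnormE -(inj_eq (@complexI R)). Qed.

Lemma rnorm_subC V (u v : V) : rnorm (u - v) = rnorm (v - u).
Proof. by rewrite -rnormN opprB. Qed.

Lemma rnormB V (u v : V) : rnorm (u - v) <= rnorm u + rnorm v.
Proof. by rewrite -(rnormN v) rnormD. Qed.

Lemma rnorm_sum V (I : Type) (s : seq I) (P : pred I) (F : I -> V) :
  rnorm (\sum_(i <- s | P i) F i) <= \sum_(i <- s | P i) rnorm (F i).
Proof.
elim/big_ind2 : _ => [|u x v y ux vy|//]; first by rewrite rnorm0.
by rewrite (le_trans (rnormD _ _))// lerD.
Qed.

Lemma rnormZ (V : normedModType R[i]) z (v : V) :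
  rnorm (z *: v) = rnorm z * rnorm v.
Proof.
apply: (@complexI R); rewrite rmorphM/=.
by rewrite -!rnormE normrZ.
Qed.

Lemma rnormC_def z : rnorm z = Num.sqrt (complex.Re z ^+ 2 + complex.Im z ^+ 2).
Proof. by rewrite /rnorm normc_def. Qed.

Lemma rnormC_sqr z : rnorm z ^+ 2 = complex.Re z ^+ 2 + complex.Im z ^+ 2.
Proof. by rewrite rnormC_def sqr_sqrtr// addr_ge0// sqr_ge0. Qed.

Lemma normRe_le z : `|complex.Re z| <= rnorm z.
Proof. by rewrite -lecR -rnormE normc_ge_Re. Qed.

Lemma normIm_le z : `|complex.Im z| <= rnorm z.
Proof.
rewrite -(@ler_pXn2r _ 2)// ?nnegrE ?rnorm_ge0//.
rewrite rnormC_sqr -normrX ger0_norm ?sqr_ge0//.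
by rewrite lerDr sqr_ge0.
Qed.

Lemma rnormC_le z : rnorm z <= `|complex.Re z| + `|complex.Im z|.
Proof.
rewrite -(@ler_pXn2r _ 2)// ?nnegrE ?rnorm_ge0// ?addr_ge0//.
rewrite rnormC_sqr -[complex.Re z ^+ 2]real_normK ?num_real//.
rewrite -[complex.Im z ^+ 2]real_normK ?num_real//.
have := normr_ge0 (complex.Re z); have := normr_ge0 (complex.Im z); nra.
Qed.

Lemma rnorm_real (x : R) : rnorm (x%:C) = `|x|.
Proof. by rewrite rnormC_def/= expr0n/= addr0 sqrtr_sqr. Qed.

Lemma rnormM z z' : rnorm (z * z') = rnorm z * rnorm z'.
Proof. by apply: (@complexI R); rewrite rmorphM/= -!rnormE normrM. Qed.

Lemma rnorm_conj z : rnorm (conjC z) = rnorm z.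
Proof. by rewrite /rnorm norm_conjC. Qed.

Lemma rnorm_cis (t : R) : rnorm (cis t) = 1.
Proof. by rewrite rnormC_def/= cos2Dsin2 sqrtr1. Qed.

Lemma ReB z z' : complex.Re (z - z') = complex.Re z - complex.Re z'.
Proof. exact: raddfB. Qed.

Lemma Re_sum (I : Type) (s : seq I) (F : I -> R[i]) :
  complex.Re (\sum_(i <- s) F i) = \sum_(i <- s) complex.Re (F i).
Proof. exact: raddf_sum. Qed.

Lemma Re_mul_conj z : complex.Re (z * conjC z) = rnorm z ^+ 2.
Proof. by rewrite rnormC_sqr; case: z => a b /=; ring. Qed.

Lemma Re_conj z : complex.Re (conjC z) = complex.Re z.
Proof. by case: z. Qed.

Lemma rnorm1 : rnorm (1 : R[i]) = 1.
Proof. by rewrite -[1]/(1%:C) rnorm_real normr1. Qed.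

Lemma cisD (s t : R) : cis (s + t) = cis s * cis t.
Proof. by rewrite /cis cosD sinD; apply/eqP; rewrite eq_complex/= eqxx/= addrC. Qed.

Lemma cis0 : cis (0 : R) = 1.
Proof. by rewrite /cis cos0 sin0. Qed.

Lemma cisN (t : R) : cis (- t) = conjC (cis t).
Proof. by rewrite /cis cosN sinN. Qed.

Lemma cis2piz (k : int) : cis (2 * pi * k%:~R : R) = 1.
Proof.
suff H (n : nat) : cis (2 * pi * n%:R : R) = 1.
  case: k => n; first exact: H.
  by rewrite NegzE mulrNz mulrN cisN (H n.+1) conjC1.
elim: n => [|n IH]; first by rewrite mulr0 cis0.
rewrite -[n.+1%:R]natr1 mulrDr mulr1 cisD IH mul1r /cis.
by rewrite mulr_natl cos2pi sin2pi.
Qed.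

End rnorm.

Section dot.
Context {R : realType} {H : completeNormedModType R[i]} (dot : {dot H for conjC}).
Hypothesis hilb : hilbert_norm dot.

Lemma Re_dotvv v : complex.Re (dot v v) = rnorm v ^+ 2.
Proof. by rewrite -hilb rnormE -rmorphXn. Qed.

Lemma dotvv v : dot v v = (rnorm v ^+ 2)%:C.
Proof. by rewrite -hilb rnormE -rmorphXn. Qed.

Lemma dotC u v : dot u v = conjC (dot v u).
Proof. by rewrite (hermC dot)/= expr0 mul1r. Qed.

Lemma dotZr (z : R[i]) u v : dot u (z *: v) = conjC z * dot u v.
Proof. by rewrite linearZr_LR. Qed.

Lemma dotZl (z : R[i]) u v : dot (z *: u) v = z * dot u v.
Proof. by rewrite linearZl_LR. Qed.

Lemma rnormB_sqr u v :
  rnorm (u - v) ^+ 2 = rnorm u ^+ 2 + rnorm v ^+ 2 - 2 * complex.Re (dot u v).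
Proof.
apply: (@complexI R); rewrite -dotvv.
rewrite linearBl !linearBr/= !dotvv [dot v u]dotC.
case: (dot u v) => a b; apply/eqP; rewrite eq_complex/=; apply/andP.
split; apply/eqP; ring.
Qed.

(** Cauchy-Schwarz, read off from the squared norm of [u] minus its orthogonal projection on [v]. *)
Lemma rnorm_dot u v : rnorm (dot u v) <= rnorm u * rnorm v.
Proof.
have [->|v0] := eqVneq v 0.
  by rewrite linear0r rnorm0 mulr_ge0 ?rnorm_ge0.
have N0 : 0 < rnorm v by rewrite lt_neqAle rnorm_ge0 andbT eq_sym rnorm_eq0.
set d := dot u v.
have := sqr_ge0 (rnorm (u - (d * ((rnorm v ^- 2)%:C)) *: v)).
rewrite rnormB_sqr dotZr -/d rnormZ rnormM rnorm_real ger0_norm ?invr_ge0 ?sqr_ge0//.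
have -> : complex.Re (conjC (d * (rnorm v ^- 2)%:C) * d) = rnorm d ^+ 2 * rnorm v ^- 2.
  rewrite rnormC_sqr; case: (d) => a b /=; ring.
have -> : rnorm d * rnorm v ^- 2 * rnorm v = rnorm d / rnorm v.
  by field; rewrite gt_eqF.
rewrite expr_div_n => le0.
rewrite -(@ler_pXn2r _ 2)// ?nnegrE ?mulr_ge0 ?rnorm_ge0// exprMn.
rewrite -ler_pdivrMr ?exprn_gt0//; lra.
Qed.

End dot.

(** * Borel measurability *)

Section topology.
Context {R : realType}.

Lemma cvg_rnormP (V : normedModType R[i]) T (F : set_system T) (FF : Filter F)
    (f : T -> V) l :
  f @ F --> l <-> forall e : R, 0 < e -> \forall t \near F, rnorm (l - f t) < e.
Proof.
split.
  move=> /cvgrPdist_lt h e e0.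
  have := h e%:C; rewrite ltcR => /(_ e0); apply: filterS => t.
  by rewrite rnormE ltcR.
move=> h; apply/cvgrPdist_lt => -[e e']; rewrite ltcE/= => /andP[/eqP -> e0].
by apply: filterS (h e e0) => t; rewrite rnormE ltcR.
Qed.

Lemma cauchy_rnorm_cvg (V : completeNormedModType R[i]) (u : nat -> V) :
  (forall e : R, 0 < e ->
     exists N, forall m n, (N <= m)%N -> (N <= n)%N -> rnorm (u m - u n) < e) ->
  cvgn u.
Proof.
move=> h; apply/cauchy_cvgP/cauchyP => -[e e'].
rewrite ltcE/= => /andP[/eqP -> e0].
have [N hN] := h e e0; exists (u N); exists N => // n /= Nn.
by rewrite -ball_normE/= rnormE ltcR hN.
Qed.

Lemma continuous_rnormP (V : normedModType R[i]) (T : topologicalType) (f : T -> V) :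
  continuous f <-> forall x (e : R), 0 < e -> \forall y \near x, rnorm (f x - f y) < e.
Proof. by split=> [h x|h x]; apply/cvg_rnormP => //; exact: h. Qed.

(** Stated for a bare real distance, because the norm of ['rV[R]_n] takes values in R and that of H
    in R[i]; both are instances. *)
Lemma dist_second_countable (T : topologicalType) (dist : T -> T -> R) :
  (forall x y, dist x y = dist y x) ->
  (forall x y z, dist x z <= dist x y + dist y z) ->
  (forall x A, nbhs x A <-> exists2 e : R, 0 < e & forall y, dist x y < e -> A y) ->
  Defs.separable T -> @second_countable T.
Proof.
move=> dC dt nb [D cD dD].
pose B := fun p : T * nat => [set y | dist p.1 y < p.2.+1%:R^-1].
have oB p : open (B p).
  rewrite openE => y /= py; apply/nb; exists (p.2.+1%:R^-1 - dist p.1 y).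
    by rewrite subr_gt0.
  move=> z yz; rewrite /B/=; by apply: le_lt_trans (dt _ y _) _; rewrite addrC -ltrBrDr.
exists (B @` (D `*` [set: nat])).
  apply: sub_countable (card_image_le _ _) _; exact: countableX.
split; first by move=> _ [p _ <-].
move=> x A /nb[e e0 xA].
have [n ne] : exists n, n.+1%:R^-1 < e / 2.
  have [n _ nP] := near_infty_natSinv_lt (PosNum (divr_gt0 e0 (ltr0n _ 2))).
  by exists n; exact: nP (leqnn n).
have x0 : B (x, n) x.
  have h : nbhs x [set y | dist x y < n.+1%:R^-1] by apply/nb; exists n.+1%:R^-1.
  exact: (nbhs_singleton h).
have [c [xc Dc]] := dD _ (ex_intro _ x x0) (oB (x, n)).
exists (B (c, n)).
  by split; [exists (c, n)|rewrite /B/= dC].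
move=> y; rewrite /B/= in xc * => cy; apply: xA.
apply: le_lt_trans (dt _ c _) _.
move: (n.+1%:R^-1) ne xc cy => r ne xc cy; lra.
Qed.

Lemma countable_bigcup_measurable {d} {T : measurableType d} U (D : set U)
    (F : U -> set T) : countable D ->
  (forall i, D i -> measurable (F i)) -> measurable (\bigcup_(i in D) F i).
Proof.
rewrite -(eq_countable (card_setT _)) => cD mF; rewrite bigcup_set_type.
by apply: countable_bigcupT_measurable => // -[i Di]; apply: mF; exact: set_mem.
Qed.

Definition borel_fun {d} {T : measurableType d} {X : topologicalType} (f : T -> X) :=
  forall U, open U -> measurable (f @^-1` U).

(** Second countability makes an open subset of X * Y a countable union of open boxes, whose
    preimages are intersections of two measurable sets. Separability of H enters the proof through
    this lemma. *)
Lemma borel_fun2 {d} {T : measurableType d} {X Y Z : topologicalType}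
    (f : T -> X) (g : T -> Y) (F : X -> Y -> Z) :
  @second_countable X -> @second_countable Y ->
  continuous (fun p : X * Y => F p.1 p.2) ->
  borel_fun f -> borel_fun g -> borel_fun (fun t => F (f t) (g t)).
Proof.
move=> [BX cX bX] [BY cY bY] cF mf mg U oU.
pose W := [set p : X * Y | U (F p.1 p.2)].
have oW : open W by move/continuousP : cF; exact.
pose I := [set p : set X * set Y | BX p.1 /\ BY p.2 /\ p.1 `*` p.2 `<=` W].
rewrite (_ : _ @^-1` _ = \bigcup_(p in I) (f @^-1` p.1 `&` g @^-1` p.2)); last first.
  apply/seteqP; split => t /=; last by move=> [p [_ [_ pW]] [/= ? ?]]; exact: (pW (f t, g t)).
  move=> Ut; have : nbhs (f t, g t) W by apply: open_nbhs_nbhs; split.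
  move=> [[P Q]/= [nP nQ] PQ].
  have [B [BB Bt] BP] := bX.2 _ _ nP.
  have [C [CC Ct] CQ] := bY.2 _ _ nQ.
  exists (B, C) => //=; split => //; split => // -[x y] /= [? ?].
  by apply: (PQ (x, y)); split => /=; [exact: BP|exact: CQ].
apply: countable_bigcup_measurable.
  apply: (@sub_countable _ _ _ (BX `*` BY)); last exact: countableX.
  by apply: subset_card_le => p [? []].
move=> [P Q]/= [BP [BQ _]]; apply: measurableI; [apply: mf; exact: bX.1|].
by apply: mg; exact: bY.1.
Qed.

Lemma continuous_borel_fun {d} {T : measurableType d} {X Y : topologicalType}
    (f : T -> X) (F : X -> Y) : continuous F -> borel_fun f -> borel_fun (F \o f).
Proof.
by move=> /continuousP cF mf U oU; rewrite comp_preimage; apply: mf; exact: cF.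
Qed.

Lemma borel_measurable {d} {T : measurableType d} (f : T -> R) :
  borel_fun f <-> measurable_fun setT f.
Proof.
split=> mf.
  move=> _; apply: (measurability _ (measurable_realfun.RGenOpens.measurableE R)) => //.
  move=> _ [_ [a [b ->]] <-]; rewrite setTI; apply: mf; exact: interval_open.
move=> U oU; rewrite -[_ @^-1` _]setTI; apply: mf => //.
exact: measurable_realfun.open_measurable.
Qed.

Lemma rV_norm_ltP n (x : 'rV[R]_n) (e : R) : 0 < e ->
  `|x| < e <-> forall i, `|x ord0 i| < e.
Proof.
move=> e0; rewrite {1}/normr/= mx_normrE; split.
  by move=> /bigmax_ltP[_ h] i; exact: (h (ord0, i)).
by move=> h; apply/bigmax_ltP; split => // -[i j] _ /=; rewrite ord1.
Qed.

Lemma rV_second_countable n : @second_countable 'rV[R]_n.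
Proof.
apply: (@dist_second_countable _ (fun x y => `|x - y|)).
- by move=> x y; rewrite distrC.
- by move=> x y z; exact: ler_distD.
- move=> x A; split.
    by move=> /nbhs_ballP[e e0 xA]; exists e => // y xy; apply: xA; rewrite -ball_normE.
  by move=> [e e0 xA]; apply/nbhs_ballP; exists e => // y; rewrite -ball_normE; exact: xA.
exists (range (fun q : 'rV[rat]_n => map_mx ratr q)).
  by apply: sub_countable (card_image_le _ _) _.
move=> O [x Ox] oO.
have /nbhs_ballP[e/= e0 xO] : nbhs x O by exact: open_nbhs_nbhs.
have hq i : {q : rat | `|x ord0 i - ratr q| < e}.
  apply: cid; have [|q] := @rat_in_itvoo _ (x ord0 i) (x ord0 i + e).
    by rewrite ltrDl.
  rewrite in_itv/= => /andP[xq qx]; exists q.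
  by rewrite ltr_distlC qx andbT (lt_trans _ xq)// gtrBl.
pose q : 'rV[rat]_n := \row_i (sval (hq i)).
exists (map_mx ratr q); split; last by exists q.
apply: xO; rewrite -ball_normE/=; apply/rV_norm_ltP => // i; rewrite !mxE.
by case: (hq i).
Qed.

Lemma hilbert_second_countable (H : normedModType R[i]) :
  Defs.separable H -> @second_countable H.
Proof.
apply: (@dist_second_countable _ (fun x y => rnorm (x - y))).
- by move=> x y; rewrite rnorm_subC.
- by move=> x y z; rewrite -{1}(subrK y x) -addrA rnormD.
- move=> x A; split.
    move=> /nbhs_ballP[[e e']/=]; rewrite ltcE/= => /andP[/eqP -> e0] xA; exists e => // y xy; apply: xA.
    by rewrite -ball_normE/= rnormE ltcR.
  move=> [e e0 xA]; apply/nbhs_ballP; exists e%:C; first by rewrite /= ltcR.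
  by move=> y; rewrite -ball_normE/= rnormE ltcR; exact: xA.
Qed.

(** The sigma-algebra is generated by the coordinates. A ball of the max norm is a box, hence
    measurable, and countably many rational balls exhaust an open set. *)
Lemma rV_open_measurable n (U : set 'rV[R]_n) : open U -> measurable U.
Proof.
move=> oU; pose c (q : 'rV[rat]_n) : 'rV[R]_n := map_mx ratr q.
pose D := [set p : 'rV[rat]_n * nat | ball (c p.1) p.2.+1%:R^-1 `<=` U].
rewrite (_ : U = \bigcup_(p in D) ball (c p.1) p.2.+1%:R^-1).
  apply: countable_bigcup_measurable => // -[q k] _ /=.
  rewrite (_ : ball _ _ = \bigcap_(i in [set: 'I_n])
     ((fun x : 'rV[R]_n => x ord0 i) @^-1` (ball (c q ord0 i) k.+1%:R^-1))).
    apply: fin_bigcap_measurable => // i _; rewrite -[X in measurable X]setTI.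
    apply: measurable_coord => //; apply: measurable_realfun.open_measurable.
    exact: ball_open.
  apply/seteqP; split=> x.
    rewrite -ball_normE/= => /rV_norm_ltP h i _ /=.
    by rewrite -ball_normE/=; have := h _ i; rewrite !mxE; exact.
  move=> h; rewrite -ball_normE/=; apply/rV_norm_ltP => // i.
  by have := h i I; rewrite -ball_normE/= !mxE.
apply/seteqP; split=> [x Ux|x [p Dp]]; last exact: Dp.
have /nbhs_ballP[e/= e0 xU] : nbhs x U by exact: open_nbhs_nbhs.
have [k _ kP] := near_infty_natSinv_lt (PosNum (divr_gt0 e0 (ltr0n _ 2))).
have {kP}ke := kP k (leqnn k).
have hq i : {q : rat | `|x ord0 i - ratr q| < k.+1%:R^-1}.
  apply: cid; have [|q] := @rat_in_itvoo _ (x ord0 i) (x ord0 i + k.+1%:R^-1).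
    by rewrite ltrDl.
  rewrite in_itv/= => /andP[xq qx]; exists q.
  by rewrite ltr_distlC qx andbT (lt_trans _ xq)// gtrBl invr_gt0 ltr0Sn.
pose q : 'rV[rat]_n := \row_i (sval (hq i)).
have xq : `|x - c q| < k.+1%:R^-1.
  by apply/rV_norm_ltP => // i; rewrite !mxE; case: (hq i).
exists (q, k); last by rewrite -ball_normE/= distrC.
move=> y; rewrite -ball_normE/= => qy; apply: xU; rewrite -ball_normE/=.
rewrite -(subrK (c q) x) -addrA (le_lt_trans (ler_normD _ _))//.
rewrite /= in ke; move: (k.+1%:R^-1) ke xq qy => r ke xq qy; lra.
Qed.

Lemma continuous_borel n (Y : topologicalType) (f : 'rV[R]_n -> Y) :
  continuous f -> borel_fun f.
Proof. by move=> /continuousP cf U oU; apply: rV_open_measurable; exact: cf. Qed.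
End topology.

(** * Lebesgue measure on row vectors *)

Section lebesgue_rV_theory.
Context {R : realType}.
Local Open Scope ereal_scope.

(** Lebesgue measure is determined by its values on the intervals ]a, b], so the shifted measure is
    compared with it there only. *)
Lemma lebesgue_measure_shift (t : R) (A : set (measurableTypeR R)) :
  measurable A ->
  lebesgue_measure ((fun x : R => (x + t)%R) @^-1` A) = (@lebesgue_measure R) A.
Proof.
move=> mA.
have mf : measurable_fun setT (fun x : measurableTypeR R => (x + t)%R : measurableTypeR R).
  exact: measurable_funD.
pose mu' : measure _ R := pushforward (@lebesgue_measure R)
  (fun x : measurableTypeR R => (x + t)%R : measurableTypeR R).
apply/esym; apply: (@lebesgue_measure_unique _ (mu' mf)) => //.
move=> _ [[a b] _ <-] /=; rewrite /mu' /pushforward.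
rewrite (_ : _ @^-1` _ = `](a - t)%R, (b - t)%R]%classic).
  rewrite !lebesgue_measure_itv /= !lte_fin ltrD2r; case: ifP => // _.
  by rewrite -!EFinB; congr EFin; ring.
by apply/seteqP; split=> x; rewrite /= !in_itv/= ltrBlDr lerBrDr.
Qed.

Lemma ge0_integral_shiftR (t : R) (f : measurableTypeR R -> \bar R) :
  measurable_fun [set: measurableTypeR R] f -> (forall x, 0 <= f x) ->
  \int[@lebesgue_measure R]_x f (x + t)%R = \int[@lebesgue_measure R]_x f x.
Proof.
move=> mf f0.
have mt : measurable_fun setT (fun x : measurableTypeR R => (x + t)%R : measurableTypeR R).
  exact: measurable_funD.
have := ge0_integral_pushforward mt (@lebesgue_measure R) measurableT mf (fun x _ => f0 x).
rewrite preimage_setT => <-.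
apply: eq_measure_integral => A mA _; exact: lebesgue_measure_shift.
Qed.

Lemma ge0_integral_consrV n (f : 'rV[R]_n.+1 -> \bar R) :
  measurable_fun [set: 'rV[R]_n.+1] f -> (forall x, 0 <= f x) ->
  \int[lebesgue_rV n.+1]_x f x =
  \int[@lebesgue_measure R]_a \int[lebesgue_rV n]_x f (consrV (a, x)).
Proof.
move=> mf f0.
have := ge0_integral_pushforward (@measurable_consrV R n)
  (@lebesgue_measure R \x lebesgue_rV n) measurableT mf (fun x _ => f0 x).
rewrite preimage_setT => fE.
rewrite [LHS]fE fubini_tonelli1//.
  by apply: measurableT_comp => //; exact: measurable_consrV.
by move=> x; exact: f0.
Qed.

Lemma consrVD n a (x : 'rV[R]_n) (y : 'rV[R]_n.+1) :
  (consrV (a, x) + y = consrV (a + y ord0 ord0, x + \row_j y ord0 (lift ord0 j)))%R.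
Proof.
by apply/rowP => i; rewrite !mxE; case: unliftP => [j|] -> /=; rewrite ?mxE.
Qed.

Lemma measurable_addrV n (y : 'rV[R]_n) :
  measurable_fun setT (fun x : 'rV[R]_n => (x + y)%R).
Proof.
apply: measurable_fun_rV => i; under eq_fun do rewrite mxE.
by apply: measurable_funD => //; exact: measurable_coord.
Qed.

(** Induction on the dimension: Tonelli splits off the first coordinate, and both iterated integrals
    are shift invariant. *)
Lemma ge0_integral_shift n (y : 'rV[R]_n) (f : 'rV[R]_n -> \bar R) :
  measurable_fun [set: 'rV[R]_n] f -> (forall x, 0 <= f x) ->
  \int[lebesgue_rV n]_x f (x + y)%R = \int[lebesgue_rV n]_x f x.
Proof.
elim: n y f => [|n IH] y f mf f0.
  by apply: eq_integral => x _; congr f; apply/rowP => -[].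
have mfc : measurable_fun setT (f \o @consrV R n).
  by apply: (measurableT_comp mf); exact: measurable_consrV.
rewrite (ge0_integral_consrV mf f0).
rewrite (@ge0_integral_consrV _ (fun x => f (x + y)%R)); last by move=> x; exact: f0.
  under eq_integral.
    move=> a _.
    under eq_integral do rewrite consrVD.
    rewrite (IH _ (fun x => f (consrV (a + y ord0 ord0, x)%R))); last by move=> x; exact: f0.
      over.
    apply: (measurableT_comp mf); apply: measurableT_comp; first exact: measurable_consrV.
    exact: measurable_fun_pair.
  rewrite (@ge0_integral_shiftR _ (fun a => \int[lebesgue_rV n]_x f (consrV (a, x))))//.
    apply: (@measurable_fun_fubini_tonelli_F _ _ _ _ _ _ (f \o @consrV R n)) => //.
    by move=> x; exact: f0.
  by move=> a; apply: integral_ge0 => x _; exact: f0.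
by apply: (measurableT_comp mf); exact: measurable_addrV.
Qed.

Lemma measurable_prod_coord n (f : 'I_n -> R -> R) :
  (forall i, measurable_fun setT (f i)) ->
  measurable_fun setT (fun x : 'rV[R]_n => (\prod_i f i (x ord0 i))%R).
Proof.
move=> mf; apply: measurable_prod => i _.
by apply: (measurableT_comp (mf i)); exact: measurable_coord.
Qed.

Lemma ge0_integral_prod n (f : 'I_n -> R -> R) :
  (forall i, measurable_fun setT (f i)) -> (forall i t, (0 <= f i t)%R) ->
  \int[lebesgue_rV n]_x (\prod_i f i (x ord0 i))%:E =
  \big[*%E/1]_i \int[@lebesgue_measure R]_t (f i t)%:E.
Proof.
elim: n f => [|n IH] f mf f0.
  rewrite big_ord0; under eq_integral do rewrite big_ord0.
  by rewrite integral_cst//= diracE in_setT mule1.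
rewrite ge0_integral_consrV; last by move=> x; rewrite lee_fin prodr_ge0.
  rewrite big_ord_recl -IH//.
  under eq_integral => a _.
    under eq_integral.
      move=> x _; rewrite big_ord_recl mxE unlift_none/=.
      under eq_bigr do rewrite mxE liftK/=.
      rewrite EFinM; over.
    rewrite ge0_integralZl_EFin//.
    - over.
    - by move=> x _; rewrite lee_fin prodr_ge0.
    - by apply/measurable_EFinP; exact: (measurable_prod_coord (fun i => mf (lift ord0 i))).
  rewrite ge0_integralZr//.
  - by apply/measurable_EFinP; exact: mf.
  - by move=> x _; rewrite lee_fin.
  - by apply: integral_ge0 => x _; rewrite lee_fin prodr_ge0.
by apply/measurable_EFinP; exact: (measurable_prod_coord mf).
Qed.

End lebesgue_rV_theory.

Lemma cvg_bigsum {K : numFieldType} {V : normedModType K} {T I : Type}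
    (F : set_system T) {FF : Filter F} (s : seq I) (P : pred I)
    (f : I -> T -> V) (l : I -> V) :
  (forall i, P i -> f i t @[t --> F] --> l i) ->
  \sum_(i <- s | P i) f i t @[t --> F] --> \sum_(i <- s | P i) l i.
Proof.
move=> fl; elim: s => [|i s IH].
  by rewrite big_nil; under eq_fun do rewrite big_nil; exact: cvg_cst.
rewrite big_cons; under eq_fun do rewrite big_cons.
by case: ifP => // Pi; apply: cvgD => //; exact: fl.
Qed.

Lemma continuous_bigsum {K : numFieldType} {V : normedModType K}
    {T : topologicalType} {I : Type} (s : seq I) (f : I -> T -> V) :
  (forall i, continuous (f i)) -> continuous (fun x => \sum_(i <- s) f i x).
Proof. by move=> cf x; apply: cvg_bigsum => i _; exact: cf. Qed.

(** * Summable families *)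

Section enumeration.
Context {I : countType}.
Implicit Types (F : {fset I}).

(* An increasing exhaustion of [I] by finite sets. *)
Definition enumset N : {fset I} :=
  [fset i in pmap (@choice.pickle_inv I) (iota 0 N)]%fset.

Lemma in_enumset N i : (i \in enumset N) = (choice.pickle i < N)%N.
Proof.
rewrite !inE mem_pmap; apply/mapP/idP => [[j]|iN].
  rewrite mem_iota add0n => /andP[_ jN] /esym ji.
  by have := @pickle_invK I j; rewrite ji/= => ->.
by exists (choice.pickle i); rewrite ?mem_iota// pickleK_inv.
Qed.

Lemma enumset_sub F : exists N, forall M, (N <= M)%N -> (F `<=` enumset M)%fset.
Proof.
exists (\max_(i <- F) (choice.pickle i).+1)%N => M NM.
apply/fsubsetP => i iF; rewrite in_enumset; apply: leq_trans NM.
by rewrite (big_fsetD1 i)//= leq_max leqnn.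
Qed.

(** Numbers below N that encode no index contribute 0; finite sums over [I] thus become initial sums
    of an ordinary series. *)
Lemma sum_enumset (V : nmodType) (f : I -> V) N :
  \sum_(i <- enumset N) f i = \sum_(j < N) oapp f 0 (@choice.pickle_inv I j).
Proof.
elim: N => [|N IH].
  by rewrite big_ord0 big1_fset// => i; rewrite in_enumset.
rewrite big_ord_recr/= -IH; case E : (@choice.pickle_inv I N) => [i|]/=.
  have iN : choice.pickle i = N by have := @pickle_invK I N; rewrite E.
  rewrite (big_fsetD1 i)/=; last by rewrite in_enumset iN.
  rewrite addrC; congr (_ + _); congr (\sum_(_ <- enum_fset _) _); apply/fsetP => j.
  rewrite in_fsetD1 !in_enumset ltnS leq_eqVlt -iN.
  have [->|ji] := eqVneq j i; first by rewrite ltnn.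
  by rewrite /= orb_idl// => /eqP /(pcan_inj choice.pickleK) ij; rewrite ij eqxx in ji.
rewrite addr0; congr (\sum_(_ <- enum_fset _) _); apply/fsetP => j.
rewrite !in_enumset ltnS leq_eqVlt; have [jN|//] := eqVneq (choice.pickle j) N.
by rewrite -jN pickleK_inv in E.
Qed.

Lemma sum_fsetD (V : nmodType) (b : I -> V) F G : (F `<=` G)%fset ->
  \sum_(i <- G) b i = \sum_(i <- F) b i + \sum_(i <- (G `\` F)%fset) b i.
Proof.
move=> FG; rewrite (big_fsetID _ (mem F) G)/=; congr +%R; apply: eq_fbigl => i.
  by rewrite !inE/= andb_idl// => iF; exact: (fsubsetP FG).
by rewrite !inE/= andbC.
Qed.

Context {R : realType}.
Implicit Types (b : I -> R) (S : R).

(** Carrying an explicit bound S keeps the l^1 estimates inside R and makes them compose. *)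
Definition summable_le b S :=
  (forall i, 0 <= b i) /\ forall F, \sum_(i <- F) b i <= S.

Definition total b : R := limn (fun N => \sum_(i <- enumset N) b i).

Lemma sum_fset_le b F G : (forall i, 0 <= b i) -> (F `<=` G)%fset ->
  \sum_(i <- F) b i <= \sum_(i <- G) b i.
Proof.
by move=> b0 FG; rewrite (sum_fsetD _ FG) lerDl sumr_ge0.
Qed.

Lemma enumset_mono M N : (M <= N)%N -> (enumset M `<=` enumset N)%fset.
Proof.
by move=> MN; apply/fsubsetP => i; rewrite !in_enumset => /leq_trans; exact.
Qed.

Lemma total_cvg b S : summable_le b S ->
  (fun N => \sum_(i <- enumset N) b i) @ \oo --> total b.
Proof.
move=> [b0 bS]; apply: nondecreasing_is_cvgn.
  by move=> M N MN; apply: sum_fset_le => //; exact: enumset_mono.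
by exists S => _ [N _ <-].
Qed.

Lemma sum_le_total b S F : summable_le b S -> \sum_(i <- F) b i <= total b.
Proof.
move=> bS; have [N hN] := enumset_sub F.
apply: le_trans (sum_fset_le bS.1 (hN N (leqnn N))) _.
apply: nondecreasing_cvgn_le.
  by move=> p q pq; apply: sum_fset_le; [exact: bS.1|exact: enumset_mono].
by apply/cvg_ex; exists (total b); exact: total_cvg bS.
Qed.

Lemma total_le b S : summable_le b S -> total b <= S.
Proof.
move=> bS; apply: limr_le; first by apply/cvg_ex; exists (total b); exact: total_cvg bS.
by apply: nearW => N; exact: bS.2.
Qed.

Lemma total_ge0 b S : summable_le b S -> 0 <= total b.
Proof. by move=> bS; have := sum_le_total fset0 bS; rewrite big_seq_fset0. Qed.

Lemma total_tail b S e : summable_le b S -> 0 < e ->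
  exists N, total b - e <= \sum_(i <- enumset N) b i.
Proof.
move=> bS e0; have /cvgrPdist_le/(_ e e0)[N _ hN] := total_cvg bS.
exists N; have := hN N (leqnn N); rewrite /= ler_norml => /andP[_ h]; lra.
Qed.

Lemma summable_leW b S S' : summable_le b S -> S <= S' -> summable_le b S'.
Proof. by move=> [b0 bS] SS; split => // F; exact: le_trans (bS F) SS. Qed.

Lemma summable_le_mono b b' S : (forall i, 0 <= b' i <= b i) -> summable_le b S ->
  summable_le b' S.
Proof.
move=> bb [b0 bS]; split => [i|F]; first by have /andP[] := bb i.
by apply: le_trans (bS F); apply: ler_sum => i _; have /andP[] := bb i.
Qed.

Lemma summable_leZ b S c : 0 <= c -> summable_le b S -> summable_le (fun i => c * b i) (c * S).
Proof.
move=> c0 [b0 bS]; split => [i|F]; first by rewrite mulr_ge0.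
by rewrite -mulr_sumr ler_wpM2l.
Qed.

Lemma summable_le_inj (h : I -> I) b S : injective h -> summable_le b S ->
  summable_le (fun i => b (h i)) S.
Proof.
move=> ih [b0 bS]; split => // F.
have := bS (h @` F)%fset; rewrite big_imfset//= => x y _ _; exact: ih.
Qed.

Lemma summable_le_setD b S e : summable_le b S -> 0 < e -> exists N,
  summable_le (fun i => b i * (i \notin enumset N)%:R) e.
Proof.
move=> bS e0; have [N hN] := total_tail bS e0; exists N; split.
  by move=> i; rewrite mulr_ge0// bS.1.
move=> F; have := sum_le_total (enumset N `|` F)%fset bS.
move: hN; generalize (enumset N) => E hN.
rewrite (sum_fsetD _ (fsubsetUl E F)) fsetDUl fsetDv fset0U.
have -> : \sum_(i <- F) b i * (i \notin E)%:R = \sum_(i <- (F `\` E)%fset) b i.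
  rewrite (big_fsetID _ (fun x => x \notin E) F)/= [X in _ + X]big1_fset ?addr0//.
    apply: eq_fbig => i; rewrite !inE/=; first by rewrite andbC.
    by move=> /andP[_ ->]; rewrite mulr1.
  by move=> i; rewrite !inE/= => /andP[_ /negbTE ->]; rewrite mulr0.
lra.
Qed.

(** Tonelli for a finite sum of infinite sums: an iterated total is bounded through finite double
    sums taken in the other order. *)
Lemma total_sum {J : choiceType} (G : {fset J}) (c : J -> I -> R) (S : J -> R) (S' : R) :
  (forall j, summable_le (c j) (S j)) ->
  (forall F, \sum_(i <- F) \sum_(j <- G) c j i <= S') ->
  \sum_(j <- G) total (c j) <= S'.
Proof.
move=> cS h.
have cv : (fun N => \sum_(j <- G) \sum_(i <- enumset N) c j i) @ \oo --> \sum_(j <- G) total (c j).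
  by apply: cvg_bigsum => j _; exact: total_cvg (cS j).
rewrite -(cvg_lim _ cv)//; apply: limr_le.
  by apply/cvg_ex; eexists; exact: cv.
by apply: nearW => N; rewrite exchange_big/=; exact: h.
Qed.

(** Dominated convergence for series, with a range of summation that grows with N. Domination is
    asked for 0 < N only, because it will come from Fejer kernels of positive order. *)
Lemma tannery (t : nat -> I -> R) b S : summable_le b S ->
  (forall N i, (0 < N)%N -> 0 <= t N i <= b i) ->
  (forall i e, 0 < e -> exists N0, forall N, (N0 <= N)%N -> t N i <= e) ->
  forall e, 0 < e -> exists N0, forall N, (N0 <= N)%N -> \sum_(i <- enumset N) t N i <= e.
Proof.
move=> bS tb t0 e e0; have e20 : 0 < e / 2 by lra.
have [M hM] := summable_le_setD bS e20.
(* Half of e is shared among the indices of [enumset M]; the added 1 keeps the denominator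
   positive. *)
pose e' := e / 2 / (1 + (#|` enumset M|)%:R).
have e'0 : 0 < e' by rewrite divr_gt0// ltr_wpDr.
have [f hf] : {f : I -> nat | forall i N, (f i <= N)%N -> t N i <= e'}.
  by have [f hf] := choice (fun i => t0 i e' e'0); exists f.
exists (\max_(i <- enumset M) f i + M).+1%N => N NN.
have MN : (M <= N)%N by lia.
have N0 : (0 < N)%N by lia.
rewrite (sum_fsetD _ (enumset_mono MN)).
have h1 : \sum_(i <- enumset M) t N i <= e / 2.
  apply: (@le_trans _ _ (\sum_(i <- enumset M) e')).
    rewrite !big_seq; apply: ler_sum => i iM; apply: hf.
    have : (f i <= \max_(i <- enumset M) f i)%N by rewrite (big_fsetD1 i)//= leq_maxl.
    lia.
  have e'E : e' * (1 + (#|` enumset M|)%:R) = e / 2 by rewrite divfK// gt_eqF// ltr_wpDr.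
  by rewrite big_const_seq count_predT iter_addr_0 -[e' *+ _]mulr_natr -e'E ler_pM2l// lerDr.
have h2 : \sum_(i <- (enumset N `\` enumset M)%fset) t N i <= e / 2.
  apply: le_trans (hM.2 (enumset N `\` enumset M)%fset).
  rewrite !big_seq; apply: ler_sum => i; rewrite in_fsetD => /andP[-> _].
  by rewrite mulr1; have /andP[] := tb N i N0.
lra.
Qed.

End enumeration.

(** * Fejer kernels *)

Section fejer_kernel.
Context {R : realType}.
Implicit Types (N : nat) (t : R).

(** The difference k = j - l occurs N - |k| times. Here [i] stands for k + N, and the two extreme
    terms have coefficient 0. *)
Lemma triangular_sum (V : pzRingType) (f : int -> V) N :
  \sum_(j < N) \sum_(l < N) f (j%:Z - l%:Z) =
  \sum_(i < (N + N).+1) (N%:Z - `|i%:Z - N%:Z|)%:~R * f (i%:Z - N%:Z).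
Proof.
elim: N => [|N IH].
  by rewrite big_ord0 big_ord_recl big_ord0 /= subrr mul0r addr0.
have -> : (N.+1 + N.+1).+1 = (N + N).+1.+2 by lia.
have trim (F : nat -> V) : F 0 = 0 -> F (N + N).+2 = 0 ->
    \sum_(i < (N + N).+3) F i = \sum_(i < (N + N).+1) F i.+1.
  by move=> F0 FN; rewrite big_ord_recl big_ord_recr/= F0 FN add0r addr0.
rewrite (trim (fun i => (N.+1%:Z - `|i%:Z - N.+1%:Z|)%:~R * f (i%:Z - N.+1%:Z))); last 2 first.
- by rewrite (_ : N.+1%:Z - `|_| = 0) ?mul0r//; lia.
- by rewrite (_ : N.+1%:Z - `|_| = 0) ?mul0r//; lia.
have -> : \sum_(i < (N + N).+1) (N.+1%:Z - `|i.+1%:Z - N.+1%:Z|)%:~R * f (i.+1%:Z - N.+1%:Z)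
   = \sum_(i < (N + N).+1) (N%:Z - `|i%:Z - N%:Z|)%:~R * f (i%:Z - N%:Z) +
     \sum_(i < (N + N).+1) f (i%:Z - N%:Z).
  rewrite -big_split/=; apply: eq_bigr => i _.
  rewrite (_ : i.+1%:Z - N.+1%:Z = i%:Z - N%:Z); last by lia.
  rewrite (_ : N.+1%:Z - _ = N%:Z - `|i%:Z - N%:Z| + 1); last by lia.
  by rewrite rmorphD/= mulrDl mul1r.
rewrite -IH big_ord_recr/=.
under eq_bigr do rewrite big_ord_recr/=.
rewrite big_split/= -!addrA; congr (_ + _).
rewrite -[RHS](big_mkord xpredT (fun i => f (i%:Z - N%:Z))) (@big_cat_nat _ _ _ N)/=; [|lia|lia].
rewrite big_mkord; congr (_ + _).
rewrite -(big_mkord xpredT (fun i => f (N%:Z - i%:Z))).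
rewrite big_nat_rev/= -[X in _ = \sum_(X <= _ < _) _](add0n N) big_addn (_ : ((N + N).+1 - N = N.+1)%N); last by lia.
rewrite !big_mkord; apply: eq_bigr => i _; congr f.
have := ltn_ord i; lia.
Qed.

Definition fejer_wt N (k : int) : R := 1 - `|k%:~R| / N%:R.

Variable beta : R.
Hypothesis beta0 : 0 < beta.
Let gam := beta^-1.

(** The Fejer kernel of period [beta^-1]. Written as a squared modulus, it is visibly nonnegative
    and directly comparable with [dirichlet]. *)
Definition fejer N t : R :=
  rnorm (\sum_(j < N) cis (2 * pi * (beta * j%:R * t))) ^+ 2 / N%:R.

Lemma fejer_ge0 N t : 0 <= fejer N t.
Proof. by rewrite divr_ge0 ?sqr_ge0. Qed.

Lemma fejerE N t : (fejer N t)%:C =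
  (N%:R^-1)%:C * \sum_(j < N) \sum_(l < N) cis (2 * pi * (beta * (j%:Z - l%:Z)%:~R * t)).
Proof.
rewrite /fejer mulrC rmorphM/=; congr (_ * _).
rewrite rmorphXn/= -rnormE normCK rmorph_sum mulr_suml.
apply: eq_bigr => j _; rewrite mulr_sumr; apply: eq_bigr => l _.
by rewrite /= -cisN -cisD; congr cis; rewrite rmorphB/=; ring.
Qed.

Lemma fejer_trig N t : (0 < N)%N -> (fejer N t)%:C =
  \sum_(i < (N + N).+1) (fejer_wt N (i%:Z - N%:Z))%:C * cis (2 * pi * (beta * (i%:Z - N%:Z)%:~R * t)).
Proof.
move=> N0; rewrite fejerE.
rewrite (triangular_sum (fun k => cis (2 * pi * (beta * k%:~R * t)))) mulr_sumr.
apply: eq_bigr => i _.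
have -> : fejer_wt N (i%:Z - N%:Z) = N%:R^-1 * (N%:Z - `|i%:Z - N%:Z|)%:~R.
  rewrite /fejer_wt [(N%:Z - _)%:~R]rmorphB/= -intr_norm mulrBr mulVf ?pnatr_eq0 ?gtn_eqF//.
  by rewrite mulrC.
by rewrite rmorphM/= rmorph_int [LHS]mulrA.
Qed.

Lemma fejer_cos N t : fejer N t =
  N%:R^-1 * \sum_(j < N) \sum_(l < N) cos (2 * pi * (beta * (j%:Z - l%:Z)%:~R * t)).
Proof.
have /(congr1 (@complex.Re R)) := fejerE N t.
have ReZ (x : R) (z : R[i]) : complex.Re (x%:C * z) = x * complex.Re z.
  by case: z => a b /=; rewrite mul0r subr0.
rewrite ReZ raddf_sum /= => ->; congr (_ * _).
by apply: eq_bigr => j _; rewrite raddf_sum.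
Qed.

Lemma fejer_continuous N : continuous (fejer N).
Proof.
rewrite (_ : fejer N = fun t => N%:R^-1 *
    \sum_(j < N) \sum_(l < N) cos (2 * pi * (beta * (j%:Z - l%:Z)%:~R * t))).
  move=> t; apply: cvgM; first exact: cvg_cst.
  apply: cvg_bigsum => j _; apply: cvg_bigsum => l _.
  apply: continuous_comp; last exact: continuous_cos.
  by apply: cvgM; [exact: cvg_cst|apply: cvgM; [exact: cvg_cst|exact: cvg_id]].
by apply/funext => t; rewrite fejer_cos.
Qed.

(** The exponential sum is geometric with ratio z, so |z - 1|^2 times its squared modulus is |z^N -
    1|^2 <= 4. On half a period the cosine decreases, hence |z - 1|^2 >= 2 - 2 cos (2 pi beta e). *)
Lemma fejer_tail N t (e : R) : (0 < N)%N -> 0 < e -> e <= `|t| <= gam / 2 ->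
  fejer N t <= (2 / (1 - cos (2 * pi * beta * e))) / N%:R.
Proof.
move=> N0 e0 /andP[et tg].
rewrite /fejer ler_pM2r ?invr_gt0 ?ltr0n//.
set z := cis (2 * pi * (beta * t)).
have tpi : 2 * pi * (beta * `|t|) <= pi.
  have : beta * `|t| <= 1 / 2.
    by rewrite -ler_pdivlMl// /gam mulrC in tg *; rewrite mul1r mulrC.
  have := pi_gt0 R; nra.
have epi : 2 * pi * beta * e <= 2 * pi * (beta * `|t|).
  by rewrite -!mulrA !ler_pM2l ?pi_gt0.
have e0' : 0 < 2 * pi * beta * e by rewrite !mulr_gt0 ?pi_gt0.
have cosle : cos (2 * pi * (beta * `|t|)) <= cos (2 * pi * beta * e).
  have [->//|ne] := eqVneq (2 * pi * beta * e) (2 * pi * (beta * `|t|)).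
  apply/ltW; rewrite ltr_cos ?in_itv/=; lra.
have c1 : cos (2 * pi * beta * e) < 1.
  have pi0 := pi_gt0 R.
  rewrite -[X in _ < X]cos0 ltr_cos ?in_itv/= ?lexx ?pi_ge0//.
  by rewrite (ltW e0') (le_trans epi).
have -> : \sum_(j < N) cis (2 * pi * (beta * j%:R * t)) = \sum_(j < N) z ^+ j.
  apply: eq_bigr => j _; elim: (nat_of_ord j) => [|k IH].
    by rewrite mulr0 mul0r mulr0 cis0 expr0.
  rewrite exprS -IH -cisD; congr cis; rewrite -natr1; ring.
have z1 : rnorm (z - 1) ^+ 2 = 2 - 2 * cos (2 * pi * (beta * t)).
  rewrite rnormC_sqr /= subr0; have := cos2Dsin2 (2 * pi * (beta * t)).
  lra.
have cosabs : cos (2 * pi * (beta * t)) = cos (2 * pi * (beta * `|t|)).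
  by have [t0|t0] := leP 0 t; [rewrite ger0_norm|rewrite ltr0_norm// !mulrN cosN].
have h : rnorm (z - 1) ^+ 2 * rnorm (\sum_(j < N) z ^+ j) ^+ 2 <= 4.
  rewrite -exprMn -rnormM -subrX1.
  have : rnorm (z ^+ N - 1) <= 2.
    rewrite (le_trans (rnormB _ _))// rnorm1.
    suff -> : rnorm (z ^+ N) = 1 by rewrite -[2]/(1 + 1).
    elim: (N) => [|k IH]; first by rewrite expr0 rnorm1.
    by rewrite exprS rnormM rnorm_cis mul1r.
  have := rnorm_ge0 (z ^+ N - 1); nra.
rewrite z1 cosabs in h.
rewrite ler_pdivlMr ?subr_gt0//.
have := sqr_ge0 (rnorm (\sum_(j < N) z ^+ j)); nra.
Qed.

Lemma sin_piz (k : int) : sin (pi * k%:~R : R) = 0.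
Proof.
suff H (n : nat) : sin (pi * n%:R : R) = 0.
  by case: k => n; [exact: H|rewrite NegzE mulrNz mulrN sinN (H n.+1) oppr0].
elim: n => [|n IH]; first by rewrite mulr0 sin0.
by rewrite -[n.+1%:R]natr1 mulrDr mulr1 sinDpi IH oppr0.
Qed.

Lemma integral_cos_int (k : int) :
  (\int[@lebesgue_measure R]_(t in `[(- gam / 2)%R, (gam / 2)%R]) (cos (2 * pi * (beta * k%:~R * t)))%:E =
  (if k == 0 then gam else 0)%:E)%E.
Proof.
have gam0 : 0 < gam by rewrite invr_gt0.
have [->|k0] := eqVneq k 0.
  under eq_integral do rewrite mulr0 mul0r mulr0 cos0.
  rewrite integral_cst//= mul1e lebesgue_measure_itv/= lte_fin.
  by rewrite ifT; [rewrite -EFinB; congr EFin; lra|lra].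
set a := 2 * pi * (beta * k%:~R).
have a0 : a != 0.
  by rewrite /a !mulf_eq0 !negb_or pnatr_eq0 intr_eq0 k0 !gt_eqF ?pi_gt0.
have dF (t : R) : is_derive t 1 (fun t => a^-1 * sin (a * t)) (cos (a * t)).
  apply: is_derive_eq.
  by rewrite /GRing.scale/= mulr1 mulrCA mulVf ?mulr1.
have cF (t : R) : {for t, continuous (fun t => a^-1 * sin (a * t))}.
  by apply: differentiable_continuous; apply/derivable1_diffP; have [] := dF t.
under eq_integral do rewrite mulrA -/a.
rewrite (@continuous_FTC2 _ _ (fun t => a^-1 * sin (a * t))).
- have -> : a * (gam / 2) = pi * k%:~R.
    by rewrite /a /gam; field; rewrite gt_eqF.
  have -> : a * (- gam / 2) = pi * (- k)%:~R.
    by rewrite /a /gam rmorphN/=; field; rewrite gt_eqF.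
    by rewrite !sin_piz !mulr0 subee.
- lra.
- apply: continuous_subspaceT => t.
  by apply: continuous_comp; [apply: cvgM; [exact: cvg_cst|exact: cvg_id]|exact: continuous_cos].
- split; first by move=> t _; have [] := dF t.
  + exact: cvg_at_right_filter (cF _).
  + exact: cvg_at_left_filter (cF _).
- by move=> t _; rewrite derive1E; have [] := dF t.
Qed.

(** Only the N diagonal terms of the double sum have a nonzero integral, namely [gam] each. *)
Lemma integral_fejer N : (0 < N)%N ->
  (\int[@lebesgue_measure R]_(t in `[(- gam / 2)%R, (gam / 2)%R]) (fejer N t)%:E = gam%:E)%E.
Proof.
move=> N0; under eq_integral do rewrite fejer_cos EFinM.
have intcos (k : int) : (@lebesgue_measure R).-integrable `[(- gam / 2)%R, (gam / 2)%R]
    (EFin \o (fun t => cos (2 * pi * (beta * k%:~R * t)))).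
  apply: continuous_compact_integrable; first exact: segment_compact.
  apply: continuous_subspaceT => t.
  apply: continuous_comp; last exact: continuous_cos.
  by apply: cvgM; [exact: cvg_cst|apply: cvgM; [exact: cvg_cst|exact: cvg_id]].
have E t : (\sum_(j < N) \sum_(l < N) cos (2 * pi * (beta * (j%:Z - l%:Z)%:~R * t)))%:E =
    (\sum_(j < N) \sum_(l < N) (cos (2 * pi * (beta * (j%:Z - l%:Z)%:~R * t)))%:E)%E.
  by rewrite -sumEFin; apply: eq_bigr => j _; rewrite -sumEFin.
under eq_integral do rewrite E.
rewrite integralZl//; last first.
  apply: integrable_sum => // j _; apply: integrable_sum => // l _; exact: intcos.
rewrite integral_sum//; last first.
  by move=> j; apply: integrable_sum => // l _; exact: intcos.
under eq_bigr => j _.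
  rewrite integral_sum//; last by move=> l; exact: intcos.
  under eq_bigr do rewrite integral_cos_int.
  rewrite (bigD1 j)//= subrr eqxx big1; last first.
    by move=> l lj; rewrite subr_eq0 ifF//; apply: contraNF lj => /eqP[/val_inj ->].
  rewrite adde0.
  over.
under eq_bigr => j _ do rewrite /=.
rewrite sumEFin -EFinM sumr_const card_ord -(mulr_natl gam) mulrA mulVf ?mul1r//.
by rewrite pnatr_eq0 gtn_eqF.
Qed.
End fejer_kernel.

(** * Cells of a lattice *)

Section cells.
Context {R : realType} {d : nat}.
Variable gam : R.
Hypothesis gam0 : 0 < gam.
Notation mu := (@lebesgue_rV R d).
Notation I := ('rV[int]_d).
Implicit Types (x y : 'rV[R]_d) (m : I).

(** Rounding to the nearest multiple of [gam]: the cells are centred at the lattice points, so that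
    the peak of a periodic Fejer kernel falls inside a cell and not on its corners. *)
Definition round_to (t : R) : int := Num.floor (t / gam + 2^-1).

Definition cell_index x : I := \row_i round_to (x ord0 i).

Lemma latticeD m m' : lattice gam (m + m') = lattice gam m + lattice gam m'.
Proof. by apply/rowP => i; rewrite !mxE rmorphD/= mulrDr. Qed.

Lemma lattice0 : lattice gam (0 : I) = 0.
Proof. by apply/rowP => i; rewrite !mxE mulr0. Qed.

Lemma round_toD t (k : int) : round_to (t + gam * k%:~R) = round_to t + k.
Proof.
rewrite /round_to mulrDl mulrAC mulfV ?gt_eqF// mul1r addrAC.
by rewrite floorDrz ?intr_int// intrKfloor.
Qed.

Lemma round_to0 t : (round_to t == 0) = (- gam / 2 <= t < gam / 2).
Proof.
rewrite /round_to -[_ == 0]/(_ == 0%Z) floor_eq ?num_real//.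
rewrite mulr0z add0r mulr1z.
have -> : (0 <= t / gam + 2^-1) = (- gam / 2 <= t).
  rewrite -[LHS](@ler_pM2r _ gam)// mul0r mulrDl mulfVK ?gt_eqF//; lra.
have -> : (t / gam + 2^-1 < 1) = (t < gam / 2).
  rewrite -[LHS](@ltr_pM2r _ gam)// mul1r mulrDl mulfVK ?gt_eqF//; lra.
by [].
Qed.

Lemma cell_indexD x m : cell_index (x + lattice gam m) = cell_index x + m.
Proof. by apply/rowP => i; rewrite !mxE round_toD. Qed.

Lemma cell_index_lattice m : cell_index (lattice gam m) = m.
Proof.
have := cell_indexD 0 m; rewrite add0r => ->.
suff -> : cell_index 0 = 0 by rewrite add0r.
apply/rowP => i; rewrite !mxE; apply/eqP; rewrite round_to0 mulNr oppr_le0.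
by rewrite (ltW (divr_gt0 gam0 (ltr0Sn R 1))) divr_gt0.
Qed.

(** The residue is in fact at most gam / 2. With the cruder bound two residues still add up to less
    than 2 gam, the radius allowed in [tame]. *)
Lemma cell_residue x : `|x - lattice gam (cell_index x)| < gam.
Proof.
apply/rV_norm_ltP => // i; rewrite !mxE -mulrN -rmorphN/=.
have : round_to (x ord0 i + gam * (- round_to (x ord0 i))%:~R) == 0.
  by rewrite round_toD subrr.
rewrite round_to0 ltr_norml => /andP[? ?]; apply/andP; split; lra.
Qed.

Lemma measurable_round_to (A : set int) : measurable [set t : R | A (round_to t)].
Proof.
rewrite (_ : [set _ | _] = \bigcup_(k in A) [set t : R | round_to t = k]); last first.
  by apply/seteqP; split => t /= => [At|[k Ak /= ->]//]; exists (round_to t).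
apply: countable_bigcup_measurable => // k _.
rewrite (_ : [set _ | _] = `[gam * k%:~R - gam / 2, gam * k%:~R + gam / 2[%classic)//.
apply/seteqP; split => t /=; rewrite in_itv/=.
  move=> tk; have : round_to (t + gam * (- k)%:~R) == 0 by rewrite round_toD tk subrr.
  by rewrite round_to0 rmorphN/= => /andP[? ?]; apply/andP; split; lra.
move=> /andP[h1 h2]; have : round_to (t + gam * (- k)%:~R) == 0.
  by rewrite round_to0 rmorphN/=; apply/andP; split; lra.
by rewrite round_toD subr_eq0 => /eqP.
Qed.

Lemma measurable_cell_index {d'} {T : measurableType d'} (h : I -> T) :
  measurable_fun [set: 'rV[R]_d] (h \o cell_index).
Proof.
move=> _ Y mY; rewrite setTI.
rewrite (_ : _ @^-1` _ = \bigcup_(m in h @^-1` Y) [set x | cell_index x = m]); last first.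
  by apply/seteqP; split => t /= => [At|[k Ak /= ->]//]; exists (cell_index t).
apply: countable_bigcup_measurable => // m _.
rewrite (_ : [set _ | _] = \bigcap_(i in [set: 'I_d])
   ((fun x : 'rV[R]_d => x ord0 i) @^-1` [set t : R | round_to t = m ord0 i])).
  apply: fin_bigcap_measurable => // i _; rewrite -[X in measurable X]setTI.
  by apply: measurable_coord => //; exact: (@measurable_round_to [set m ord0 i]).
apply/seteqP; split => x /=; first by move=> <- i _ /=; rewrite mxE.
by move=> h'; apply/rowP => i; rewrite mxE; exact: h'.
Qed.

Definition cell_integral (K : 'rV[R]_d -> R) : \bar R :=
  (\int[mu]_x (K x * (cell_index x == 0)%:R)%:E)%E.

Lemma measurable_cell0 : measurable_fun [set: 'rV[R]_d]
  (fun x => (cell_index x == 0)%:R : R).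
Proof. exact: (measurable_cell_index (fun m => (m == 0)%:R : R)). Qed.

(* Periodicity of [K] turns the sum over the cells into a multiple of the
   integral over a single cell. *)
Lemma integral_cells_le (K : 'rV[R]_d -> R) (b : I -> R) (S : R) :
  measurable_fun [set: 'rV[R]_d] K -> (forall x, 0 <= K x) ->
  (forall x m, K (x + lattice gam m) = K x) ->
  summable_le b S ->
  (\int[mu]_x (b (cell_index x) * K x)%:E <= S%:E * cell_integral K)%E.
Proof.
move=> mK K0 Kper [b0 bS].
(* The integrand restricted to the [j]-th cell; a number that encodes no index gives the zero
   function. *)
pose f j x := oapp (fun m => b m * K x * (cell_index x == m)%:R) 0 (@choice.pickle_inv I j).
have mf j : measurable_fun setT (EFin \o f j).
  apply/measurable_EFinP; rewrite /f; case: (@choice.pickle_inv I _) => [m|]/=; last exact: measurable_cst.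
  apply: measurable_funM; first by apply: measurable_funM => //; exact: measurable_cst.
  exact: (measurable_cell_index (fun m' => (m' == m)%:R : R)).
have f0 j x : (0 <= (f j x)%:E)%E.
  rewrite lee_fin /f; case: (@choice.pickle_inv I _) => [m|]//=.
  by rewrite !mulr_ge0.
have fE x : (\sum_(0 <= j <oo) (f j x)%:E = (b (cell_index x) * K x)%:E)%E.
  rewrite (@nneseriesD1 _ _ (choice.pickle (cell_index x)))//.
  rewrite {1}/f pickleK_inv/= eqxx mulr1 eseries0 ?adde0// => j _ jx.
  rewrite /f; have := @pickle_invK I j; case: (@choice.pickle_inv I j) => [m|]//= mj.
  case: eqP => [xm|_]; last by rewrite mulr0.
  by rewrite xm mj eqxx in jx.
under eq_integral do rewrite -fE.
rewrite integral_nneseries//.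
have fI j : (\int[mu]_x (f j x)%:E = (oapp b 0 (@choice.pickle_inv I j))%:E * cell_integral K)%E.
  rewrite /f; case: (@choice.pickle_inv I _) => [m|]/=; last first.
    by rewrite mul0e integral0_eq.
  (* Translation by [lattice gam m] carries cell 0 to cell [m] and leaves [K] unchanged. *)
  rewrite -(ge0_integral_shift (lattice gam m))//.
  - rewrite /cell_integral -ge0_integralZl_EFin//.
    + apply: eq_integral => x _; rewrite -EFinM Kper cell_indexD.
      by rewrite -[X in _ == X]add0r (inj_eq (addIr m)) mulrA.
    + by move=> x _; rewrite lee_fin mulr_ge0.
    + by apply/measurable_EFinP; apply: measurable_funM => //; exact: measurable_cell0.
  - by have := mf (choice.pickle m); rewrite /f pickleK_inv.
  - by move=> x; rewrite lee_fin !mulr_ge0.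
under eq_eseriesr do rewrite fI.
apply: lime_le.
  apply: is_cvg_nneseries => j _ _; rewrite mule_ge0// ?lee_fin; first by case: (@choice.pickle_inv I _) => /=.
  by apply: integral_ge0 => x _; rewrite lee_fin mulr_ge0.
apply: nearW => N; rewrite /= big_mkord -ge0_sume_distrl.
  rewrite sumEFin -(sum_enumset b) lee_wpmul2r// ?lee_fin//.
  by apply: integral_ge0 => x _; rewrite lee_fin mulr_ge0.
by move=> j _; rewrite lee_fin; case: (@choice.pickle_inv I _) => /=.
Qed.

Definition fejer_rV N x : R := \prod_(i < d) fejer gam^-1 N (x ord0 i).

Lemma fejer_rV_ge0 N x : 0 <= fejer_rV N x.
Proof. by apply: prodr_ge0 => i _; exact: fejer_ge0. Qed.

Lemma measurable_fejer N : measurable_fun [set: R] (fejer gam^-1 N).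
Proof. by apply: continuous_measurable_fun; exact: fejer_continuous. Qed.

Lemma measurable_fejer_rV N : measurable_fun [set: 'rV[R]_d] (fejer_rV N).
Proof. exact: (measurable_prod_coord (fun _ => @measurable_fejer N)). Qed.

Lemma fejer_rV_per N x m : fejer_rV N (x + lattice gam m) = fejer_rV N x.
Proof.
apply: eq_bigr => i _; rewrite !mxE /fejer; congr (rnorm _ ^+ 2 / _).
apply: eq_bigr => j _; rewrite (mulrDr (gam^-1 * _)) (mulrDr (2 * pi)) cisD.
rewrite [X in _ * X](_ : _ = 1) ?mulr1// -(cis2piz (j%:Z * m ord0 i)).
by congr cis; rewrite rmorphM/=; field; rewrite gt_eqF.
Qed.

Lemma cell_index0 x : (cell_index x == 0)%:R = \prod_(i < d) (round_to (x ord0 i) == 0)%:R :> R.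
Proof.
have [x0|x0] := eqVneq (cell_index x) 0.
  by rewrite big1// => i _; move/rowP/(_ i) : x0; rewrite !mxE => ->; rewrite eqxx.
apply/esym/eqP/prodf_eq0.
have [i xi] : exists i, round_to (x ord0 i) != 0.
  apply/existsP; apply: contra_neqT x0; rewrite negb_exists => /forallP h.
  by apply/rowP => i; rewrite !mxE; have := h i; rewrite negbK => /eqP.
by exists i => //; rewrite (negbTE xi).
Qed.

(** The cell is half-open while the Fejer integral was computed on the closed interval; the endpoint
    has measure 0. *)
Lemma integral_round0 (F : R -> R) : continuous F -> (forall t, 0 <= F t) ->
  (\int[@lebesgue_measure R]_t (F t * (round_to t == 0)%:R)%:E =
  \int[@lebesgue_measure R]_(t in `[(- gam / 2)%R, (gam / 2)%R]) (F t)%:E)%E.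
Proof.
move=> cF F0; rewrite -integral_itv_bndo_bndc; last first.
  apply/measurable_EFinP/measurable_funTS; exact: continuous_measurable_fun.
rewrite [RHS]integral_mkcond; apply: eq_integral => t _.
rewrite patchE mem_setE in_itv/= -round_to0; case: ifP => _; first by rewrite mulr1.
by rewrite mulr0.
Qed.

Lemma cell_integral_prod (f : 'I_d -> R -> R) :
  (forall i, measurable_fun [set: R] (f i)) -> (forall i t, 0 <= f i t) ->
  cell_integral (fun x => \prod_i f i (x ord0 i)) =
  (\big[*%E/1]_i \int[@lebesgue_measure R]_t (f i t * (round_to t == 0)%:R)%:E)%E.
Proof.
move=> mf f0; rewrite /cell_integral.
under eq_integral do rewrite cell_index0 -big_split/=.
rewrite (ge0_integral_prod (f := fun i t => f i t * (round_to t == 0)%:R))//.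
  move=> i; apply: measurable_funM => //.
  move=> _ Y mY; rewrite setTI.
  exact: (@measurable_round_to (fun k => Y (k == 0)%:R)).
by move=> i t; rewrite mulr_ge0.
Qed.

Lemma integral_fejer_round0 N : (0 < N)%N ->
  (\int[@lebesgue_measure R]_t (fejer gam^-1 N t * (round_to t == 0)%:R)%:E = gam%:E)%E.
Proof.
move=> N0; rewrite integral_round0.
- have b0 : 0 < gam^-1 by rewrite invr_gt0.
  by have := integral_fejer b0 N0; rewrite invrK.
- exact: fejer_continuous.
- exact: fejer_ge0.
Qed.

Lemma cell_integral_fejer N : (0 < N)%N -> cell_integral (fejer_rV N) = (gam ^+ d)%:E.
Proof.
move=> N0; rewrite (cell_integral_prod (f := fun=> fejer gam^-1 N)).
- under eq_bigr do rewrite integral_fejer_round0//.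
  by rewrite prodEFin prodr_const card_ord.
- by move=> _; exact: measurable_fejer.
- by move=> _; exact: fejer_ge0.
Qed.

Lemma cell_integral1 : cell_integral (fun=> 1) = (gam ^+ d)%:E.
Proof.
(* The kernel of order 1 is the constant 1. *)
rewrite -(@cell_integral_fejer 1)//; congr cell_integral; apply/funext => x.
rewrite /fejer_rV big1// => i _; rewrite /fejer big_ord1 rnorm_cis; lra.
Qed.

(** The integral factors over the coordinates: coordinate [i] contributes the tail bound and every
    other one its full mass [gam]. *)
Lemma cell_integral_fejer_tail (e : R) (i : 'I_d) N : 0 < e -> (0 < N)%N ->
  (cell_integral (fun x => (fejer_rV N x * (e <= `|x ord0 i|)%R%:R)%R) <=
   (gam ^+ d * ((2 / (1 - cos (2 * pi * gam^-1 * e))) / N%:R))%:E)%E.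
Proof.
move=> e0 N0.
set c := (_ / N%:R).
have c0 : 0 <= c by rewrite divr_ge0// divr_ge0// subr_ge0 cos_le1.
pose f j t := fejer gam^-1 N t * ((j == i) ==> (e <= `|t|)%R)%:R.
have -> : (fun x : 'rV[R]_d => fejer_rV N x * (e <= `|x ord0 i|)%R%:R) =
    fun x => \prod_j f j (x ord0 j).
  apply/funext => x; rewrite big_split/=; congr (_ * _).
  by rewrite (bigD1 i)//= eqxx/= big1 ?mulr1// => j /negbTE ->.
have f0 j t : 0 <= f j t by rewrite mulr_ge0// fejer_ge0.
have mf j : measurable_fun [set: R] (f j).
  apply: measurable_funM; first exact: measurable_fejer.
  case: eqP => [_|_]/=; last exact: measurable_cst.
  apply: (@measurableT_comp _ _ _ _ _ _ (fun b : bool => b%:R : R)) => //.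
  by apply: measurable_fun_ler => //; exact: measurableT_comp.
rewrite cell_integral_prod//.
have -> : (gam ^+ d * c)%:E = (\big[*%E/1]_(j < d) (if j == i then c * gam else gam)%:E)%E.
  rewrite prodEFin (bigD1 i)//= eqxx (eq_bigr (fun=> gam)); last by move=> j /negbTE ->.
  rewrite prodr_const cardC1 card_ord -mulrA -exprS mulrC.
  by rewrite prednK// (leq_ltn_trans _ (ltn_ord i)).
rewrite -[leLHS]/(_ : \bar R).
set A := (X in (X <= _)%E); set B := (X in (_ <= X)%E).
(* Nonnegativity is carried along so that the inequalities can be multiplied factor by factor. *)
suff /andP[] : (0 <= A <= B)%E by [].
rewrite {}/A {}/B; elim/big_ind2 : _ => [|x1 x2 y1 y2 /andP[h1 h2] /andP[h3 h4]|j _].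
- by rewrite lexx andbT lee_fin.
- by rewrite mule_ge0//= lee_pmul.
apply/andP; split; first by apply: integral_ge0 => t _; rewrite lee_fin mulr_ge0.
case: eqP => [->|ji]; last first.
  rewrite -(integral_fejer_round0 N0) le_eqVlt; apply/orP; left; apply/eqP.
  by apply: eq_integral => t _; rewrite /f; case: eqP => //= _; rewrite mulr1.
rewrite /f eqxx/= EFinM.
have -> : gam%:E = (\int[@lebesgue_measure R]_t ((round_to t == 0)%:R)%:E)%E.
  rewrite -(integral_fejer_round0 (ltn0Sn 0)); apply: eq_integral => t _.
  by rewrite /fejer big_ord1 rnorm_cis expr1n divr1 mul1r.
have mr : measurable_fun [set: R] (fun t => (round_to t == 0)%:R : R).
  by move=> _ Y mY; rewrite setTI; exact: (@measurable_round_to (fun k => Y (k == 0)%:R)).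
rewrite -ge0_integralZl_EFin//; last exact/measurable_EFinP.
apply: ge0_le_integral => //.
- by move=> t _; rewrite lee_fin mulr_ge0// mulr_ge0// fejer_ge0.
- apply/measurable_EFinP; apply: measurable_funM => //.
  by have := mf i; rewrite /f eqxx.
- by apply: measurable_funeM; exact/measurable_EFinP.
move=> t _; rewrite -EFinM lee_fin round_to0.
case: andP => [[t1 t2]|_]; last by rewrite !mulr0.
rewrite [_ * true%:R]mulr1 [c * _]mulr1.
have [et|et] := leP e `|t|; last by rewrite mulr0.
rewrite mulr1 /c; apply: fejer_tail => //; first by rewrite invr_gt0.
by rewrite et invrK ler_norml; apply/andP; split; lra.
Qed.

(** Approximate identity on a single cell. Within [del] of 0 the oscillation of Phi is below e / 2.
    A farther point has some coordinate of modulus at least [del], and the kernel mass of these d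
    regions is O(1 / N). *)
Lemma fejer_rV_approx (Phi : 'rV[R]_d -> R) (B e : R) :
  measurable_fun [set: 'rV[R]_d] Phi -> (forall x, cell_index x = 0 -> `|Phi x| <= B) ->
  {for 0, continuous Phi} -> 0 < e ->
  exists N0, forall N, (N0 <= N)%N ->
    `|gam ^- d * Rintegral mu setT (fun x => Phi x * (fejer_rV N x * (cell_index x == 0)%:R)) - Phi 0| <= e.
Proof.
move=> mPhi PhiB cPhi e0.
have c00 : cell_index 0 = 0.
  by apply/rowP => i; apply/eqP; rewrite !mxE round_to0 mulNr oppr_le0 ltW divr_gt0.
have e20 : 0 < e / 2 by lra.
have /cvgrPdist_lt/(_ _ e20)/nbhs_ballP[del/= del0 Hdel] := cPhi.
pose c := 2 / (1 - cos (2 * pi * gam^-1 * del)).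
have gd : gam ^+ d != 0 by rewrite expf_neq0// gt_eqF.
have gd0 : 0 < gam ^+ d by rewrite exprn_gt0.
have c0 : 0 <= c by rewrite divr_ge0// subr_ge0 cos_le1.
have B0 : 0 <= B by apply: le_trans (PhiB 0 c00).
(* On the d outer regions |Phi - Phi 0| is at most 2 B, which gives gam^d (4 B d c / N) / 2 in all;
   this threshold makes 4 B d c / N at most e. *)
exists (Num.truncn (4 * B * d%:R * c / e)).+1 => N N0.
have Npos : (0 < N)%N by apply: leq_trans N0.
have NR : 4 * B * d%:R * c / e < N%:R.
  by apply: lt_le_trans (truncnS_gt _) _; rewrite ler_nat.
pose K1 x : R := fejer_rV N x * (cell_index x == 0)%:R.
pose T x : R := e / 2 * K1 x +
  \sum_(i < d) 2 * B * (fejer_rV N x * (del <= `|x ord0 i|)%R%:R * (cell_index x == 0)%:R).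
have K10 x : 0 <= K1 x by rewrite mulr_ge0// fejer_rV_ge0.
have mK1 : measurable_fun setT K1.
  by apply: measurable_funM; [exact: measurable_fejer_rV|exact: measurable_cell0].
have iK1 : (\int[mu]_x (K1 x)%:E = (gam ^+ d)%:E)%E by rewrite -(cell_integral_fejer Npos).
have L1 : mu.-integrable setT (EFin \o K1).
  apply/integrableP; split; first exact/measurable_EFinP.
  under eq_integral do rewrite /= ger0_norm//.
  by rewrite iK1 ltry.
have LP : mu.-integrable setT (EFin \o (fun x => Phi x * K1 x)).
  apply: (@le_integrable _ _ _ _ _ _ _ (EFin \o (fun x => B * K1 x))) => //.
  - by apply/measurable_EFinP; apply: measurable_funM.
  - move=> x _; rewrite lee_fin (normrM (Phi x) (K1 x)) (normrM B) (ger0_norm B0) (ger0_norm (K10 x)).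
    rewrite /K1; case: eqP => [/PhiB xB|_]; last by rewrite !mulr0.
    by rewrite mulr1 ler_wpM2r// fejer_rV_ge0.
  - exact: (integrableZl _ B L1).
have -> : gam ^- d * Rintegral mu setT (fun x => Phi x * K1 x) - Phi 0 =
   gam ^- d * Rintegral mu setT (fun x => (Phi x - Phi 0) * K1 x).
  under [in RHS]eq_Rintegral do rewrite mulrBl.
  rewrite RintegralB//; last exact: (integrableZl _ (Phi 0) L1).
  rewrite RintegralZl// {3}/Rintegral iK1/= mulrBr; congr (_ - _).
  by rewrite mulrCA mulVf// mulr1.
have LPB : mu.-integrable setT (EFin \o (fun x => (Phi x - Phi 0) * K1 x)).
  rewrite (_ : EFin \o _ = fun x => ((Phi x * K1 x)%:E - (Phi 0 * K1 x)%:E)%E); last first.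
    by apply/funext => x; rewrite /= mulrBl EFinB.
  by apply: integrableB => //; exact: (integrableZl _ (Phi 0) L1).
rewrite normrM ger0_norm ?invr_ge0 ?(ltW gd0)// ler_pdivrMl//.
apply: le_trans (le_normr_Rintegral _ LPB) _ => //.
rewrite -lee_fin fineK; last by apply: integrable_fin_num => //; exact: integrable_norm.
have mT i : measurable_fun setT (fun x : 'rV[R]_d =>
    fejer_rV N x * (del <= `|x ord0 i|)%R%:R * (cell_index x == 0)%:R).
  apply: measurable_funM; last exact: measurable_cell0.
  apply: measurable_funM; first exact: measurable_fejer_rV.
  apply: (@measurableT_comp _ _ _ _ _ _ (fun b : bool => b%:R : R)) => //.
  apply: measurable_fun_ler => //; apply: measurableT_comp => //; exact: measurable_coord.
have T0 i x : 0 <= fejer_rV N x * (del <= `|x ord0 i|)%R%:R * (cell_index x == 0)%:R.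
  by rewrite !mulr_ge0// fejer_rV_ge0.
apply: (@le_trans _ _ (\int[mu]_x ((e / 2)%:E * (K1 x)%:E + \sum_(i < d) (2 * B)%:E *
    (fejer_rV N x * (del <= `|x ord0 i|)%R%:R * (cell_index x == 0)%:R)%:E))%E).
  apply: ge0_le_integral => //.
  - apply/measurable_EFinP; apply: measurableT_comp => //.
    by move/integrableP : LPB => [/measurable_EFinP].
  - apply: emeasurable_funD.
      by apply: measurable_funeM; exact/measurable_EFinP.
    by apply: emeasurable_sum => i; apply: measurable_funeM; exact/measurable_EFinP.
  - move=> x _; rewrite (normrM _ (K1 x)) (ger0_norm (K10 x)).
    under eq_bigr do rewrite -EFinM.
    rewrite sumEFin -EFinM -EFinD lee_fin.
    rewrite /K1; case: eqP => [xc|_]; last first.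
      by rewrite !mulr0 add0r; apply: sumr_ge0 => i _; rewrite [X in 2 * B * X]mulr0 mulr0.
    have [xd|xd] := ltP `|x| del.
      rewrite mulr1 -[leLHS]addr0 lerD//.
        rewrite ler_wpM2r ?fejer_rV_ge0// ltW// distrC Hdel//= -ball_normE/= sub0r normrN//.
      by apply: sumr_ge0 => i _; rewrite !mulr_ge0// fejer_rV_ge0.
    have [i xi] : exists i, del <= `|x ord0 i|.
      apply/existsP; apply: contraTT xd; rewrite negb_exists -ltNge => /forallP h.
      by apply/rV_norm_ltP => // i; rewrite ltNge h.
    rewrite (bigD1 i)//= xi !mulr1.
    apply: le_trans (_ : 2 * B * fejer_rV N x <= _).
      rewrite ler_wpM2r ?fejer_rV_ge0//.
      rewrite (le_trans (ler_normB _ _))// -[2]/(1 + 1) mulrDl !mul1r lerD ?PhiB//.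
    rewrite addrCA lerDl addr_ge0//; first by rewrite mulr_ge0 ?fejer_rV_ge0// ltW.
    by apply: sumr_ge0 => j _; rewrite !mulr_ge0// fejer_rV_ge0.
rewrite ge0_integralD//; last 4 first.
- by move=> x _; rewrite mule_ge0 ?lee_fin ?(ltW e20).
- by apply: measurable_funeM; exact/measurable_EFinP.
- by move=> x _; apply: sume_ge0 => i _; rewrite mule_ge0 ?lee_fin// mulr_ge0.
- by apply: emeasurable_sum => i; apply: measurable_funeM; exact/measurable_EFinP.
rewrite ge0_integralZl_EFin//; last 3 first.
- by move=> x _; rewrite lee_fin.
- exact/measurable_EFinP.
- exact: ltW.
rewrite iK1 ge0_integral_sum//; last 2 first.
- by move=> i; apply: measurable_funeM; exact/measurable_EFinP.
- by move=> i x _; rewrite mule_ge0 ?lee_fin// mulr_ge0.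
apply: (@le_trans _ _ ((e / 2)%:E * (gam ^+ d)%:E + \sum_(i < d) (2 * B)%:E * (gam ^+ d * (c / N%:R))%:E)%E).
  apply: leeD => //; apply: lee_sum => i _.
  rewrite ge0_integralZl_EFin//; last 3 first.
  - by move=> x _; rewrite lee_fin.
  - exact/measurable_EFinP.
  - by rewrite mulr_ge0.
  apply: lee_wpmul2l; first by rewrite lee_fin mulr_ge0.
  exact: cell_integral_fejer_tail.
under eq_bigr do rewrite -EFinM.
rewrite sumEFin -EFinM -EFinD lee_fin sumr_const card_ord.
have : 4 * B * d%:R * c / N%:R <= e.
  by rewrite ler_pdivrMr ?ltr0n// (mulrC e) ltW// -ltr_pdivrMr.
rewrite -(mulr_natl (2 * B * (gam ^+ d * (c / N%:R)))) => h.
have -> : d%:R * (2 * B * (gam ^+ d * (c / N%:R))) = gam ^+ d * ((4 * B * d%:R * c / N%:R) / 2).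
  field; by rewrite pnatr_eq0 gtn_eqF.
nra.
Qed.

End cells.

(** * Continuity expressed through real norms *)

Section rcont.
Context {R : realType} {T : topologicalType}.

(** Only an R[i]-valued norm is required, so that vectors and complex scalars are handled alike;
    [rcontP] gives back [continuous]. *)
Definition rcont {V : normedZmodType R[i]} (f : T -> V) :=
  forall x (e : R), 0 < e -> \forall y \near x, rnorm (f x - f y) < e.

Lemma rcont_cst {V : normedZmodType R[i]} (v : V) : rcont (fun=> v).
Proof. by move=> x e e0; apply: nearW => y; rewrite subrr rnorm0. Qed.

Lemma rcontD {V : normedZmodType R[i]} (f g : T -> V) :
  rcont f -> rcont g -> rcont (fun x => f x + g x).
Proof.
move=> cf cg x e e0; have e20 : 0 < e / 2 by lra.
apply: filterS2 (cf x _ e20) (cg x _ e20) => y fy gy.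
by rewrite opprD addrACA (le_lt_trans (rnormD _ _))//; lra.
Qed.

Lemma rcont_sum {V : normedZmodType R[i]} I (s : seq I) (f : I -> T -> V) :
  (forall i, rcont (f i)) -> rcont (fun x => \sum_(i <- s) f i x).
Proof.
move=> cf; elim: s => [|i s IH].
  by under eq_fun do rewrite big_nil; exact: rcont_cst.
by under eq_fun do rewrite big_cons; exact: rcontD.
Qed.

(** Common source of continuity for scaling, the complex product and the inner product. *)
Lemma rcont_biadditive {U V W : normedZmodType R[i]} (B : U -> V -> W)
    (f : T -> U) (g : T -> V) :
  (forall u v, rnorm (B u v) <= rnorm u * rnorm v) ->
  (forall u u' v, B (u - u') v = B u v - B u' v) ->
  (forall u v v', B u (v - v') = B u v - B u v') ->
  rcont f -> rcont g -> rcont (fun x => B (f x) (g x)).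
Proof.
move=> nB Bl Br cf cg x e e0.
pose c := 2 * (1 + rnorm (f x) + rnorm (g x)).
have c0 : 0 < c by have := rnorm_ge0 (f x); have := rnorm_ge0 (g x); rewrite /c; lra.
(* Keeping the variation of g below 1 bounds [rnorm (g y)] by [rnorm (g x) + 1]. *)
have e1 : 0 < Num.min 1 (e / c) by rewrite lt_min ltr01 divr_gt0.
apply: filterS2 (cf x _ e1) (cg x _ e1) => y; rewrite !lt_min => /andP[f1 f2] /andP[g1 g2].
have -> : B (f x) (g x) - B (f y) (g y) =
    B (f x) (g x - g y) + B (f x - f y) (g y).
  by rewrite Br Bl addrA subrK.
rewrite (le_lt_trans (rnormD _ _))// (le_lt_trans (lerD (nB _ _) (nB _ _)))//.
have gy : rnorm (g y) <= rnorm (g x) + 1.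
  have := rnormB (g x) (g x - g y); rewrite subKr; lra.
have := rnorm_ge0 (f x); have := rnorm_ge0 (g x); have := rnorm_ge0 (g y).
have := rnorm_ge0 (f x - f y); have := rnorm_ge0 (g x - g y).
have : e / c * c = e by rewrite mulfVK ?gt_eqF.
move: (e / c) f2 g2 => r; rewrite /c => f2 g2 <-; nra.
Qed.

Lemma rcontZ {V : normedModType R[i]} (p : T -> R[i]) (f : T -> V) :
  rcont p -> rcont f -> rcont (fun x => p x *: f x).
Proof.
apply: (rcont_biadditive (B := fun (z : R[i]) (v : V) => z *: v)).
- by move=> u v; rewrite rnormZ.
- by move=> *; rewrite scalerBl.
- by move=> *; rewrite scalerBr.
Qed.

Lemma rcontM (p q : T -> R[i]) : rcont p -> rcont q -> rcont (fun x => p x * q x).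
Proof.
apply: (rcont_biadditive (B := fun z z' : R[i] => z * z')).
- by move=> u v; rewrite rnormM.
- by move=> *; rewrite mulrBl.
- by move=> *; rewrite mulrBr.
Qed.

Lemma rcont_cis (f : T -> R) : continuous f -> rcont (fun x => cis (f x)).
Proof.
move=> cf x e e0; have e20 : 0 < e / 2 by lra.
have /cvgrPdist_lt/(_ _ e20) : (cos (f y) @[y --> x] --> cos (f x)).
  by apply: continuous_comp; [exact: cf|exact: continuous_cos].
have /cvgrPdist_lt/(_ _ e20) : (sin (f y) @[y --> x] --> sin (f x)).
  by apply: continuous_comp; [exact: cf|exact: continuous_sin].
apply: filterS2 => y h1 h2; rewrite (le_lt_trans (rnormC_le _))//=; lra.
Qed.

Lemma rcont_Re (p : T -> R[i]) : rcont p -> continuous (fun x => complex.Re (p x)).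
Proof.
move=> cp x; apply/cvgrPdist_lt => e e0; apply: filterS (cp x e e0) => y.
by rewrite -raddfB; apply: le_lt_trans; exact: normRe_le.
Qed.

Lemma rcont_Im (p : T -> R[i]) : rcont p -> continuous (fun x => complex.Im (p x)).
Proof.
move=> cp x; apply/cvgrPdist_lt => e e0; apply: filterS (cp x e e0) => y.
by rewrite -raddfB; apply: le_lt_trans; exact: normIm_le.
Qed.

Lemma rcont_rnorm {V : normedZmodType R[i]} (f : T -> V) :
  rcont f -> continuous (fun x => rnorm (f x)).
Proof.
move=> cf x; apply/cvgrPdist_lt => e e0; apply: filterS (cf x e e0) => y.
apply: le_lt_trans; rewrite ler_norml; apply/andP; split.
  by have := rnormB (f x) (f x - f y); rewrite subKr; lra.
by have := rnormD (f x - f y) (f y); rewrite subrK; lra.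
Qed.

(** Locally uniform approximation suffices: N may depend on the point. *)
Lemma rcont_uniform_limit {V : normedZmodType R[i]} (f : nat -> T -> V) (h : T -> V) :
  (forall N, rcont (f N)) ->
  (forall (x : T) (e : R), 0 < e -> exists N, nbhs x [set y | rnorm (h y - f N y) <= e]) ->
  rcont h.
Proof.
move=> cf fh x e e0; have e40 : 0 < e / 4 by lra.
have [N hN] := fh x _ e40.
have hx := nbhs_singleton hN.
apply: filterS2 hN (cf N x _ e40) => y hy fxy.
have -> : h x - h y = (h x - f N x) + (f N x - f N y) + (f N y - h y).
  by rewrite !addrA !subrK.
rewrite /= in hx hy; rewrite rnorm_subC in hy.
have := rnormD (h x - f N x + (f N x - f N y)) (f N y - h y).
have := rnormD (h x - f N x) (f N x - f N y); lra.
Qed.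

Lemma rcontP {V : normedModType R[i]} (f : T -> V) : continuous f <-> rcont f.
Proof. exact: continuous_rnormP. Qed.

End rcont.

Lemma rcont_comp {R : realType} {S T : topologicalType} {V : normedZmodType R[i]}
    (f : T -> V) (t : S -> T) : continuous t -> rcont f -> rcont (f \o t).
Proof. by move=> ct cf x e e0; exact: (ct x _ (cf (t x) e e0)). Qed.

(** * Square-integrable functions *)

Section L2.
Context {R : realType} {H : completeNormedModType R[i]} {d : nat}.
Variable dot : {dot H for conjC}.
Hypothesis hilb : hilbert_norm dot.
Hypothesis sepH : Defs.separable H.
Notation mu := (@lebesgue_rV R d).
Implicit Types (f g h : 'rV[R]_d -> H) (F G : 'rV[R]_d -> R) (Z : 'rV[R]_d -> R[i]).

Definition L1 F := mu.-integrable setT (EFin \o F).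
Definition rint F := Rintegral mu setT F.

Lemma L1_le F G : measurable_fun setT F -> (forall x, `|F x| <= G x) -> L1 G -> L1 F.
Proof.
move=> mF FG; apply: le_integrable => //; first exact/measurable_EFinP.
by move=> x _; rewrite lee_fin (le_trans (FG x))// ler_norm.
Qed.

Lemma L1_measurable F : L1 F -> measurable_fun setT F.
Proof. by move=> /integrableP[/measurable_EFinP]. Qed.

Lemma L1D F G : L1 F -> L1 G -> L1 (fun x => F x + G x).
Proof. by move=> iF iG; exact: (integrableD measurableT iF iG). Qed.

Lemma L1Z c F : L1 F -> L1 (fun x => c * F x).
Proof. by move=> iF; exact: (integrableZl _ c iF). Qed.

Lemma L1N F : L1 F -> L1 (fun x => - F x).
Proof. by move=> iF; under eq_fun do rewrite -mulN1r; exact: L1Z. Qed.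

Lemma L1_abs F : L1 F -> L1 (fun x => `|F x|).
Proof. exact: integrable_norm. Qed.

Lemma L1_ge0P F : measurable_fun setT F -> (forall x, 0 <= F x) ->
  (\int[mu]_x (F x)%:E < +oo)%E -> L1 F.
Proof.
move=> mF F0 Fi; apply/integrableP; split; first exact/measurable_EFinP.
by under eq_integral do rewrite /= ger0_norm//.
Qed.

Lemma rintE F : L1 F -> (\int[mu]_x (F x)%:E)%E = (rint F)%:E.
Proof. by move=> iF; rewrite fineK//; exact: integrable_fin_num. Qed.

Lemma rintD F G : L1 F -> L1 G -> rint (fun x => F x + G x) = rint F + rint G.
Proof. by move=> iF iG; exact: RintegralD. Qed.

Lemma rintZ c F : L1 F -> rint (fun x => c * F x) = c * rint F.
Proof. by move=> iF; exact: RintegralZl. Qed.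

Lemma rintN F : L1 F -> rint (fun x => - F x) = - rint F.
Proof.
move=> iF; rewrite -mulN1r -rintZ//; congr rint; apply/funext => x.
by rewrite mulN1r.
Qed.

Lemma rint_le F G : L1 F -> L1 G -> (forall x, F x <= G x) -> rint F <= rint G.
Proof. by move=> iF iG FG; apply: le_Rintegral. Qed.

Lemma rint_ge0 F : (forall x, 0 <= F x) -> 0 <= rint F.
Proof. by move=> F0; apply: Rintegral_ge0. Qed.

Lemma rint_abs F : L1 F -> `|rint F| <= rint (fun x => `|F x|).
Proof. by move=> iF; exact: le_normr_Rintegral. Qed.

Lemma eq_rint F G : F =1 G -> rint F = rint G.
Proof. by move=> FG; congr rint; apply/funext. Qed.

(** Shift invariance is known for nonnegative integrands; the signed case goes through positive and
    negative parts. *)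
Lemma rint_shift F (y : 'rV[R]_d) : measurable_fun setT F ->
  (L1 F <-> L1 (fun x => F (x + y))) /\ rint (fun x => F (x + y)) = rint F.
Proof.
move=> mF.
have mFy : measurable_fun setT (fun x : 'rV[R]_d => F (x + y)).
  by apply: (measurableT_comp mF); exact: measurable_addrV.
have int0 (G : 'rV[R]_d -> R) : measurable_fun setT G -> (forall x, 0 <= G x) ->
    (\int[mu]_x (G (x + y)%R)%:E = \int[mu]_x (G x)%:E)%E.
  move=> mG G0; rewrite (ge0_integral_shift y (f := EFin \o G))//.
  exact/measurable_EFinP.
split.
  have E := int0 (fun x => `|F x|) (measurableT_comp (@normr_measurable _ _) mF) (fun x => normr_ge0 _).
  rewrite /L1; split=> /integrableP[_ h]; apply/integrableP; split; try exact/measurable_EFinP.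
    by rewrite /= in h *; rewrite E.
  by rewrite /= in h *; rewrite -E.
rewrite /rint /Rintegral; congr fine; rewrite integralE [RHS]integralE; congr (_ - _)%E.
  refine (etrans _ (ge0_integral_shift y (f := ((EFin \o F)^\+)%E) _ _)).
  - by apply: eq_integral => x _; rewrite !funeposE.
  - exact/measurable_funepos/measurable_EFinP.
  - by move=> x; exact: funepos_ge0.
refine (etrans _ (ge0_integral_shift y (f := ((EFin \o F)^\-)%E) _ _)).
- by apply: eq_integral => x _; rewrite !funenegE.
- exact/measurable_funeneg/measurable_EFinP.
- by move=> x; exact: funeneg_ge0.
Qed.

Definition cint Z : R[i] :=
  rint (fun x => complex.Re (Z x)) +i* rint (fun x => complex.Im (Z x)).

Definition cL1 Z :=
  L1 (fun x => complex.Re (Z x)) /\ L1 (fun x => complex.Im (Z x)).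

Lemma cL1P Z : measurable_fun setT (fun x => complex.Re (Z x)) ->
  measurable_fun setT (fun x => complex.Im (Z x)) -> forall G, L1 G ->
  (forall x, rnorm (Z x) <= G x) -> cL1 Z.
Proof.
move=> mr mi G iG ZG; split; apply: L1_le iG => // x; apply: le_trans (ZG x).
  exact: normRe_le.
exact: normIm_le.
Qed.

Lemma cintD Z Z' : cL1 Z -> cL1 Z' -> cint (fun x => Z x + Z' x) = cint Z + cint Z'.
Proof.
move=> [Zr Zi] [Z'r Z'i]; rewrite /cint -[RHS]/(_ +i* _) -!rintD//.
by congr (rint _ +i* rint _); apply/funext => x; rewrite raddfD.
Qed.

Lemma cL1D Z Z' : cL1 Z -> cL1 Z' -> cL1 (fun x => Z x + Z' x).
Proof.
by move=> [Zr Zi] [Z'r Z'i]; split; under eq_fun do rewrite raddfD/=; apply: L1D.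
Qed.

Lemma cL1Z c Z : cL1 Z -> cL1 (fun x => c * Z x).
Proof.
move=> [Zr Zi]; split.
  rewrite (_ : (fun x => _) = fun x => complex.Re c * complex.Re (Z x) + - (complex.Im c * complex.Im (Z x))).
    by apply: L1D; [exact: L1Z|apply: L1N; exact: L1Z].
  by apply/funext => x; case: c (Z x) => [a b] [].
rewrite (_ : (fun x => _) = fun x => complex.Re c * complex.Im (Z x) + complex.Im c * complex.Re (Z x)).
  by apply: L1D; exact: L1Z.
by apply/funext => x; case: c (Z x) => [a b] [].
Qed.

Lemma cintZ c Z : cL1 Z -> cint (fun x => c * Z x) = c * cint Z.
Proof.
move=> [Zr Zi]; rewrite /cint.
have -> : rint (fun x => complex.Re (c * Z x)) =
    complex.Re c * rint (fun x => complex.Re (Z x)) - complex.Im c * rint (fun x => complex.Im (Z x)).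
  rewrite -!rintZ// -rintN; last exact: L1Z.
  rewrite -rintD; [|exact: L1Z|apply: L1N; exact: L1Z].
  by apply: eq_rint => x; case: c (Z x) => [a b] [].
have -> : rint (fun x => complex.Im (c * Z x)) =
    complex.Re c * rint (fun x => complex.Im (Z x)) + complex.Im c * rint (fun x => complex.Re (Z x)).
  rewrite -!rintZ// -rintD; [|exact: L1Z|exact: L1Z].
  by apply: eq_rint => x; case: c (Z x) => [a b] [].
by case: c.
Qed.

Lemma cL1_0 : cL1 (fun=> 0).
Proof. by split; apply: integrable0. Qed.

Lemma cint0 : cint (fun=> 0) = 0.
Proof. by rewrite /cint /rint /Rintegral integral0. Qed.

Lemma cL1_sum I (s : seq I) (Z : I -> 'rV[R]_d -> R[i]) : (forall i, cL1 (Z i)) ->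
  cL1 (fun x => \sum_(i <- s) Z i x).
Proof.
move=> iZ; elim: s => [|i s IH]; first by under eq_fun do rewrite big_nil; exact: cL1_0.
by under eq_fun do rewrite big_cons; exact: cL1D.
Qed.

Lemma cint_sum I (s : seq I) (Z : I -> 'rV[R]_d -> R[i]) : (forall i, cL1 (Z i)) ->
  cint (fun x => \sum_(i <- s) Z i x) = \sum_(i <- s) cint (Z i).
Proof.
move=> iZ; elim: s => [|i s IH].
  by rewrite big_nil -[RHS]cint0; congr cint; apply/funext => x; rewrite big_nil.
rewrite big_cons -IH -cintD//; last exact: cL1_sum.
by congr cint; apply/funext => x; rewrite big_cons.
Qed.

(** The factor 2 comes from bounding real and imaginary parts separately. *)
Lemma cint_le Z G : cL1 Z -> L1 G -> (forall x, rnorm (Z x) <= G x) ->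
  rnorm (cint Z) <= 2 * rint G.
Proof.
move=> [Zr Zi] iG ZG; rewrite (le_trans (rnormC_le _))//= mulrDl mul1r lerD//.
  rewrite (le_trans (rint_abs Zr))// rint_le//; first exact: L1_abs.
  by move=> x; apply: le_trans (ZG x); exact: normRe_le.
rewrite (le_trans (rint_abs Zi))// rint_le//; first exact: L1_abs.
by move=> x; apply: le_trans (ZG x); exact: normIm_le.
Qed.

Lemma cint_conj Z : cL1 Z -> cint (fun x => conjC (Z x)) = conjC (cint Z).
Proof.
move=> [Zr Zi]; rewrite /cint.
have -> : rint (fun x => complex.Re (conjC (Z x))) = rint (fun x => complex.Re (Z x)).
  by apply: eq_rint => x; case: (Z x).
have -> // : rint (fun x => complex.Im (conjC (Z x))) = - rint (fun x => complex.Im (Z x)).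
by rewrite -rintN//; apply: eq_rint => x; case: (Z x).
Qed.

Definition sqn f := rint (fun x => rnorm (f x) ^+ 2).

Lemma H_second_countable : @second_countable H.
Proof. exact: hilbert_second_countable. Qed.

Lemma Hmeasurable_rnorm f : Hmeasurable f -> measurable_fun setT (fun x => rnorm (f x)).
Proof.
move=> mf; apply/borel_measurable.
have c : continuous (fun v : H => rnorm v).
  by apply: rcont_rnorm; apply/rcontP => v; exact: cvg_id.
exact: (continuous_borel_fun c mf).
Qed.

Lemma Hmeasurable2 (F : H -> H -> H) f g : rcont (fun p : H * H => F p.1 p.2) ->
  Hmeasurable f -> Hmeasurable g -> Hmeasurable (fun x => F (f x) (g x)).
Proof.
move=> cF; apply: borel_fun2; [exact: H_second_countable|exact: H_second_countable|].
by apply/rcontP.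
Qed.

Lemma rcont_fst (X Y : normedModType R[i]) : rcont (fun p : X * Y => p.1).
Proof. by apply/rcontP => p; exact: cvg_fst. Qed.

Lemma rcont_snd (X Y : normedModType R[i]) : rcont (fun p : X * Y => p.2).
Proof. by apply/rcontP => p; exact: cvg_snd. Qed.

Lemma HmeasurableD f g : Hmeasurable f -> Hmeasurable g -> Hmeasurable (fun x => f x + g x).
Proof.
by apply: (Hmeasurable2 (F := fun u v => u + v)); apply: rcontD; [exact: rcont_fst|exact: rcont_snd].
Qed.

Lemma HmeasurableZ (p : 'rV[R]_d -> R[i]) f : rcont p -> Hmeasurable f ->
  Hmeasurable (fun x => p x *: f x).
Proof.
move=> cp mf; pose F (x : 'rV[R]_d) (v : H) := p x *: v.
rewrite -[Hmeasurable _]/(borel_fun (fun x : 'rV[R]_d => F (idfun x) (f x))).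
apply: borel_fun2 => //.
- exact: rV_second_countable.
- exact: H_second_countable.
- apply/rcontP; apply: rcontZ; last by apply/rcontP => q; exact: cvg_snd.
  by apply: rcont_comp cp => q; exact: cvg_fst.
- by apply: continuous_borel => x; exact: cvg_id.
Qed.

Lemma rcont_dot (T : topologicalType) (f g : T -> H) :
  rcont f -> rcont g -> rcont (fun x => dot (f x) (g x)).
Proof.
apply: (rcont_biadditive (B := fun u v => dot u v)).
- exact: rnorm_dot.
- by move=> *; rewrite linearBl.
- by move=> *; rewrite linearBr.
Qed.

Lemma measurable_Re_dot f g : Hmeasurable f -> Hmeasurable g ->
  measurable_fun setT (fun x => complex.Re (dot (f x) (g x))).
Proof.
move=> mf mg; apply/borel_measurable.
apply: (borel_fun2 (F := fun u v => complex.Re (dot u v))) mf mg;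
  [exact: H_second_countable|exact: H_second_countable|].
by apply: rcont_Re; apply: rcont_dot; [exact: rcont_fst|exact: rcont_snd].
Qed.

Lemma measurable_Im_dot f g : Hmeasurable f -> Hmeasurable g ->
  measurable_fun setT (fun x => complex.Im (dot (f x) (g x))).
Proof.
move=> mf mg; apply/borel_measurable.
apply: (borel_fun2 (F := fun u v => complex.Im (dot u v))) mf mg;
  [exact: H_second_countable|exact: H_second_countable|].
by apply: rcont_Im; apply: rcont_dot; [exact: rcont_fst|exact: rcont_snd].
Qed.

Lemma L2norm_sqr f : (L2norm f ^+ 2 = \int[mu]_x (rnorm (f x) ^+ 2)%:E)%E.
Proof.
have := @powR_Lnorm _ _ _ mu (EFin \o rnorm \o f) 2.
rewrite pnatr_eq0 => /(_ isT).
have poweR2 (x : \bar R) : (0 <= x -> x `^ 2 = x ^+ 2)%E.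
  case: x => [r r0|_|//]; first by rewrite poweR_EFin powR_mulrn.
  by rewrite poweRyr ?pnatr_eq0// expe2 mulyy.
move=> E; rewrite /L2norm -poweR2 ?Lnorm_ge0// E.
apply: eq_integral => x _; rewrite /comp gee0_abs ?lee_fin ?rnorm_ge0// poweR_EFin.
by rewrite powR_mulrn ?rnorm_ge0.
Qed.

Lemma in_L2P f : in_L2 f <-> Hmeasurable f /\ L1 (fun x => rnorm (f x) ^+ 2).
Proof.
have -> : in_L2 f <-> Hmeasurable f /\ (\int[mu]_x (rnorm (f x) ^+ 2)%:E < +oo)%E.
  rewrite -L2norm_sqr /in_L2; split=> -[mf fi]; split => //.
    by rewrite lte_mul_pinfty ?Lnorm_ge0 ?ge0_fin_numE ?Lnorm_ge0.
  move: fi; apply: contraTT; rewrite -!leNgt !leye_eq => /eqP ->.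
  by rewrite expe2.
split=> -[mf fi]; split => //.
  apply: L1_ge0P => // [|x]; last exact: sqr_ge0.
  by apply: measurable_funX; exact: Hmeasurable_rnorm.
by move/integrableP : fi => [_]; under eq_integral do rewrite /= ger0_norm ?sqr_ge0//.
Qed.

Lemma L2norm_sqn f : in_L2 f -> (L2norm f ^+ 2 = (sqn f)%:E)%E.
Proof. by move=> /in_L2P[mf fi]; rewrite L2norm_sqr rintE. Qed.

Lemma in_L2D f g : in_L2 f -> in_L2 g -> in_L2 (fun x => f x + g x).
Proof.
move=> /in_L2P[mf fi] /in_L2P[mg gi]; apply/in_L2P; split; first exact: HmeasurableD.
apply: L1_le (L1Z 2 (L1D fi gi)).
  by apply: measurable_funX; apply: Hmeasurable_rnorm; exact: HmeasurableD.
move=> x; rewrite ger0_norm ?sqr_ge0//.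
have : rnorm (f x + g x) ^+ 2 <= (rnorm (f x) + rnorm (g x)) ^+ 2.
  by rewrite ler_sqr ?nnegrE ?addr_ge0 ?rnorm_ge0// rnormD.
have := sqr_ge0 (rnorm (f x) - rnorm (g x)); nra.
Qed.

Lemma in_L2_mul (p : 'rV[R]_d -> R[i]) (C : R) f : rcont p -> (forall x, rnorm (p x) <= C) ->
  in_L2 f -> in_L2 (fun x => p x *: f x).
Proof.
move=> cp pC /in_L2P[mf fi]; apply/in_L2P; split; first exact: HmeasurableZ.
apply: L1_le (L1Z (C ^+ 2) fi).
  by apply: measurable_funX; apply: Hmeasurable_rnorm; exact: HmeasurableZ.
move=> x; rewrite ger0_norm ?sqr_ge0// rnormZ exprMn ler_wpM2r ?sqr_ge0//.
by rewrite ler_sqr ?nnegrE ?rnorm_ge0// (le_trans (rnorm_ge0 (p x))).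
Qed.

Lemma in_L2Z (c : R[i]) f : in_L2 f -> in_L2 (fun x => c *: f x).
Proof. by apply: (in_L2_mul (C := rnorm c)) => //; exact: rcont_cst. Qed.

Lemma in_L2B f g : in_L2 f -> in_L2 g -> in_L2 (fun x => f x - g x).
Proof.
move=> lf lg; have := in_L2D lf (in_L2Z (-1) lg).
by congr in_L2; apply/funext => x; rewrite scaleN1r.
Qed.

Lemma in_L2_0 : in_L2 (fun _ : 'rV[R]_d => 0 : H).
Proof.
apply/in_L2P; split.
  by move=> U _; rewrite preimage_cst; case: ifP.
by rewrite /L1; under eq_fun do rewrite rnorm0 expr0n/=; exact: integrable0.
Qed.

Lemma in_L2_sum I (s : seq I) (u : I -> 'rV[R]_d -> H) : (forall i, in_L2 (u i)) ->
  in_L2 (fun x => \sum_(i <- s) u i x).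
Proof.
move=> lu; elim: s => [|i s IH]; first by under eq_fun do rewrite big_nil; exact: in_L2_0.
by under eq_fun do rewrite big_cons; exact: in_L2D.
Qed.

Lemma in_L2_translate a f : in_L2 f -> in_L2 (translate a f).
Proof.
move=> /in_L2P[mf fi]; apply/in_L2P; split.
  move=> U oU; rewrite -[_ @^-1` _]setTI.
  exact: (measurable_addrV (- a) measurableT (mf U oU)).
have [+ _] := rint_shift (F := fun x => rnorm (f x) ^+ 2) (- a) (L1_measurable fi).
by move=> h; apply/h.
Qed.

Lemma rcont_modulation (b : 'rV[R]_d) :
  rcont (fun x : 'rV[R]_d => cis (2 * pi * \sum_i (b ord0 i * x ord0 i))).
Proof.
have cM (t : R) : continuous (fun x : R => t * x) by exact: mulrl_continuous.
have c : continuous (fun x : 'rV[R]_d => \sum_i (b ord0 i * x ord0 i)).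
  apply: continuous_bigsum => i x.
  apply: (@continuous_comp _ _ _ (fun x : 'rV[R]_d => x ord0 i) (fun t => b ord0 i * t)) => //.
    exact: coord_continuous.
  exact: cM.
apply: rcont_cis => x.
by apply: (@continuous_comp _ _ _ _ (fun t => 2 * pi * t)); [exact: c|exact: cM].
Qed.

Lemma in_L2_gabor g alpha beta kn : in_L2 g -> in_L2 (gabor g alpha beta kn).
Proof.
move=> lg; apply: (in_L2_mul (C := 1)).
- exact: rcont_modulation.
- by move=> x; rewrite rnorm_cis.
- exact: in_L2_translate.
Qed.

Lemma cL1_dot f g : in_L2 f -> in_L2 g -> cL1 (fun x => dot (f x) (g x)).
Proof.
move=> /in_L2P[mf fi] /in_L2P[mg gi].
apply: (cL1P _ _ (L1D fi gi)).
- exact: measurable_Re_dot.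
- exact: measurable_Im_dot.
move=> x; apply: le_trans (rnorm_dot hilb _ _) _.
have := rnorm_ge0 (f x); have := rnorm_ge0 (g x); nra.
Qed.

Lemma L2dotE f g : L2dot dot f g = cint (fun x => dot (f x) (g x)).
Proof. by []. Qed.

Lemma L2dotZl c f g : in_L2 f -> in_L2 g ->
  L2dot dot (fun x => c *: f x) g = c * L2dot dot f g.
Proof.
move=> lf lg; rewrite !L2dotE -cintZ; last exact: cL1_dot.
by congr cint; apply/funext => x; rewrite dotZl.
Qed.

Lemma L2dotBl f g h : in_L2 f -> in_L2 g -> in_L2 h ->
  L2dot dot (fun x => f x - g x) h = L2dot dot f h - L2dot dot g h.
Proof.
move=> lf lg lh; rewrite !L2dotE -mulN1r -cintZ; last exact: cL1_dot.
rewrite -cintD; [|exact: cL1_dot|apply: cL1Z; exact: cL1_dot].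
by congr cint; apply/funext => x; rewrite linearBl mulN1r.
Qed.

Lemma L2dot_suml I (s : seq I) (u : I -> 'rV[R]_d -> H) h :
  (forall i, in_L2 (u i)) -> in_L2 h ->
  L2dot dot (fun x => \sum_(i <- s) u i x) h = \sum_(i <- s) L2dot dot (u i) h.
Proof.
move=> lu lh; rewrite L2dotE -cint_sum; last by move=> i; exact: cL1_dot.
by congr cint; apply/funext => x; rewrite linear_sumlz.
Qed.

Lemma L2dotC f g : in_L2 f -> in_L2 g -> L2dot dot f g = conjC (L2dot dot g f).
Proof.
move=> lf lg; rewrite !L2dotE -cint_conj; last exact: cL1_dot.
by congr cint; apply/funext => x; rewrite dotC.
Qed.

Lemma sqn_ge0 f : 0 <= sqn f.
Proof. by apply: rint_ge0 => x; exact: sqr_ge0. Qed.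

Lemma Re_L2dot_self f : complex.Re (L2dot dot f f) = sqn f.
Proof. by apply: eq_rint => x; rewrite Re_dotvv. Qed.

(** Cauchy-Schwarz in arithmetic-geometric form. The free [t] lets a small [sqn f] be traded against
    a merely bounded [sqn g], with no square root. *)
Lemma rnorm_L2dot_le f g t : in_L2 f -> in_L2 g -> 0 < t ->
  rnorm (L2dot dot f g) <= t * sqn f + t^-1 * sqn g.
Proof.
move=> lf lg t0.
have /in_L2P[mf fi] := lf; have /in_L2P[mg gi] := lg.
pose G x := t / 2 * rnorm (f x) ^+ 2 + t^-1 / 2 * rnorm (g x) ^+ 2.
have iG : L1 G by apply: L1D; exact: L1Z.
apply: le_trans (cint_le (cL1_dot lf lg) iG _) _.
  move=> x; apply: le_trans (rnorm_dot hilb _ _) _; rewrite /G.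
  have := sqr_ge0 (t * rnorm (f x) - rnorm (g x)) => h.
  rewrite -(ler_pM2l t0) mulrDr.
  have -> : t * (t^-1 / 2 * rnorm (g x) ^+ 2) = rnorm (g x) ^+ 2 / 2 by field; rewrite gt_eqF.
  nra.
rewrite /G rintD; [|exact: L1Z|exact: L1Z].
by rewrite !rintZ// -/(sqn f) -/(sqn g) le_eqVlt; apply/orP; left; apply/eqP; field; rewrite gt_eqF.
Qed.

Lemma sqn_sub f g (t : R) : in_L2 f -> in_L2 g ->
  sqn (fun x => f x - t%:C *: g x) =
  sqn f + t ^+ 2 * sqn g - 2 * t * complex.Re (L2dot dot f g).
Proof.
move=> lf lg.
have /in_L2P[mf fi] := lf; have /in_L2P[mg gi] := lg; have [ri _] := cL1_dot lf lg.
have i2 := L1Z (t ^+ 2) gi; have i3 := L1Z (- (2 * t)) ri.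
have -> : sqn (fun x => f x - t%:C *: g x) = rint (fun x =>
    rnorm (f x) ^+ 2 + t ^+ 2 * rnorm (g x) ^+ 2 + - (2 * t) * complex.Re (dot (f x) (g x))).
  apply: eq_rint => x; rewrite (rnormB_sqr hilb) dotZr rnormZ rnorm_real exprMn real_normK ?num_real//.
  by case: (dot (f x) (g x)) => a b /=; ring.
rewrite rintD//; last exact: L1D.
rewrite rintD// !rintZ// mulNr.
by [].
Qed.

End L2.

(** Young's inequality with the upper frame bound as weight: after summation the second term is
    absorbed by that bound. *)
Lemma Re_mul_conj_le {R : realType} (B : R) (a b : R[i]) : 0 < B ->
  complex.Re (a * conjC b) <= B / 2 * rnorm a ^+ 2 + (2 * B)^-1 * rnorm b ^+ 2.
Proof.
move=> B0; apply: (@le_trans _ _ (rnorm (a * conjC b))).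
  exact: le_trans (ler_norm _) (normRe_le _).
rewrite rnormM rnorm_conj.
move: (rnorm a) (rnorm b) => p q; have := sqr_ge0 (B * p - q) => hab.
rewrite -(ler_pM2l B0) mulrDr.
have -> : B * ((2 * B)^-1 * q ^+ 2) = q ^+ 2 / 2 by field; rewrite gt_eqF.
nra.
Qed.

(** * The frame operator *)

Section frame.
Context {R : realType} {H : completeNormedModType R[i]} {d : nat}.
Variable dot : {dot H for conjC}.
Hypothesis hilb : hilbert_norm dot.
Hypothesis sepH : Defs.separable H.
Notation mu := (@lebesgue_rV R d).
Notation K := ('rV[int]_d * 'rV[int]_d)%type.
Variables (g : 'rV[R]_d -> H) (alpha beta : R).
Hypothesis g2 : in_L2 g.
Implicit Types (f h u v z : 'rV[R]_d -> H).
Local Notation e_ := (gabor g alpha beta).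
Local Notation "<< f , h >>" := (L2dot dot f h).
Let ge2 kn : in_L2 (e_ kn) := in_L2_gabor sepH alpha beta kn g2.

(* S_g v = z tested against L^2, the double series being summed unconditionally. *)
Definition weak_frame_operator v z :=
  forall f, in_L2 f -> forall e : R, 0 < e -> exists F0 : {fset K}, forall F : {fset K},
    (F0 `<=` F)%fset ->
    rnorm (<<z, f>> - \sum_(kn <- F) <<v, e_ kn>> * conjC <<f, e_ kn>>) <= e.

Lemma frame_operator_weak v z : in_L2 v -> frame_operator dot g alpha beta v z ->
  weak_frame_operator v z.
Proof.
move=> lv [lz hz] f lf e e0.
(* With this [t], the term t^-1 * sqn f is at most e / 2; the error [u] is then taken with t * sqn u
   <= e / 2. The 1 keeps [t] positive. *)
pose t := 2 * (sqn f + 1) / e.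
have f0 := sqn_ge0 f.
have t0 : 0 < t by rewrite divr_gt0//; lra.
have et0 : 0 < e / (2 * t) by rewrite divr_gt0// mulr_gt0.
have nu0 : 0 < Num.sqrt (e / (2 * t)) by rewrite sqrtr_gt0.
have [F0 hF] := hz _ nu0; exists F0 => F /hF.
set u := (X in L2norm X) => hu.
have lu : in_L2 u.
  apply: in_L2B => //; apply: in_L2_sum => // kn; exact: in_L2Z.
have su : sqn u <= e / (2 * t).
  have : (L2norm u ^+ 2 <= (Num.sqrt (e / (2 * t)) ^+ 2)%:E)%E.
    rewrite EFin_expe !expe2 lee_pmul ?Lnorm_ge0//; exact: ltW.
  by rewrite (L2norm_sqn lu) lee_fin (sqr_sqrtr (ltW et0)).
have -> : \sum_(kn <- F) <<v, e_ kn>> * conjC <<f, e_ kn>> =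
    <<fun x => \sum_(kn <- F) <<v, e_ kn>> *: e_ kn x, f>>.
  rewrite L2dot_suml//; last by move=> kn; exact: in_L2Z.
  by apply: eq_bigr => kn _; rewrite L2dotZl// -L2dotC.
rewrite -L2dotBl//; last by apply: in_L2_sum => // kn; exact: in_L2Z.
apply: le_trans (rnorm_L2dot_le hilb sepH lu lf t0) _.
have h1 : t * sqn u <= e / 2.
  rewrite -ler_pdivlMl//; apply: le_trans su _.
  by rewrite le_eqVlt; apply/orP; left; apply/eqP; field; rewrite !gt_eqF.
have h2 : t^-1 * sqn f <= e / 2.
  rewrite ler_pdivrMl// /t.
  have -> : 2 * (sqn f + 1) / e * (e / 2) = sqn f + 1 by field; rewrite gt_eqF.
  lra.
lra.
Qed.

Lemma weak_frame_operatorB v z v' z' (t : R) : in_L2 v -> in_L2 z -> in_L2 v' -> in_L2 z' ->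
  weak_frame_operator v z -> weak_frame_operator v' z' ->
  weak_frame_operator (fun x => v x - t%:C *: v' x) (fun x => z x - t%:C *: z' x).
Proof.
move=> lv lz lv' lz' wv wv' f lf e e0.
have e1 : 0 < e / 2 by lra.
have e2 : 0 < e / (2 * (`|t| + 1)) by rewrite divr_gt0// mulr_gt0// ltr_wpDl.
have [F1 h1] := wv f lf _ e1; have [F2 h2] := wv' f lf _ e2.
exists (F1 `|` F2)%fset => F; rewrite fsubUset => /andP[/h1 {}h1 /h2 {}h2].
rewrite L2dotBl//; [|exact: in_L2Z]; rewrite L2dotZl//.
have -> : \sum_(kn <- F) <<fun x => v x - t%:C *: v' x, e_ kn>> * conjC <<f, e_ kn>> =
   \sum_(kn <- F) <<v, e_ kn>> * conjC <<f, e_ kn>> -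
   t%:C * \sum_(kn <- F) <<v', e_ kn>> * conjC <<f, e_ kn>>.
  rewrite mulr_sumr -sumrB; apply: eq_bigr => kn _.
  by rewrite (L2dotBl hilb sepH)//; [rewrite (L2dotZl hilb sepH)// mulrBl mulrA|exact: in_L2Z].
set p := <<z, f>> in h1 *; set q := <<z', f>> in h2 *.
set a := \sum_(kn <- F) _ in h1 *; set b := \sum_(kn <- F) _ in h2 *.
have -> : p - t%:C * q - (a - t%:C * b) = (p - a) - t%:C * (q - b) by ring.
apply: le_trans (rnormB _ _) _; rewrite rnormM rnorm_real.
have : `|t| * rnorm (q - b) <= e / 2.
  apply: (@le_trans _ _ ((`|t| + 1) * (e / (2 * (`|t| + 1))))).
    by rewrite ler_pM ?rnorm_ge0// lerDl.
  rewrite le_eqVlt; apply/orP; left; apply/eqP; field.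
  by rewrite gt_eqF// ltr_wpDl.
lra.
Qed.

Variables (A B : R).
Hypotheses (A0 : 0 < A) (AB : A <= B).
Hypothesis upper : forall f, in_L2 f -> forall F : {fset K},
  \sum_(kn <- F) rnorm <<f, e_ kn>> ^+ 2 <= B * sqn f.
Hypothesis lower : forall f, in_L2 f -> forall e : R, 0 < e -> exists F0 : {fset K},
  forall F : {fset K}, (F0 `<=` F)%fset -> A * sqn f - e <= \sum_(kn <- F) rnorm <<f, e_ kn>> ^+ 2.

(** The frame bounds give A |v|^2 <= Re <z, v> and |z|^2 <= B Re <z, v>. Expanding |v - z / B|^2,
    the second inequality leaves at most |v|^2 - Re <z, v> / B, and the first concludes. *)
Lemma weak_frame_contraction v z : in_L2 v -> in_L2 z -> weak_frame_operator v z ->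
  sqn (fun x => v x - (B^-1)%:C *: z x) <= (1 - A / B) * sqn v.
Proof.
move=> lv lz wvz.
have B0 : 0 < B by apply: lt_le_trans AB.
have lowv : A * sqn v <= complex.Re <<z, v>>.
  apply/ler_addgt0Pr => e e0; have e20 : 0 < e / 2 by lra.
  have [F1 h1] := wvz v lv _ e20; have [F2 h2] := lower lv e20.
  have {}h1 := h1 _ (fsubsetUl F1 F2); have {}h2 := h2 _ (fsubsetUr F1 F2).
  have := le_trans (normRe_le _) h1; rewrite ReB Re_sum.
  under eq_bigr do rewrite Re_mul_conj.
  rewrite ler_norml => /andP[? ?]; lra.
have upz : sqn z <= B * complex.Re <<z, v>>.
  (* <z, z> is expanded along the frame and split termwise by Young's inequality; the upper bound
     applied to [z] turns one half into |z|^2 / 2. *)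
  suff : sqn z <= (B / 2) * complex.Re <<z, v>> + sqn z / 2 by lra.
  apply/ler_addgt0Pr => e e0.
  have e1 : 0 < e / 2 by lra.
  have e2 : 0 < e / B by rewrite divr_gt0.
  have [F1 h1] := wvz z lz _ e1; have [F2 h2] := wvz v lv _ e2.
  have {}h1 := h1 _ (fsubsetUl F1 F2); have {}h2 := h2 _ (fsubsetUr F1 F2).
  have := le_trans (normRe_le _) h1; have := le_trans (normRe_le _) h2.
  rewrite !ReB !Re_sum.
  under eq_bigr do rewrite Re_mul_conj.
  rewrite Re_L2dot_self// !ler_norml.
  move=> /andP[k1 k2] /andP[k3 k4].
  have h3 := upper lz (F1 `|` F2)%fset.
  set S1 := \sum_(kn <- _) _ in k1 k2; set S3 := \sum_(kn <- _) _ in h3.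
  have : \sum_(kn <- (F1 `|` F2)%fset) complex.Re (<<v, e_ kn>> * conjC <<z, e_ kn>>) <=
      B / 2 * S1 + (2 * B)^-1 * S3.
    rewrite !mulr_sumr -big_split; apply: ler_sum => kn _; exact: Re_mul_conj_le.
  set X := \sum_(kn <- _) _ => hX.
  have hS3 : (2 * B)^-1 * S3 <= sqn z / 2.
    rewrite ler_pdivrMl ?mulr_gt0//; nra.
  have hS1 : B / 2 * S1 <= B / 2 * complex.Re <<z, v>> + e / 2.
    have -> : e / 2 = B / 2 * (e / B) by field; rewrite gt_eqF.
    rewrite -mulrDr ler_pM2l ?divr_gt0//; lra.
  rewrite -/X in k3 k4; lra.
rewrite (sqn_sub hilb sepH)//.
rewrite (L2dotC hilb sepH)//.
rewrite Re_conj.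
have h1 : B^-1 ^+ 2 * sqn z <= B^-1 * complex.Re <<z, v>>.
  rewrite -(ler_pM2l (exprn_gt0 2 B0)) mulrA -exprMn mulfV ?gt_eqF// expr1n mul1r.
  by rewrite mulrA expr2 mulfK ?gt_eqF.
have h2 : A / B * sqn v <= B^-1 * complex.Re <<z, v>>.
  by rewrite mulrAC mulrC ler_pM2l ?invr_gt0.
lra.
Qed.

End frame.

(** * Fejer means and lattice sums *)

Section poisson_limit.
Context {R : realType} {d : nat}.
Variable gam : R.
Hypothesis gam0 : 0 < gam.
Notation mu := (@lebesgue_rV R d).
Notation I := ('rV[int]_d).
Local Notation ci := (cell_index gam).

Lemma continuous_shift {Y : topologicalType} (f : 'rV[R]_d -> Y) (y : 'rV[R]_d) :
  continuous f -> continuous (fun x : 'rV[R]_d => f (x + y)).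
Proof.
move=> cf x; apply: (@cvg_comp _ _ _ (fun z : 'rV[R]_d => z + y) f _ (nbhs (x + y))).
  exact: (cvgD cvg_id (cvg_cst y)).
exact: cf.
Qed.

(** [K] stays abstract so as to cover both the Fejer kernels and the constant 1, which have the same
    mass on a cell. *)
Lemma cells_dominated (K F : 'rV[R]_d -> R) (b : I -> R) (S : R) :
  measurable_fun [set: 'rV[R]_d] K -> (forall x, 0 <= K x) ->
  (forall x m, K (x + lattice gam m) = K x) ->
  cell_integral gam K = (gam ^+ d)%:E -> summable_le b S ->
  measurable_fun [set: 'rV[R]_d] F -> (forall x, `|F x| <= b (ci x)) ->
  L1 (fun x => F x * K x) /\ gam ^- d * rint (fun x => `|F x| * K x) <= S.
Proof.
move=> mK K0 Kper cK bS mF Fb.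
have mbK : measurable_fun [set: 'rV[R]_d] (fun x : 'rV[R]_d => b (ci x) * K x).
  by apply: measurable_funM => //; exact: (measurable_cell_index gam0 b).
have le := integral_cells_le gam0 mK K0 Kper bS.
have bK0 x : 0 <= b (ci x) * K x by rewrite mulr_ge0// bS.1.
have lbK : L1 (fun x : 'rV[R]_d => b (ci x) * K x).
  apply/(L1_ge0P mbK bK0); apply: le_lt_trans le _.
  by rewrite cK -EFinM ltry.
have mFK : measurable_fun [set: 'rV[R]_d] (fun x => F x * K x) by exact: measurable_funM.
have lFK : L1 (fun x => F x * K x).
  apply: L1_le lbK => // x; rewrite normrM (ger0_norm (K0 x)).
  by rewrite ler_wpM2r.
split => //.
rewrite ler_pdivrMl ?exprn_gt0//.
rewrite -lee_fin mulrC EFinM -cK; apply: le_trans le.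
rewrite (rintE lbK) lee_fin; apply: rint_le => //.
  apply: L1_le lbK; first by apply: measurable_funM => //; exact: measurableT_comp.
  by move=> x; rewrite normrM normr_id (ger0_norm (K0 x)) ler_wpM2r.
by move=> x; rewrite ler_wpM2r.
Qed.

Lemma fejer_dominated N (F : 'rV[R]_d -> R) (b : I -> R) (S : R) : (0 < N)%N ->
  summable_le b S ->
  measurable_fun [set: 'rV[R]_d] F -> (forall x, `|F x| <= b (ci x)) ->
  L1 (fun x => F x * fejer_rV gam N x) /\
  `|gam ^- d * rint (fun x => F x * fejer_rV gam N x)| <= S.
Proof.
move=> N0 bS mF Fb.
have F0 (x : 'rV[R]_d) := fejer_rV_ge0 gam N x.
have [l le] := cells_dominated (measurable_fejer_rV gam N) F0
  (fejer_rV_per gam0 N) (cell_integral_fejer gam0 N0) bS mF Fb.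
split => //; rewrite normrM ger0_norm ?invr_ge0 ?exprn_ge0 ?(ltW gam0)//.
apply: le_trans le; rewrite ler_pM2l ?invr_gt0 ?exprn_gt0//.
apply: le_trans (rint_abs l) _; rewrite le_eqVlt; apply/orP; left; apply/eqP.
by apply: eq_rint => x; rewrite normrM (ger0_norm (F0 x)).
Qed.

Lemma sum_mem_fset (T : choiceType) (E : {fset T}) (y : T) :
  (y \in E)%:R = \sum_(m <- E) (y == m)%:R :> R.
Proof.
have [yE|yE] := boolP (y \in E).
  rewrite (big_fsetD1 y)//= eqxx big_seq big1 ?addr0// => i.
  by rewrite !inE eq_sym => /andP[/negbTE ->].
rewrite big_seq big1// => i iE; case: eqVneq => // yi; by rewrite yi iE in yE.
Qed.

Lemma rint_sum (J : Type) (s : seq J) (F : J -> 'rV[R]_d -> R) : (forall j, L1 (F j)) ->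
  L1 (fun x => \sum_(j <- s) F j x) /\
  rint (fun x => \sum_(j <- s) F j x) = \sum_(j <- s) rint (F j).
Proof.
move=> lF; elim: s => [|j s [IH1 IH2]].
  have e0 : (fun x => \sum_(j <- [::]) F j x) = (fun _ : 'rV[R]_d => 0).
    by apply/funext => x; rewrite big_nil.
  rewrite e0 big_nil; split; first exact: (integrable0 mu).
  by rewrite /rint /Rintegral integral0.
have -> : (fun x => \sum_(i <- j :: s) F i x) = (fun x => F j x + \sum_(i <- s) F i x).
  by apply/funext => x; rewrite big_cons.
by rewrite big_cons; split; [exact: L1D|rewrite rintD// IH2].
Qed.

(* The periodic Fejer kernels concentrate at the lattice points. *)
Lemma fejer_sum_limit (Phi : 'rV[R]_d -> R) (b : I -> R) (S e : R) :
  continuous Phi -> (forall x, `|Phi x| <= b (ci x)) -> summable_le b S -> 0 < e ->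
  exists N0, forall N, (N0 <= N)%N ->
    `|gam ^- d * rint (fun x => Phi x * fejer_rV gam N x) -
      \sum_(m <- enumset N) Phi (lattice gam m)| <= e.
Proof.
move=> cPhi Pb bS e0.
have e30 : 0 < e / 3 by lra.
have mPhi : measurable_fun [set: 'rV[R]_d] Phi.
  apply/borel_measurable; exact: (continuous_borel cPhi).
(* Outside [E] the family [b] sums to at most e / 3, which controls both the integral and the
   lattice sum there; the last e / 3 is spread over the cells of [E]. *)
have [M hM] := summable_le_setD bS e30.
pose E : {fset I} := enumset M.
pose n : R := 1 + (#|` E|)%:R.
have n0 : 0 < n by rewrite ltr_wpDr.
have e'0 : 0 < e / 3 / n by rewrite divr_gt0.
have loc (m : I) : exists N0, forall N, (N0 <= N)%N ->
    `|gam ^- d * rint (fun x => Phi x * fejer_rV gam N x * (ci x == m)%:R) -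
      Phi (lattice gam m)| <= e / 3 / n.
  have [] := @fejer_rV_approx R d gam gam0 (fun x => Phi (x + lattice gam m)) (b m) (e / 3 / n).
  - exact: (measurableT_comp mPhi (measurable_addrV _)).
  - by move=> x x0; apply: le_trans (Pb _) _; rewrite cell_indexD// x0 add0r.
  - exact: continuous_shift.
  - by [].
  move=> N0 hN; exists N0 => N /hN; rewrite add0r.
  set F := (fun x => Phi x * fejer_rV gam N x * (ci x == m)%:R).
  have mF : measurable_fun [set: 'rV[R]_d] F.
    apply: measurable_funM; first by apply: measurable_funM => //; exact: measurable_fejer_rV.
    exact: (measurable_cell_index gam0 (fun m' => (m' == m)%:R : R)).
  rewrite -(rint_shift (lattice gam m) mF).2.
  congr (`|_ * _ - _| <= _); apply: eq_rint => x; rewrite /F fejer_rV_per// cell_indexD//.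
  by rewrite mulrA -[ci x + m == m]subr_eq0 addrK.
have [f hf] := choice loc.
exists (\max_(i <- E) f i + M).+1%N => N NN.
have MN : (M <= N)%N by lia.
have N0 : (0 < N)%N by lia.
have mK := @measurable_fejer_rV R d gam N.
have lPK := (fejer_dominated N0 bS mPhi Pb).1.
pose PE (x : 'rV[R]_d) := Phi x * (ci x \notin E)%:R.
have mPE : measurable_fun [set: 'rV[R]_d] PE.
  by apply: measurable_funM => //; exact: (measurable_cell_index gam0 (fun m' => (m' \notin E)%:R : R)).
have [lPE hPE] : L1 (fun x => PE x * fejer_rV gam N x) /\
    `|gam ^- d * rint (fun x => PE x * fejer_rV gam N x)| <= e / 3.
  apply: (fejer_dominated N0 hM mPE) => x; by rewrite /PE normrM normr_nat ler_wpM2r.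
have lPm m : L1 (fun x => Phi x * fejer_rV gam N x * (ci x == m)%:R).
  apply: L1_le (L1_abs lPK).
    apply: measurable_funM; first exact: measurable_funM.
    exact: (measurable_cell_index gam0 (fun m' => (m' == m)%:R : R)).
  by move=> x; rewrite normrM ler_piMr// ger0_norm//; case: eqP.
have [lsum rsum] := rint_sum E lPm.
have split_rint : rint (fun x => Phi x * fejer_rV gam N x) =
    \sum_(m <- E) rint (fun x => Phi x * fejer_rV gam N x * (ci x == m)%:R) +
    rint (fun x => PE x * fejer_rV gam N x).
  rewrite -rsum -rintD//; apply: eq_rint => x.
  rewrite -mulr_sumr -sum_mem_fset /PE; case: (ci x \in E) => /=; ring.
have tail : `|\sum_(m <- (enumset N `\` E)%fset) Phi (lattice gam m)| <= e / 3.
  apply: le_trans (ler_norm_sum _ _ _) _; apply: le_trans (hM.2 (enumset N `\` E)%fset).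
  rewrite !big_seq; apply: ler_sum => m; rewrite in_fsetD => /andP[mE _].
  rewrite -/E mE mulr1; apply: le_trans (Pb _) _.
  by rewrite cell_index_lattice.
have main : `|\sum_(m <- E) (gam ^- d * rint (fun x => Phi x * fejer_rV gam N x * (ci x == m)%:R) -
      Phi (lattice gam m))| <= e / 3.
  apply: le_trans (ler_norm_sum _ _ _) _.
  apply: (@le_trans _ _ (\sum_(m <- E) (e / 3 / n))).
    rewrite !big_seq; apply: ler_sum => m mE; apply: hf.
    apply: leq_trans (leq_trans (leq_addr M _) (ltnW NN)).
    by rewrite (big_fsetD1 m)//= leq_maxl.
  rewrite big_const_seq count_predT iter_addr_0 -[(_ / n) *+ _]mulr_natr.
  have nE : e / 3 / n * n = e / 3 by rewrite divfK// gt_eqF.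
  by rewrite -[leRHS]nE ler_pM2l// lerDr.
rewrite split_rint (sum_fsetD _ (enumset_mono MN)) -/E.
move: main; rewrite sumrB -mulr_sumr.
move: (\sum_(m <- E) rint _) hPE tail => s1.
move: (rint _) (\sum_(m <- E) _) (\sum_(m <- (_ `\` _)%fset) _) => s2 s3 s4.
rewrite mulrDr; move: (gam ^- d * s1) (gam ^- d * s2) => p q.
by rewrite !ler_norml => /andP[? ?] /andP[? ?] /andP[? ?]; apply/andP; split; lra.
Qed.

End poisson_limit.

(** * Double series by square partial sums *)

Section rectangle.
Context {R : realType} {I : countType}.
Implicit Types (D : I -> I -> R).

Definition rect {V : nmodType} (t : I -> I -> V) N : V :=
  \sum_(k <- enumset N) \sum_(m <- enumset N) t k m.

Lemma rectB {V : zmodType} (t : I -> I -> V) M N : (N <= M)%N ->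
  rect t M - rect t N =
  \sum_(k <- enumset N) \sum_(m <- (enumset M `\` enumset N)%fset) t k m +
  \sum_(k <- (enumset M `\` enumset N)%fset) \sum_(m <- enumset M) t k m.
Proof.
move=> NM; rewrite /rect (sum_fsetD _ (enumset_mono NM)).
under [X in X + _ - _]eq_bigr do rewrite (sum_fsetD _ (enumset_mono NM)).
rewrite big_split/=.
move: (\sum_(i <- enumset N) \sum_(j <- enumset N) _) => a.
by rewrite -[a + _ + _]addrA [a + _]addrC addrK.
Qed.

(** Both differences run over the same pairs, so the Cauchy property passes from the majorant to the
    vector-valued series. *)
Lemma rect_diff_le {V : normedZmodType R[i]} (t : I -> I -> V) D M N :
  (forall k m, rnorm (t k m) <= D k m) -> (N <= M)%N ->
  rnorm (rect t M - rect t N) <= rect D M - rect D N.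
Proof.
move=> tD NM; rewrite !rectB//; apply: le_trans (rnormD _ _) _; apply: lerD.
  apply: le_trans (rnorm_sum _ _ _) _; apply: ler_sum => k _.
  by apply: le_trans (rnorm_sum _ _ _) _; exact: ler_sum.
apply: le_trans (rnorm_sum _ _ _) _; apply: ler_sum => k _.
by apply: le_trans (rnorm_sum _ _ _) _; exact: ler_sum.
Qed.

Lemma rect_cauchy D S : (forall k m, 0 <= D k m) -> (forall N, rect D N <= S) ->
  forall e, 0 < e -> exists N0, forall M N, (N0 <= N)%N -> (N <= M)%N ->
    rect D M - rect D N <= e.
Proof.
move=> D0 DS e e0.
have nd : nondecreasing_seq (rect D).
  move=> N M NM; rewrite -subr_ge0 rectB// addr_ge0// sumr_ge0// => k _; exact: sumr_ge0.
have cv : cvgn (rect D).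
  by apply: nondecreasing_is_cvgn => //; exists S => _ [N _ <-].
have /cvgrPdist_le/(_ e e0)[N0 _ hN] := cv.
exists N0 => M N N0N NM; have := hN N N0N; rewrite /= ler_norml => /andP[_ h].
have := nondecreasing_cvgn_le nd cv M; lra.
Qed.

End rectangle.

(** * Walnut's representation *)

Section walnut_operator.
Context {R : realType} {H : completeNormedModType R[i]} {d : nat}.
Variable dot : {dot H for conjC}.
Hypothesis hilb : hilbert_norm dot.
Variable gam : R.
Hypothesis gam0 : 0 < gam.
Local Notation I := ('rV[int]_d).
Local Notation lat := (lattice gam).
Local Notation ci := (cell_index gam).
Variables (v : I -> 'rV[R]_d -> H) (c : I -> I -> R) (C : R).
Hypothesis vcont : forall k, rcont (v k).
Hypothesis v_le : forall k m (x : 'rV[R]_d), `|x| < 2 * gam -> rnorm (v k (x + lat m)) <= c m k.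
Hypothesis c_row : forall m, summable_le (c m) C.
Hypothesis c_col : forall k, summable_le (fun m => c m k) C.
Implicit Types (h : 'rV[R]_d -> H) (b : I -> R).

Let c0 m k : 0 <= c m k. Proof. exact: (c_row m).1. Qed.
Let cC m k : c m k <= C.
Proof. by have := (c_row m).2 [fset k]%fset; rewrite big_seq_fset1. Qed.
Let C0 : 0 <= C. Proof. exact: le_trans (cC 0 0). Qed.

Let lt2 (x : 'rV[R]_d) : `|x| < gam -> `|x| < 2 * gam.
Proof. by move=> xg; apply: lt_le_trans xg _; rewrite mulr_natl mulr2n lerDl ltW. Qed.

(* The cells overlap (the lattice has step [gam]) so that translates of a tame function
   by a non-lattice vector are still controlled by [b]. *)
Definition tame h b S := [/\ rcont h, summable_le b S &
  forall m (x : 'rV[R]_d), `|x| < 2 * gam -> rnorm (h (x + lat m)) <= b m].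

Definition walnut_term h (y : 'rV[R]_d) (k m : I) :=
  dot (h (y + lat m)) (v k (y + lat m)) *: v k y.

(** [c m k] bounds [v k] around the m-th lattice point. For fixed [k] the sum over [m] sees only the
    first two factors, which leads to [walnut_p]. *)
Definition walnut_bound b (m0 k m : I) := b (m0 + m) * c (m0 + m) k * c m0 k.

(* [gam ^+ d *: walnut h] is S_g h, by [walnut_representation]. *)
Definition walnut h (y : 'rV[R]_d) : H := limn (rect (walnut_term h y)).

Lemma walnut_term_le h b S (x : 'rV[R]_d) m0 k m : tame h b S -> `|x| < 2 * gam ->
  rnorm (walnut_term h (x + lat m0) k m) <= walnut_bound b m0 k m.
Proof.
move=> [_ [b0 _] hb] xg; rewrite rnormZ /walnut_bound ler_pM ?rnorm_ge0//; last exact: v_le.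
apply: le_trans (rnorm_dot hilb _ _) _.
by rewrite -addrA -latticeD ler_pM ?rnorm_ge0//; [exact: hb|exact: v_le].
Qed.

Lemma walnut_bound_ge0 b S m0 k m : summable_le b S -> 0 <= walnut_bound b m0 k m.
Proof. by move=> [b0 _]; rewrite /walnut_bound !mulr_ge0. Qed.

Lemma summable_le_shift b S m0 : summable_le b S -> summable_le (fun m => b (m0 + m)) S.
Proof. by apply: summable_le_inj; exact: addrI. Qed.

(** The factor [c m0 k] is bounded by C entrywise, the other one is summed along its row, and [b] is
    summed last. *)
Lemma rect_walnut_bound b S m0 N : summable_le b S -> rect (walnut_bound b m0) N <= C * C * S.
Proof.
move=> bS; have [b0 _] := bS.
rewrite /rect exchange_big/=.
apply: (@le_trans _ _ (\sum_(m <- enumset N) C * C * b (m0 + m))); last first.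
  by rewrite -mulr_sumr ler_wpM2l ?mulr_ge0//; exact: (summable_le_shift m0 bS).2.
apply: ler_sum => m _.
apply: (@le_trans _ _ (\sum_(k <- enumset N) b (m0 + m) * C * c (m0 + m) k)).
  apply: ler_sum => k _; rewrite /walnut_bound.
  by rewrite -!mulrA [C * _]mulrC ler_wpM2l// ler_wpM2l.
rewrite -mulr_sumr.
have -> : C * C * b (m0 + m) = b (m0 + m) * C * C by ring.
by rewrite ler_wpM2l ?mulr_ge0// (c_row (m0 + m)).2.
Qed.

(** The majorant does not depend on [x], so one N0 serves a whole overlapping cell. *)
Lemma walnut_cauchy h b S m0 e : tame h b S -> 0 < e -> exists N0,
  forall (x : 'rV[R]_d) M N, `|x| < 2 * gam -> (N0 <= M)%N -> (N0 <= N)%N ->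
  rnorm (rect (walnut_term h (x + lat m0)) M - rect (walnut_term h (x + lat m0)) N) <= e.
Proof.
move=> th e0; have [_ bS _] := th.
have [|N0 hN] := rect_cauchy _ (fun N => rect_walnut_bound m0 N bS) e0.
  by move=> k m; exact: walnut_bound_ge0 bS.
exists N0 => x M N xg N0M N0N.
have t_le k m := walnut_term_le m0 k m th xg.
have [NM|MN] := leqP N M.
  exact: le_trans (rect_diff_le t_le NM) (hN _ _ N0N NM).
rewrite rnorm_subC; exact: le_trans (rect_diff_le t_le (ltnW MN)) (hN _ _ N0M (ltnW MN)).
Qed.

Lemma cell_decomp (y : 'rV[R]_d) : exists2 x : 'rV[R]_d, `|x| < gam & y = x + lat (ci y).
Proof. by exists (y - lat (ci y)); rewrite ?subrK//; exact: cell_residue. Qed.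

Lemma walnut_cvg h b S y : tame h b S -> rect (walnut_term h y) @ \oo --> walnut h y.
Proof.
move=> th; have [x xg ->] := cell_decomp y.
apply: cauchy_rnorm_cvg => e e0; have e20 : 0 < e / 2 by lra.
have [N0 hN] := walnut_cauchy (ci y) th e20.
exists N0 => M N N0M N0N; apply: le_lt_trans (hN x M N (lt2 xg) N0M N0N) _; lra.
Qed.

Lemma rnorm_limit_le (u : nat -> H) l a (e : R) : u @ \oo --> l ->
  (exists N0, forall N, (N0 <= N)%N -> rnorm (a - u N) <= e) -> rnorm (a - l) <= e.
Proof.
move=> /cvg_rnormP ul [N0 hN]; apply/ler_addgt0Pr => e' e'0.
have [N1 _ h1] := ul _ e'0.
have := h1 (N0 + N1)%N (leq_addl _ _); have := hN (N0 + N1)%N (leq_addr _ _).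
move=> /= hx hy; have := rnormD (a - u (N0 + N1)%N) (u (N0 + N1)%N - l).
rewrite addrA subrK; rewrite rnorm_subC in hy; lra.
Qed.

Lemma walnut_unif h b S m0 e : tame h b S -> 0 < e -> exists N0,
  forall (x : 'rV[R]_d) N, `|x| < 2 * gam -> (N0 <= N)%N ->
  rnorm (rect (walnut_term h (x + lat m0)) N - walnut h (x + lat m0)) <= e.
Proof.
move=> th e0; have [N0 hN] := walnut_cauchy m0 th e0.
exists N0 => x N xg N0N; apply: rnorm_limit_le (walnut_cvg th) _.
by exists N0 => M N0M; exact: hN.
Qed.

Lemma rcont_shift (X : normedZmodType R[i]) (f : 'rV[R]_d -> X) (y : 'rV[R]_d) :
  rcont f -> rcont (fun x : 'rV[R]_d => f (x + y)).
Proof.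
move=> cf; apply: (@rcont_comp _ _ _ _ f (fun x : 'rV[R]_d => x + y)) => // x.
exact: (cvgD cvg_id (cvg_cst y)).
Qed.

Lemma rcont_walnut h b S : tame h b S -> rcont (walnut h).
Proof.
move=> th; have [ch _ _] := th.
apply: (@rcont_uniform_limit _ _ _ (fun N y => rect (walnut_term h y) N)).
  move=> N; apply: rcont_sum => k; apply: rcont_sum => m.
  by apply: rcontZ => //; apply: rcont_dot => //; exact: rcont_shift.
move=> y e e0; have [N hN] := walnut_unif (ci y) th e0; exists N.
have [x xg yE] := cell_decomp y.
(* A point within gam of [y] is within 2 gam of the same lattice point: the overlap of the cells
   gives uniformity on a full neighbourhood, also at cell boundaries. *)
have := nbhsx_ballx y gam gam0; apply: filterS => z; rewrite -ball_normE /= => yz.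
have zE : z = (z - lat (ci y)) + lat (ci y) by rewrite subrK.
rewrite rnorm_subC zE; apply: hN => //.
have -> : z - lat (ci y) = x - (y - z).
  have -> : x = y - lat (ci y) by rewrite {1}yE addrK.
  by move: (lat _) => L; apply/rowP => i; rewrite !mxE; ring.
by apply: le_lt_trans (ler_normB _ _) _; lra.
Qed.

(** Schur's test in two steps: this is the transpose of [c] applied to [b], and [walnut_b] applies
    [c] to the result. Row sums of [c] control the first step, column sums the second. *)
Definition walnut_p b k := total (fun m => b m * c m k).

Lemma walnut_p_summable b S k : summable_le b S -> summable_le (fun m => b m * c m k) (S * C).
Proof.
move=> bS; apply: (@summable_le_mono _ _ (fun m => C * b m)).
  by move=> m; rewrite mulr_ge0 ?bS.1//= mulrC ler_wpM2r ?bS.1.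
by rewrite mulrC; exact: summable_leZ.
Qed.

Lemma walnut_p_ge0 b S k : summable_le b S -> 0 <= walnut_p b k.
Proof. by move=> bS; exact: total_ge0 (walnut_p_summable k bS). Qed.

Lemma summable_walnut_p b S : summable_le b S -> summable_le (walnut_p b) (S * C).
Proof.
move=> bS; split => [k|F]; first exact: walnut_p_ge0 bS.
apply: (@total_sum _ _ _ _ (fun k m => b m * c m k) (fun=> S * C)).
  by move=> k; exact: walnut_p_summable.
move=> G; apply: (@le_trans _ _ (\sum_(m <- G) b m * C)).
  by apply: ler_sum => m _; rewrite -mulr_sumr ler_wpM2l ?bS.1// (c_row m).2.
by rewrite -mulr_suml ler_wpM2r// bS.2.
Qed.

Definition walnut_b b m0 := total (fun k => walnut_p b k * c m0 k).

Lemma walnut_b_row b S m0 : summable_le b S ->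
  summable_le (fun k => walnut_p b k * c m0 k) (S * C * C).
Proof.
move=> bS; have pS := summable_walnut_p bS.
apply: (@summable_le_mono _ _ (fun k => C * walnut_p b k)).
  by move=> k; rewrite mulr_ge0 ?pS.1//= mulrC ler_wpM2r ?pS.1.
by rewrite mulrC; exact: summable_leZ.
Qed.

Lemma summable_walnut_b b S : summable_le b S -> summable_le (walnut_b b) (S * C * C).
Proof.
move=> bS; have pS := summable_walnut_p bS; split => [m|F].
  exact: total_ge0 (walnut_b_row m bS).
apply: (@total_sum _ _ _ _ (fun m k => walnut_p b k * c m k) (fun=> S * C * C)).
  by move=> m; exact: walnut_b_row.
move=> G; apply: (@le_trans _ _ (\sum_(k <- G) walnut_p b k * C)).
  by apply: ler_sum => k _; rewrite -mulr_sumr ler_wpM2l ?pS.1// (c_col k).2.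
by rewrite -mulr_suml ler_wpM2r// pS.2.
Qed.

Lemma summable_walnut_col b S m0 k : summable_le b S ->
  summable_le (fun m => b (m0 + m) * c (m0 + m) k) (walnut_p b k).
Proof.
move=> bS; have pS := walnut_p_summable k bS; split => [m|F]; first exact: pS.1.
have := sum_le_total [fset (m0 + m)%R | m in F]%fset pS.
by rewrite big_imfset//= => x y _ _; exact: addrI.
Qed.

Lemma sum_walnut_bound b S m0 k (F : {fset I}) : summable_le b S ->
  \sum_(m <- F) walnut_bound b m0 k m <= walnut_p b k * c m0 k.
Proof.
move=> bS; rewrite -mulr_suml ler_wpM2r//; exact: (summable_walnut_col m0 k bS).2.
Qed.

Lemma tame_walnut h b S : tame h b S -> tame (walnut h) (walnut_b b) (S * C * C).
Proof.
move=> th; have [ch bS hb] := th; split; [exact: rcont_walnut th|exact: summable_walnut_b|].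
move=> m x xg.
have h1 N : rnorm (rect (walnut_term h (x + lat m)) N) <= walnut_b b m.
  apply: le_trans (rnorm_sum _ _ _) _.
  apply: le_trans (sum_le_total (enumset N) (walnut_b_row m bS)).
  apply: ler_sum => k _; apply: le_trans (rnorm_sum _ _ _) _.
  apply: le_trans (sum_walnut_bound m k (enumset N) bS).
  by apply: ler_sum => m' _; exact: walnut_term_le th xg.
have := @rnorm_limit_le (rect (walnut_term h (x + lat m))) (walnut h (x + lat m)) 0
  (walnut_b b m) (walnut_cvg th); rewrite sub0r rnormN; apply.
by exists 0%N => N _; rewrite sub0r rnormN.
Qed.

(** In the series at [y] the function [h] is evaluated only at the points [y + lat m], where [chi]
    equals [chi y]. *)
Lemma walnut_periodic h b S (chi : 'rV[R]_d -> R[i]) y :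
  tame h b S -> (forall x m, chi (x + lat m) = chi x) ->
  walnut (fun x => chi x *: h x) y = chi y *: walnut h y.
Proof.
move=> th per; rewrite /walnut.
have -> : rect (walnut_term (fun x => chi x *: h x) y) =
    fun N => chi y *: rect (walnut_term h y) N.
  apply/funext => N; rewrite /rect scaler_sumr; apply: eq_bigr => k _.
  rewrite scaler_sumr; apply: eq_bigr => m _.
  by rewrite /walnut_term per dotZl scalerA.
by apply: cvg_lim => //; apply: cvgZ; [exact: cvg_cst|exact: walnut_cvg th].
Qed.

Lemma tameD h b S h' b' S' : tame h b S -> tame h' b' S' ->
  tame (fun x => h x + h' x) (fun m => b m + b' m) (S + S').
Proof.
move=> [ch [b0 bS] hb] [ch' [b0' bS'] hb']; split; first exact: rcontD.
  split => [m|F]; first by rewrite addr_ge0.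
  by rewrite big_split/= lerD.
by move=> m x xg; apply: le_trans (rnormD _ _) _; apply: lerD; [exact: hb|exact: hb'].
Qed.

Lemma tameM h b S (chi : 'rV[R]_d -> R[i]) (B : R) : rcont chi ->
  (forall x, rnorm (chi x) <= B) ->
  tame h b S -> tame (fun x => chi x *: h x) (fun m => B * b m) (B * S).
Proof.
move=> cchi chiB [ch bS hb].
have B0 : 0 <= B by apply: le_trans (chiB 0); exact: rnorm_ge0.
split; [exact: rcontZ|exact: summable_leZ|].
by move=> m x xg; rewrite rnormZ ler_pM ?rnorm_ge0//; exact: hb.
Qed.

Lemma tame_cell h b S y : tame h b S -> rnorm (h y) <= b (ci y).
Proof.
move=> [_ _ hb]; have [x xg {1}->] := cell_decomp y; apply: hb.
exact: lt2.
Qed.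

End walnut_operator.

(** * Fourier coefficients of the lattice Fejer kernel *)

Section fejer_lattice.
Context {R : realType} {d : nat}.
Variable beta : R.
Hypothesis beta0 : 0 < beta.
Notation I := ('rV[int]_d).

Lemma big_fsetM (V : nmodType) (J K : choiceType) (A : {fset J}) (B : {fset K}) (F : J -> K -> V) :
  \sum_(k <- A) \sum_(n <- B) F k n = \sum_(p <- (A `*` B)%fset) F p.1 p.2.
Proof. by rewrite /fsetM big_imfset2//= => -[? ?] [? ?] _ _ /= [-> ->]. Qed.

Lemma sum_fin_imfset (V : nmodType) (J : finType) (K : choiceType) (h : J -> K) (F : K -> V) :
  injective h -> \sum_(s : J) F (h s) = \sum_(n <- [fset h s | s in J]%fset) F n.
Proof.
move=> ih; rewrite big_imfset/=; last by move=> x y _ _; exact: ih.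
by rewrite big_enum_cond.
Qed.

Definition fejer_index N (s : {ffun 'I_d -> 'I_(N + N).+1}) : I := \row_i ((s i)%:Z - N%:Z).

Definition fejer_support N : {fset I} := [fset fejer_index s | s in {ffun 'I_d -> 'I_(N + N).+1}]%fset.

Definition fejer_weight N (n : I) : R := \prod_(i < d) fejer_wt N (n ord0 i).

Definition lattice_phase (n : I) (x : 'rV[R]_d) : R :=
  2 * pi * \sum_i (lattice beta n ord0 i * x ord0 i).

Lemma fejer_index_inj N : injective (@fejer_index N).
Proof.
move=> s s' ss'; apply/ffunP => i; apply/val_inj => /=.
have /rowP/(_ i) := ss'; rewrite !mxE; lia.
Qed.

(** Each coordinate factor is a trigonometric sum; distributing the product gives one frequency per
    choice function from coordinates to indices. *)
Lemma fejer_rV_trig N x : (0 < N)%N -> (fejer_rV beta^-1 N x)%:C =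
  \sum_(n <- fejer_support N) (fejer_weight N n)%:C * cis (lattice_phase n x).
Proof.
move=> N0; rewrite /fejer_support -(@sum_fin_imfset _ _ _ _
  (fun n => (fejer_weight N n)%:C * cis (lattice_phase n x)) (@fejer_index_inj N)).
rewrite /fejer_rV rmorph_prod /=.
under eq_bigr do rewrite invrK fejer_trig//.
rewrite bigA_distr_bigA/=; apply: eq_bigr => s _.
rewrite big_split/= /fejer_weight rmorph_prod; congr (_ * _).
  by apply: eq_bigr => i _; rewrite mxE.
rewrite /lattice_phase mulr_sumr.
have cis_sum (J : Type) (r : seq J) (F : J -> R) : cis (\sum_(i <- r) F i) = \prod_(i <- r) cis (F i).
  by elim: r => [|j r IH]; rewrite ?big_nil ?cis0// !big_cons cisD IH.
by rewrite cis_sum; apply: eq_bigr => i _; rewrite !mxE.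
Qed.

Lemma fejer_weight_itv N n : n \in fejer_support N -> 0 <= fejer_weight N n <= 1.
Proof.
move=> /imfsetP[/= s _ ->]; rewrite /fejer_weight.
have wt i : 0 <= (fejer_wt N (fejer_index s ord0 i) : R) <= 1.
  have nN : (`|fejer_index s ord0 i| <= N%:Z)%R.
    by rewrite mxE; have := ltn_ord (s i); lia.
  rewrite /fejer_wt; apply/andP; split; last by rewrite lerBlDr lerDl divr_ge0.
  have nR : `|(fejer_index s ord0 i)%:~R| <= N%:R :> R.
    by move: nN; rewrite -(ler_int R) intr_norm.
  (* For N = 0 the quotient by N is 0 and the weight is 1. *)
  have [NE|N0] := posnP N.
    by rewrite (_ : N%:R = 0 :> R) ?invr0 ?mulr0 ?subr0 ?NE.
  by rewrite subr_ge0 ler_pdivrMr ?ltr0n// mul1r.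
apply/andP; split; first by apply: prodr_ge0 => i _; have /andP[] := wt i.
apply: (@le_trans _ _ (\prod_(i < d) (1 : R))); last by rewrite big1.
by apply: ler_prod => i _; exact: wt.
Qed.

Lemma fejer_support_sub (n : I) : exists N0, forall N, (N0 <= N)%N -> n \in fejer_support N.
Proof.
clear beta0.
exists (\sum_i `|n ord0 i|)%N => N nN.
have h i : (`|n ord0 i| <= N)%N.
  by apply: leq_trans nN; rewrite (bigD1 i)//= leq_addr.
have h' i : (absz (n ord0 i + N%:Z)%R < (N + N).+1)%N by have := h i; lia.
apply/imfsetP; exists [ffun i => Ordinal (h' i)] => //.
apply/rowP => i; rewrite mxE ffunE /=; move: (h i).
move: (n _ i) => k hk.
lia.
Qed.

Lemma fejer_weight_cvg n : (fun N => fejer_weight N n) @ \oo --> (1 : R).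
Proof.
have -> : (1 : R) = \prod_(i < d) 1 by rewrite big1.
have inv0 : (fun N : nat => N%:R^-1 : R) @ \oo --> (0 : R).
  rewrite -(cvg_shiftS (fun N : nat => N%:R^-1 : R)); exact: cvg_harmonic.
apply: cvg_big => [|i _]; first exact: mul_continuous.
rewrite -[X in _ --> X](subr0 1) -[X in _ - X](mulr0 (`|(n ord0 i)%:~R|)).
by apply: cvgB; [exact: cvg_cst|apply: cvgM; [exact: cvg_cst|exact: inv0]].
Qed.

(** Evenness is what lets the frequency sum, which depends on x - z, be read as the kernel at z -
    x. *)
Lemma fejer_rVN N (x : 'rV[R]_d) : fejer_rV beta^-1 N (- x) = fejer_rV beta^-1 N x.
Proof.
apply: eq_bigr => i _; rewrite !mxE !fejer_cos; congr (_ * _).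
by apply: eq_bigr => j _; apply: eq_bigr => l _; rewrite mulrN mulrN cosN.
Qed.

End fejer_lattice.

(** * Complex Fejer means, and square integrability from cell bounds *)

Section fejer_means.
Context {R : realType} {H : completeNormedModType R[i]} {d : nat}.
Variable dot : {dot H for conjC}.
Hypothesis hilb : hilbert_norm dot.
Hypothesis sepH : Defs.separable H.
Notation mu := (@lebesgue_rV R d).
Notation I := ('rV[int]_d).
Variable gam : R.
Hypothesis gam0 : 0 < gam.
Local Notation lat := (lattice gam).
Local Notation ci := (cell_index gam).

Lemma cint_shift (Z : 'rV[R]_d -> R[i]) y : cL1 Z -> cint (fun x => Z (x + y)) = cint Z.
Proof.
move=> [lr li]; rewrite /cint; congr (_ +i* _).
  exact: (rint_shift y (L1_measurable lr)).2.
exact: (rint_shift y (L1_measurable li)).2.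
Qed.

Lemma Re_mulr_real (z : R[i]) (t : R) : complex.Re (z * t%:C) = complex.Re z * t.
Proof. by case: z => a b /=; rewrite mulr0 subr0. Qed.

Lemma Im_mulr_real (z : R[i]) (t : R) : complex.Im (z * t%:C) = complex.Im z * t.
Proof. by case: z => a b /=; rewrite mulr0 add0r. Qed.

Lemma fejer_cint_dominated N (Phi : 'rV[R]_d -> R[i]) b S : (0 < N)%N -> rcont Phi ->
  summable_le b S -> (forall x, rnorm (Phi x) <= b (ci x)) ->
  cL1 (fun x => Phi x * (fejer_rV gam N x)%:C) /\
  rnorm ((gam ^- d)%:C * cint (fun x => Phi x * (fejer_rV gam N x)%:C)) <= 2 * S.
Proof.
move=> N0 cPhi bS Pb.
have mRe : measurable_fun [set: 'rV[R]_d] (fun x => complex.Re (Phi x)).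
  by apply/borel_measurable; apply: continuous_borel; exact: rcont_Re.
have mIm : measurable_fun [set: 'rV[R]_d] (fun x => complex.Im (Phi x)).
  by apply/borel_measurable; apply: continuous_borel; exact: rcont_Im.
have [lRe hRe] := fejer_dominated gam0 N0 bS mRe (fun x => le_trans (normRe_le _) (Pb x)).
have [lIm hIm] := fejer_dominated gam0 N0 bS mIm (fun x => le_trans (normIm_le _) (Pb x)).
split; first by split; [under eq_fun do rewrite Re_mulr_real|under eq_fun do rewrite Im_mulr_real].
rewrite mulrC; apply: le_trans (rnormC_le _) _; rewrite Re_mulr_real Im_mulr_real /=.
under eq_rint do rewrite Re_mulr_real.
under [X in _ + `|X * _|]eq_rint do rewrite Im_mulr_real.
by rewrite ![_ * gam ^- d]mulrC mulr_natl mulr2n lerD.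
Qed.

Lemma fejer_cint_limit (Phi : 'rV[R]_d -> R[i]) b S e : rcont Phi ->
  summable_le b S -> (forall x, rnorm (Phi x) <= b (ci x)) -> 0 < e ->
  exists N0, forall N, (N0 <= N)%N ->
    rnorm ((gam ^- d)%:C * cint (fun x => Phi x * (fejer_rV gam N x)%:C) -
      \sum_(m <- enumset N) Phi (lat m)) <= e.
Proof.
move=> cPhi bS Pb e0; have e20 : 0 < e / 2 by lra.
have [N1 h1] := fejer_sum_limit gam0 (rcont_Re cPhi) (fun x => le_trans (normRe_le _) (Pb x)) bS e20.
have [N2 h2] := fejer_sum_limit gam0 (rcont_Im cPhi) (fun x => le_trans (normIm_le _) (Pb x)) bS e20.
exists (N1 + N2)%N => N NN.
have {}h1 := h1 N (leq_trans (leq_addr _ _) NN); have {}h2 := h2 N (leq_trans (leq_addl _ _) NN).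
have ImB (z z' : R[i]) : complex.Im (z - z') = complex.Im z - complex.Im z' by case: z z' => ? ? [].
have Im_sum (s : seq I) (F : I -> R[i]) : complex.Im (\sum_(i <- s) F i) = \sum_(i <- s) complex.Im (F i).
  by rewrite raddf_sum.
apply: le_trans (rnormC_le _) _; rewrite ReB ImB Re_sum Im_sum mulrC Re_mulr_real Im_mulr_real.
rewrite ![_ * gam ^- d]mulrC /=.
under eq_rint do rewrite Re_mulr_real.
under [X in _ + `|_ * X - _|]eq_rint do rewrite Im_mulr_real.
lra.
Qed.

Lemma L1_cells (b : I -> R) S : summable_le b S -> L1 (fun x : 'rV[R]_d => b (ci x)).
Proof.
move=> bS; have mb := measurable_cell_index gam0 b.
have [] := @cells_dominated R d gam gam0 (fun=> 1) (b \o ci) b S _ _ _ (cell_integral1 gam0) bS mb.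
- exact: measurable_cst.
- by move=> x; exact: ler01.
- by [].
- by move=> x /=; rewrite ger0_norm// bS.1.
- by under eq_fun do rewrite mulr1.
Qed.

(** Each [b m] is at most S, hence [b m ^+ 2 <= S * b m]. *)
Lemma summable_le_sqr (b : I -> R) S : summable_le b S -> summable_le (fun m => b m ^+ 2) (S * S).
Proof.
move=> bS; apply: (@summable_le_mono _ _ (fun m => S * b m)).
  move=> m; rewrite sqr_ge0 expr2 ler_wpM2r ?bS.1//=.
  by have := bS.2 [fset m]%fset; rewrite big_seq_fset1.
apply: summable_leZ => //; apply: le_trans (bS.2 fset0); by rewrite big_seq_fset0.
Qed.

Lemma in_L2_cells (f : 'rV[R]_d -> H) b S : Hmeasurable f -> summable_le b S ->
  (forall x, rnorm (f x) <= b (ci x)) -> in_L2 f.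
Proof.
move=> mf bS fb; apply/in_L2P; split => //.
apply: L1_le (L1_cells (summable_le_sqr bS)).
  by apply: measurable_funX; exact: Hmeasurable_rnorm.
by move=> x; rewrite ger0_norm ?sqr_ge0// ler_pXn2r ?nnegrE ?rnorm_ge0 ?bS.1.
Qed.

Lemma tame_in_L2 (h : 'rV[R]_d -> H) b S : tame gam h b S -> in_L2 h.
Proof.
move=> th; have [ch bS _] := th; apply: in_L2_cells bS _ => [U oU|x].
  by apply: (continuous_borel _ oU); apply/rcontP.
exact: (tame_cell gam0 x th).
Qed.

Lemma sqn_dominated_cvg (u : nat -> 'rV[R]_d -> H) b S : (forall N, Hmeasurable (u N)) ->
  summable_le b S -> (forall N x, rnorm (u N x) <= b (ci x)) ->
  (forall x e, 0 < e -> exists N0, forall N, (N0 <= N)%N -> rnorm (u N x) <= e) ->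
  (fun N => sqn (u N)) @ \oo --> (0 : R).
Proof.
move=> mu_ bS ub u0.
have mU N : measurable_fun [set: 'rV[R]_d] (fun x => rnorm (u N x) ^+ 2).
  by apply: measurable_funX; exact: Hmeasurable_rnorm.
have lb := L1_cells (summable_le_sqr bS).
have [|||||_ _] := @dominated_convergence _ _ R mu setT measurableT
  (fun N x => (rnorm (u N x) ^+ 2)%:E) (fun=> 0%E) (fun x => (b (ci x) ^+ 2)%:E).
- by move=> N; apply/measurable_EFinP; exact: mU.
- exact: measurable_cst.
- apply: aeW => x _; apply/fine_cvgP; split; first exact: nearW.
  apply/cvgrPdist_le => e e0 /=.
  (* A norm at most 1 and at most e has a square at most e. *)
  have [] := u0 x (Num.min 1 e); first by rewrite lt_min ltr01.
  move=> N0 hN; exists N0 => // N /= N0N; have := hN N N0N.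
  rewrite le_min => /andP[h1 h2]; rewrite sub0r normrN ger0_norm ?sqr_ge0//.
  by apply: le_trans h2; rewrite expr2 ler_piMr// rnorm_ge0.
- exact: lb.
- apply: aeW => x N _ /=; rewrite lee_fin ger0_norm ?sqr_ge0//.
  by rewrite ler_pXn2r ?nnegrE ?rnorm_ge0 ?bS.1.
rewrite integral0 => cv.
have lu N : L1 (fun x => rnorm (u N x) ^+ 2).
  apply: L1_le lb => // x; rewrite ger0_norm ?sqr_ge0//.
  by rewrite ler_pXn2r ?nnegrE ?rnorm_ge0 ?bS.1.
have cvE : (fun N => (sqn (u N))%:E) @ \oo --> 0%E.
  rewrite (_ : (fun N => (sqn (u N))%:E) = fun N => (\int[mu]_x (rnorm (u N x) ^+ 2)%:E)%E)//.
  by apply/funext => N; rewrite (rintE (lu N)).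
by have /fine_cvgP[_] := cvE.
Qed.

End fejer_means.

(** On an absolutely summable family, a summation method with weights tending to 1 agrees with
    unconditional summation. This turns Fejer-weighted limits into the net of plain finite sums
    asked for by [weak_frame_operator]. *)
Lemma net_sum_limit {R : realType} {K : countType} (t : K -> R[i]) (T : R) (L : R[i])
    (G : nat -> {fset K}) (om : nat -> K -> R) :
  (forall F : {fset K}, \sum_(p <- F) rnorm (t p) <= T) ->
  (forall N p, p \in G N -> 0 <= om N p <= 1) ->
  (forall p, exists N0, forall N, (N0 <= N)%N -> p \in G N) ->
  (forall p, (fun N => om N p) @ \oo --> (1 : R)) ->
  (forall e, 0 < e -> exists N0, forall N, (N0 <= N)%N ->
    rnorm (\sum_(p <- G N) (om N p)%:C * t p - L) <= e) ->
  forall e, 0 < e -> exists F0 : {fset K}, forall F : {fset K}, (F0 `<=` F)%fset ->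
    rnorm (L - \sum_(p <- F) t p) <= e.
Proof.
move=> tT om01 inG om1 lim e e0; have e40 : 0 < e / 4 by lra.
have bT : summable_le (fun p => rnorm (t p)) T by split => // p; exact: rnorm_ge0.
have [M hM] := summable_le_setD bT e40; move: hM; set E : {fset K} := enumset M => hM.
(* Four errors of e / 4: the weighted limit, the tails of [G N] and of [F] outside [E], and the
   weights on [E]. *)
exists E => F EF.
have tail (u : K -> R) (F' : {fset K}) : (forall p, p \in F' -> 0 <= u p <= 1) -> (E `<=` F')%fset ->
    rnorm (\sum_(p <- (F' `\` E)%fset) (u p)%:C * t p) <= e / 4.
  move=> u01 EF'; apply: le_trans (rnorm_sum _ _ _) _; apply: le_trans (hM.2 (F' `\` E)%fset).
  rewrite !big_seq; apply: ler_sum => p; rewrite in_fsetD => /andP[pE pF].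
  have /andP[u0 u1] := u01 p pF.
  by rewrite pE mulr1 rnormM rnorm_real ger0_norm// ler_piMl// rnorm_ge0.
have [f hf] := choice inG.
have [N1 h1] := lim _ e40.
have : (fun N => \sum_(p <- E) `|om N p - 1| * rnorm (t p)) @ \oo --> \sum_(p <- E) (0 : R).
  apply: cvg_bigsum => p _; rewrite -[X in _ --> X](mul0r (rnorm (t p))).
  apply: cvgM; last exact: cvg_cst.
  rewrite -[X in _ --> X](normr0 R) -[X in `|X|](subrr 1); apply: cvg_norm.
  by apply: cvgB; [exact: om1|exact: cvg_cst].
rewrite big1// => /cvgrPdist_le/(_ _ e40)[N2 _ h2].
pose N := (\max_(p <- E) f p + N1 + N2)%N.
have EG : (E `<=` G N)%fset.
  apply/fsubsetP => p pE; apply: hf; apply: leq_trans (leq_addr N2 _).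
  by apply: leq_trans (leq_addr N1 _); rewrite (big_fsetD1 p)//= leq_maxl.
have {}h1 := h1 N (leq_trans (leq_addl _ _) (leq_addr _ _)).
have {}h2 := h2 N (leq_addl _ _).
move: h1; rewrite (sum_fsetD _ EG) (sum_fsetD _ EF).
have k1 := tail (om N) (G N) (om01 N) EG.
have k2 : rnorm (\sum_(p <- (F `\` E)%fset) t p) <= e / 4.
  have := tail (fun=> 1) F _ EF; rewrite (eq_bigr t) => [|p _]; last by rewrite mul1r.
  by apply => p _; rewrite ler01 lexx.
have k3 : rnorm (\sum_(p <- E) (om N p)%:C * t p - \sum_(p <- E) t p) <= e / 4.
  move: h2; rewrite /= sub0r normrN ger0_norm; last by apply: sumr_ge0 => p _; rewrite mulr_ge0// rnorm_ge0.
  apply: le_trans; rewrite -sumrB; apply: le_trans (rnorm_sum _ _ _) _.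
  apply: ler_sum => p _; rewrite -[X in _ - X]mul1r -mulrBl rnormM.
  by rewrite (_ : (om N p)%:C - 1 = (om N p - 1)%:C) ?rnorm_real// rmorphB.
move: k1 k2 k3.
move: (\sum_(p <- (G N `\` E)%fset) _) (\sum_(p <- (F `\` E)%fset) _).
move: (\sum_(p <- E) (om N p)%:C * t p) (\sum_(p <- E) t p) => a b x y k1 k2 k3 k4.
have -> : L - (b + y) = (a - b) + x - y - (a + x - L) by ring.
apply: le_trans (rnormB _ _) _.
apply: le_trans (lerD (rnormB _ _) k4) _.
have := rnormD (a - b) x; lra.
Qed.

(** * Walnut's series represents the frame operator *)

Section walnut_representation.
Context {R : realType} {H : completeNormedModType R[i]} {d : nat}.
Variable dot : {dot H for conjC}.
Hypothesis hilb : hilbert_norm dot.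
Hypothesis sepH : Defs.separable H.
Notation mu := (@lebesgue_rV R d).
Notation I := ('rV[int]_d).
Variables (g : 'rV[R]_d -> H) (alpha beta : R).
Hypothesis beta0 : 0 < beta.
Let gam := beta^-1.
Let gam0 : 0 < gam. Proof. by rewrite invr_gt0. Qed.
Local Notation lat := (lattice gam).
Local Notation ci := (cell_index gam).
Local Notation e_ := (gabor g alpha beta).
Local Notation "<< f , h >>" := (L2dot dot f h).
Let v (k : I) := translate (lattice alpha k) g.
Variables (c : I -> I -> R) (C B : R).
Hypothesis vcont : forall k, rcont (v k).
Hypothesis v_le : forall k m (x : 'rV[R]_d), `|x| < 2 * gam -> rnorm (v k (x + lat m)) <= c m k.
Hypothesis c_row : forall m, summable_le (c m) C.
Hypothesis c_col : forall k, summable_le (fun m => c m k) C.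
Hypothesis g2 : in_L2 g.
Hypothesis upper : forall f, in_L2 f -> forall F : {fset I * I},
  \sum_(kn <- F) rnorm <<f, e_ kn>> ^+ 2 <= B * sqn f.

Let ge2 kn : in_L2 (e_ kn) := in_L2_gabor sepH alpha beta kn g2.

Section fixed_h.
Variables (h : 'rV[R]_d -> H) (b : I -> R) (S : R).
Hypothesis th : tame gam h b S.

Let bS : summable_le b S. Proof. by have [] := th. Qed.
Let ch : rcont h. Proof. by have [] := th. Qed.

Let h2 : in_L2 h := tame_in_L2 gam0 th.

Let Phi k y := dot (h y) (v k y).

Let P N x := \sum_(k <- enumset N) \sum_(n <- fejer_support N)
  ((fejer_weight N n)%:C * <<h, e_ (k, n)>>) *: e_ (k, n) x.

Let q N k x := cint (fun y => Phi k (y + x) * (fejer_rV gam N y)%:C).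

Let cPhi k : rcont (Phi k).
Proof. by apply: rcont_dot. Qed.

(** For fixed [k] the coefficients <h, e_(k, n)> are, up to normalisation, Fourier coefficients of
    the periodisation of [Phi k]. Their Fejer-weighted sum is therefore the convolution [q] of
    [Phi k] with the Fejer kernel. *)
Lemma fejer_meanE N x : (0 < N)%N -> P N x = \sum_(k <- enumset N) q N k x *: v k x.
Proof.
move=> N0; apply: eq_bigr => k _.
have gE n z : e_ (k, n) z = cis (lattice_phase beta n z) *: v k z by [].
under eq_bigr do rewrite gE scalerA.
rewrite -scaler_suml; congr (_ *: _).
have dE n z : dot (h z) (e_ (k, n) z) = cis (- lattice_phase beta n z) * Phi k z.
  by rewrite gE (dotZr dot) -cisN.
have l1 n : cL1 (fun z => cis (- lattice_phase beta n z) * Phi k z).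
  by under eq_fun do rewrite -dE; exact: (cL1_dot hilb sepH).
pose Z n z := (fejer_weight N n)%:C * cis (lattice_phase beta n x) *
  (cis (- lattice_phase beta n z) * Phi k z).
have lZ n : cL1 (Z n) by exact: cL1Z.
transitivity (cint (fun z => \sum_(n <- fejer_support N) Z n z)).
  rewrite cint_sum//; apply: eq_bigr => n _; rewrite /Z cintZ// L2dotE mulrAC; congr (_ * _).
  by congr cint; apply/funext => z; exact: dE.
rewrite -(cint_shift x); last exact: cL1_sum.
rewrite /q; congr cint; apply/funext => z.
rewrite -fejer_rVN /gam fejer_rV_trig// mulr_sumr; apply: eq_bigr => n _.
have cc : cis (lattice_phase beta n (- z)) =
    cis (lattice_phase beta n x) * cis (- lattice_phase beta n (z + x)); last by rewrite /Z cc; ring.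
rewrite -cisD; congr cis.
rewrite /lattice_phase -mulrBr -sumrB; congr (_ * _).
by apply: eq_bigr => i _; rewrite !mxE; ring.
Qed.

Let Phi_le k x y : rnorm (Phi k (y + x)) <= b (ci x + ci y) * c (ci x + ci y) k.
Proof.
have [_ _ hb] := th.
have [x' xg xE] := cell_decomp gam0 x; have [y' yg yE] := cell_decomp gam0 y.
have -> : y + x = (y' + x') + lat (ci x + ci y).
  by rewrite latticeD [lat _ + lat _]addrC addrACA -xE -yE.
have xyg : `|y' + x'| < 2 * gam.
  by apply: le_lt_trans (ler_normD _ _) _; rewrite mulr_natl mulr2n ltrD.
by apply: le_trans (rnorm_dot hilb _ _) _; rewrite ler_pM ?rnorm_ge0 ?hb ?v_le.
Qed.

Let rcontPhi k x : rcont (fun y : 'rV[R]_d => Phi k (y + x)).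
Proof. exact: rcont_shift. Qed.

Lemma fejer_mean_term_le N k x : (0 < N)%N ->
  rnorm ((gam ^- d)%:C * q N k x) <= 2 * walnut_p c b k.
Proof.
move=> N0; exact: (fejer_cint_dominated gam0 N0 (rcontPhi k x)
  (summable_walnut_col c_row (ci x) k bS) (fun y => Phi_le k x y)).2.
Qed.

(** For each [k] the Fejer mean tends to the sum of [Phi k] over [x] plus the lattice; Tannery's
    theorem carries the limit through the sum over [k]. *)
Lemma fejer_mean_cvg x e : 0 < e -> exists N0, forall N, (N0 <= N)%N ->
  rnorm ((gam ^- d)%:C *: P N x - walnut dot gam v h x) <= e.
Proof.
move=> e0; have e20 : 0 < e / 2 by lra.
pose D N k := (gam ^- d)%:C * q N k x - \sum_(m <- enumset N) Phi k (x + lat m).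
(* 3 = 2 + 1: twice [walnut_p] for the Fejer mean and once for the lattice sum. *)
have pc := summable_leZ (ler0n R 3) (walnut_b_row c_row (ci x) bS).
have [||N1 h1] := tannery (t := fun N k => rnorm (D N k) * c (ci x) k) pc _ _ e20.
- move=> N k N0; rewrite mulr_ge0 ?rnorm_ge0 ?(c_row _).1//= mulrA ler_wpM2r ?(c_row _).1//.
  apply: le_trans (rnormB _ _) _.
  have -> : 3 * walnut_p c b k = 2 * walnut_p c b k + walnut_p c b k by ring.
  apply: lerD; first exact: fejer_mean_term_le.
  apply: le_trans (rnorm_sum _ _ _) _.
  apply: le_trans ((summable_walnut_col c_row (ci x) k bS).2 (enumset N)).
  by apply: ler_sum => m _; rewrite addrC (le_trans (Phi_le _ _ _))// cell_index_lattice.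
- move=> k e' e'0.
  (* The 1 keeps the divisor positive when [c (ci x) k] is 0. *)
  have ck0 : 0 < c (ci x) k + 1 by rewrite ltr_wpDl// (c_row _).1.
  have [N2 h2'] := fejer_cint_limit gam0 (rcontPhi k x)
    (summable_walnut_col c_row (ci x) k bS) (fun y => Phi_le k x y) (divr_gt0 e'0 ck0).
  exists N2 => N /h2'.
  under [\sum_(m <- _) _]eq_bigr do rewrite addrC.
  rewrite -/(D N k) ler_pdivlMr// => hD; apply: le_trans hD.
  by rewrite ler_wpM2l ?rnorm_ge0// lerDl.
have /cvg_rnormP/(_ _ e20)[N2 _ h2'] := walnut_cvg hilb gam0 v_le c_row (y := x) th.
exists (N1 + N2).+1%N => N NN.
have {}h1 := h1 N (leq_trans (leq_addr _ _) (ltnW NN)).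
have {}h2' := h2' N (leq_trans (leq_addl _ _) (ltnW NN)).
rewrite (_ : _ - _ = ((gam ^- d)%:C *: P N x - rect (walnut_term dot gam v h x) N) +
    (rect (walnut_term dot gam v h x) N - walnut dot gam v h x)); last by rewrite addrA subrK.
apply: le_trans (rnormD _ _) _.
have -> : (gam ^- d)%:C *: P N x - rect (walnut_term dot gam v h x) N =
    \sum_(k <- enumset N) D N k *: v k x.
  rewrite fejer_meanE ?(leq_trans _ NN)// scaler_sumr -sumrB; apply: eq_bigr => k _.
  by rewrite scalerA -scaler_suml -scalerBl.
have : rnorm (\sum_(k <- enumset N) D N k *: v k x) <= e / 2.
  apply: le_trans (rnorm_sum _ _ _) _; apply: le_trans h1.
  apply: ler_sum => k _; rewrite rnormZ ler_wpM2l ?rnorm_ge0//.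
  have [x' xg {1}->] := cell_decomp gam0 x; apply: v_le.
  by apply: lt_le_trans xg _; rewrite mulr_natl mulr2n lerDl ltW.
rewrite /= rnorm_subC in h2'; lra.
Qed.

(** An N-free majorant that depends on the cell only: with it, pointwise convergence becomes
    convergence in L^2. *)
Lemma fejer_mean_le N x : (0 < N)%N -> rnorm ((gam ^- d)%:C *: P N x) <= 2 * walnut_b c b (ci x).
Proof.
move=> N0; rewrite fejer_meanE// scaler_sumr; apply: le_trans (rnorm_sum _ _ _) _.
apply: (@le_trans _ _ (2 * \sum_(k <- enumset N) walnut_p c b k * c (ci x) k)); last first.
  by rewrite ler_pM2l//; exact: (sum_le_total _ (walnut_b_row c_row (ci x) bS)).
rewrite mulr_sumr; apply: ler_sum => k _.
rewrite scalerA rnormZ mulrA ler_pM ?rnorm_ge0//; first exact: fejer_mean_term_le.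
have [x' xg {1}->] := cell_decomp gam0 x; apply: v_le.
by apply: lt_le_trans xg _; rewrite mulr_natl mulr2n lerDl ltW.
Qed.

(** The weighted sums [P N] converge in L^2 to the series. Paired with [f], they are weighted sums
    of products of two square-summable families, which are absolutely summable by the upper frame
    bound, so the weights can be removed. *)
Theorem walnut_representation :
  weak_frame_operator dot g alpha beta h (fun x => (gam ^+ d)%:C *: walnut dot gam v h x).
Proof.
move=> f lf.
have gd0 : gam ^+ d != 0 by rewrite expf_neq0// gt_eqF.
have tW := tame_walnut hilb gam0 vcont v_le c_row c_col th.
have W2 : in_L2 (walnut dot gam v h) by exact: (tame_in_L2 gam0 tW).
have P2 N : in_L2 (P N).
  by apply: in_L2_sum => // k; apply: in_L2_sum => // n; exact: in_L2Z.
(* Shifted by one, since the Fejer bounds hold for positive order. *)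
pose u N x := (gam ^- d)%:C *: P N.+1 x - walnut dot gam v h x.
have u2 N : in_L2 (u N) by apply: in_L2B => //; exact: in_L2Z.
have [_ bW _] := tW.
have ucv : (fun N => sqn (u N)) @ \oo --> (0 : R).
  apply: (sqn_dominated_cvg gam0 (fun N => (u2 N).1) (summable_leZ (ler0n R 3) bW)).
    move=> N x; apply: le_trans (rnormB _ _) _.
    have := fejer_mean_le x (ltn0Sn N); have := tame_cell gam0 x tW; lra.
  move=> x e e0; have [N0 hN] := fejer_mean_cvg x e0.
  by exists N0 => N N0N; apply: hN; exact: leqW.
pose t (p : I * I) := <<h, e_ p>> * conjC <<f, e_ p>>.
apply: (@net_sum_limit _ _ t (B * sqn h + B * sqn f) _
  (fun N => (enumset N `*` fejer_support N)%fset) (fun N p => fejer_weight N p.2)).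
- move=> F; apply: le_trans (lerD (upper h2 F) (upper lf F)).
  rewrite -big_split /=; apply: ler_sum => p _; rewrite rnormM rnorm_conj.
  move: (rnorm_ge0 <<h, e_ p>>) (rnorm_ge0 <<f, e_ p>>).
  move: (rnorm _) (rnorm _) => a a'; have := sqr_ge0 (a - a'); nra.
- by move=> N [k n]; rewrite in_fsetM => /andP[_]; exact: fejer_weight_itv.
- move=> [k n]; have [N1 h1] := enumset_sub [fset k]%fset.
  have [N2 h2'] := fejer_support_sub n.
  exists (N1 + N2)%N => N NN; rewrite in_fsetM /= h2' ?(leq_trans (leq_addl _ _) NN)// andbT.
  by have /fsubsetP := h1 N (leq_trans (leq_addr _ _) NN); apply; rewrite in_fset1.
- by move=> p; exact: fejer_weight_cvg.
move=> e e0.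
have f0 := sqn_ge0 f.
have gd : 0 < gam ^+ d by rewrite exprn_gt0.
(* [T] first makes gam^d T^-1 |f|^2 at most e / 2; then N is chosen so that gam^d T |u N|^2 is
   too. *)
have [T T0 TE] : exists2 T : R, 0 < T & T = 2 * gam ^+ d * (sqn f + 1) / e.
  by eexists; [|reflexivity]; rewrite divr_gt0// !mulr_gt0//; lra.
have d0 : 0 < e / (2 * gam ^+ d * T) by rewrite divr_gt0// !mulr_gt0.
have /cvgrPdist_le/(_ _ d0)[N0 _ hN] := ucv.
exists N0.+1 => -[//|N] N0N; have {hN} := hN N N0N.
rewrite /= sub0r normrN ger0_norm ?sqn_ge0// => hu.
rewrite -(big_fsetM (enumset N.+1) (fejer_support N.+1)
   (fun k n => (fejer_weight N.+1 n)%:C * t (k, n))).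
have -> : \sum_(k <- enumset N.+1) \sum_(n <- fejer_support N.+1)
    (fejer_weight N.+1 n)%:C * t (k, n) = <<P N.+1, f>>.
  rewrite /P L2dot_suml//; last by move=> k; apply: in_L2_sum => // n; exact: in_L2Z.
  apply: eq_bigr => k _; rewrite (L2dot_suml hilb sepH)//; last by move=> n; exact: in_L2Z.
  apply: eq_bigr => n _; rewrite (L2dotZl hilb sepH)// /t mulrA; congr (_ * _).
  by rewrite -(L2dotC hilb sepH).
have -> : <<P N.+1, f>> - <<fun x => (gam ^+ d)%:C *: walnut dot gam v h x, f>> =
    (gam ^+ d)%:C * <<u N, f>>.
  rewrite -(L2dotBl hilb sepH)//; last exact: in_L2Z.
  rewrite -(L2dotZl hilb sepH)//; congr (L2dot dot _ f); apply/funext => x.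
  by rewrite /u scalerBr scalerA -rmorphM mulfV// scale1r.
rewrite rnormM rnorm_real (ger0_norm (ltW gd)).
apply: (@le_trans _ _ (gam ^+ d * (T * sqn (u N) + T^-1 * sqn f))).
  by rewrite ler_pM2l//; exact: rnorm_L2dot_le.
have k1 : gam ^+ d * (T * sqn (u N)) <= e / 2.
  have -> : e / 2 = gam ^+ d * (T * (e / (2 * gam ^+ d * T))).
    by field; rewrite gd0 gt_eqF.
  by rewrite ler_pM2l// ler_pM2l.
have k2 : gam ^+ d * (T^-1 * sqn f) <= e / 2.
  have -> : gam ^+ d * (T^-1 * sqn f) = (e / 2) * (sqn f / (sqn f + 1)).
    by rewrite TE; field; rewrite gd0 !gt_eqF//; lra.
  have f1 : 0 < sqn f + 1 by lra.
  have fle : sqn f / (sqn f + 1) <= 1 by rewrite ler_pdivrMr// mul1r lerDl.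
  have e2 : 0 <= e / 2 by lra.
  by rewrite ler_piMr.
rewrite mulrDr; lra.
Qed.

End fixed_h.

End walnut_representation.

(** * The Neumann iteration *)

Section dirichlet.
Context {R : realType} {d : nat}.
Variable gam : R.
Hypothesis gam0 : 0 < gam.

Lemma rcont_prod {T : topologicalType} I (s : seq I) (p : I -> T -> R[i]) :
  (forall i, rcont (p i)) -> rcont (fun x => \prod_(i <- s) p i x).
Proof.
move=> cp; elim: s => [|i s IH]; first by under eq_fun do rewrite big_nil; exact: rcont_cst.
by under eq_fun do rewrite big_cons; exact: rcontM.
Qed.

(* A [gam]-periodic multiplier concentrated near the lattice translates of [x0]. *)
Definition dirichlet M (x0 x : 'rV[R]_d) : R[i] :=
  \prod_(i < d) \sum_(j < M) cis (2 * pi * (gam^-1 * j%:R * (x - x0) ord0 i)).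

Lemma rcont_dirichlet M x0 : rcont (dirichlet M x0).
Proof.
apply: rcont_prod => i; apply: rcont_sum => j; apply: rcont_cis.
have cM (t : R) : continuous (fun x : R => t * x) by exact: mulrl_continuous.
have -> : (fun x : 'rV[R]_d => 2 * pi * (gam^-1 * j%:R * (x - x0) ord0 i)) =
    (fun t : R => 2 * pi * (gam^-1 * j%:R) * (t - x0 ord0 i)) \o (fun x : 'rV[R]_d => x ord0 i).
  by apply/funext => x /=; rewrite !mxE !mulrA.
move=> x; apply: continuous_comp; first exact: coord_continuous.
apply: (@continuous_comp _ _ _ (fun t : R => t - x0 ord0 i) (fun t => 2 * pi * (gam^-1 * j%:R) * t)).
  by apply: cvgB; [exact: cvg_id|exact: cvg_cst].
exact: cM.
Qed.

Lemma dirichlet_le M x0 x : rnorm (dirichlet M x0 x) <= M%:R ^+ d.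
Proof.
have -> : rnorm (dirichlet M x0 x) =
    \prod_(i < d) rnorm (\sum_(j < M) cis (2 * pi * (gam^-1 * j%:R * (x - x0) ord0 i))).
  by apply: (big_morph (@rnorm R _)); [exact: rnormM|exact: rnorm1].
rewrite -[d in _ ^+ d]card_ord -prodr_const; apply: ler_prod => i _.
rewrite rnorm_ge0/=; apply: le_trans (rnorm_sum _ _ _) _.
under eq_bigr do rewrite rnorm_cis.
by rewrite sumr_const card_ord.
Qed.

Lemma dirichlet_periodic M x0 x m : dirichlet M x0 (x + lattice gam m) = dirichlet M x0 x.
Proof.
apply: eq_bigr => i _; apply: eq_bigr => j _.
rewrite addrAC !mxE [gam^-1 * _ * (_ + _)]mulrDr mulrDr cisD.
rewrite [X in _ * X](_ : _ = 1) ?mulr1// -(cis2piz (j%:Z * m ord0 i)).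
by congr cis; rewrite rmorphM/=; field; rewrite gt_eqF.
Qed.

Lemma dirichlet_sqr M x0 x : (0 < M)%N ->
  rnorm (dirichlet M x0 x) ^+ 2 = M%:R ^+ d * fejer_rV gam M (x - x0).
Proof.
move=> M0; have -> : (M%:R ^+ d : R) = \prod_(i < d) M%:R by rewrite prodr_const card_ord.
rewrite /fejer_rV -big_split/=.
have -> : rnorm (dirichlet M x0 x) =
    \prod_(i < d) rnorm (\sum_(j < M) cis (2 * pi * (gam^-1 * j%:R * (x - x0) ord0 i))).
  by apply: (big_morph (@rnorm R _)); [exact: rnormM|exact: rnorm1].
rewrite -prodrXl; apply: eq_bigr => i _.
by rewrite /fejer [RHS]mulrC divfK// pnatr_eq0 gtn_eqF.
Qed.

End dirichlet.

Section iteration.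
Context {R : realType} {H : completeNormedModType R[i]} {d : nat}.
Variable dot : {dot H for conjC}.
Hypothesis hilb : hilbert_norm dot.
Hypothesis sepH : Defs.separable H.
Notation mu := (@lebesgue_rV R d).
Notation I := ('rV[int]_d).
Variables (g : 'rV[R]_d -> H) (alpha beta : R).
Hypothesis beta0 : 0 < beta.
Let gam := beta^-1.
Let gam0 : 0 < gam. Proof. by rewrite invr_gt0. Qed.
Local Notation lat := (lattice gam).
Local Notation ci := (cell_index gam).
Local Notation e_ := (gabor g alpha beta).
Local Notation "<< f , h >>" := (L2dot dot f h).
Let v (k : I) := translate (lattice alpha k) g.
Variables (c : I -> I -> R) (C A B Sg : R) (bg : I -> R).
Hypothesis vcont : forall k, rcont (v k).
Hypothesis v_le : forall k m (x : 'rV[R]_d), `|x| < 2 * gam -> rnorm (v k (x + lat m)) <= c m k.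
Hypothesis c_row : forall m, summable_le (c m) C.
Hypothesis c_col : forall k, summable_le (fun m => c m k) C.
Hypothesis tg : tame gam g bg Sg.
Hypotheses (A0 : 0 < A) (AB : A <= B).
Hypothesis upper : forall f, in_L2 f -> forall F : {fset I * I},
  \sum_(kn <- F) rnorm <<f, e_ kn>> ^+ 2 <= B * sqn f.
Hypothesis lower : forall f, in_L2 f -> forall e : R, 0 < e -> exists F0 : {fset I * I},
  forall F : {fset I * I}, (F0 `<=` F)%fset -> A * sqn f - e <= \sum_(kn <- F) rnorm <<f, e_ kn>> ^+ 2.

Let g2 : in_L2 g := tame_in_L2 gam0 tg.
Let W h (x : 'rV[R]_d) := (gam ^+ d)%:C *: walnut dot gam v h x.
Let T h x : H := h x - (B^-1)%:C *: W h x.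
Let rho := 1 - A / B.

Let B0 : 0 < B. Proof. exact: lt_le_trans AB. Qed.

Let rho_ge0 : 0 <= rho.
Proof. by rewrite subr_ge0 ler_pdivrMr// mul1r. Qed.

Let rho_lt1 : rho < 1.
Proof. by rewrite gtrBl divr_gt0. Qed.

Lemma tame_W h b S : tame gam h b S -> exists b' S', tame gam (W h) b' S'.
Proof.
move=> th; do 2 eexists; apply: tameM (tame_walnut hilb gam0 vcont v_le c_row c_col th).
  exact: rcont_cst.
by move=> x; exact: lexx.
Qed.

Lemma tame_T h b S : tame gam h b S -> exists b' S', tame gam (T h) b' S'.
Proof.
move=> th; have [b1 [S1 tW]] := tame_W th.
have eT : T h = fun x => h x + (- (B^-1)%:C) *: W h x.
  by apply/funext => x; rewrite /T scaleNr.
do 2 eexists; rewrite eT; apply: tameD th _; apply: tameM tW; first exact: rcont_cst.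
by move=> x; exact: lexx.
Qed.

Definition residual N := iter N T g.

Lemma tame_residual N : exists b S, tame gam (residual N) b S.
Proof.
elim: N => [|N [b [S IH]]]; first by exists bg, Sg.
exact: tame_T IH.
Qed.

Lemma weak_W h b S : tame gam h b S -> weak_frame_operator dot g alpha beta h (W h).
Proof. exact: (walnut_representation hilb sepH beta0 vcont v_le c_row c_col g2 upper). Qed.

(** [T] commutes with the multiplication by [chi], and [chi *: h] is again tame, so the L^2
    contraction applies to it. *)
Lemma sqn_T_le h b S (chi : 'rV[R]_d -> R[i]) X : tame gam h b S -> rcont chi ->
  (forall x, rnorm (chi x) <= X) -> (forall x m, chi (x + lat m) = chi x) ->
  sqn (fun x => chi x *: T h x) <= rho * sqn (fun x => chi x *: h x).
Proof.
move=> th cchi chiX per.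
have tch := tameM cchi chiX th.
have [b' [S' tW]] := tame_W tch.
have := weak_frame_contraction hilb sepH A0 AB upper lower
  (tame_in_L2 gam0 tch) (tame_in_L2 gam0 tW) (weak_W tch).
apply: le_trans; rewrite le_eqVlt; apply/orP; left; apply/eqP.
congr sqn; apply/funext => x; rewrite /T scalerBr; congr (_ - _).
rewrite /W (walnut_periodic hilb gam0 v_le c_row x th per).
by rewrite !scalerA; congr (_ *: _); ring.
Qed.

Lemma sqn_residual_le N (chi : 'rV[R]_d -> R[i]) X : rcont chi ->
  (forall x, rnorm (chi x) <= X) -> (forall x m, chi (x + lat m) = chi x) ->
  sqn (fun x => chi x *: residual N x) <= rho ^+ N * sqn (fun x => chi x *: g x).
Proof.
move=> cchi chiX per; elim: N => [|N IH]; first by rewrite expr0 mul1r.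
have [b [S tN]] := tame_residual N.
apply: le_trans (sqn_T_le tN cchi chiX per) _.
by rewrite exprS -mulrA ler_wpM2l.
Qed.

Lemma tame_shift (h : 'rV[R]_d -> H) b S x0 x : tame gam h b S -> rnorm (h (x + x0)) <= b (ci x0 + ci x).
Proof.
move=> [_ _ hb].
have [x' xg xE] := cell_decomp gam0 x; have [y' yg yE] := cell_decomp gam0 x0.
have -> : x + x0 = (x' + y') + lat (ci x0 + ci x).
  by rewrite latticeD [lat _ + lat _]addrC addrACA -xE -yE.
apply: hb; apply: le_lt_trans (ler_normD _ _) _.
by rewrite mulr_natl mulr2n ltrD.
Qed.

Lemma sqn_dirichlet (h : 'rV[R]_d -> H) b S M x0 : tame gam h b S -> (0 < M)%N ->
  sqn (fun x => dirichlet gam M x0 x *: h x) =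
  M%:R ^+ d * rint (fun x => rnorm (h (x + x0)) ^+ 2 * fejer_rV gam M x).
Proof.
move=> th M0.
have ch2 : continuous (fun x => rnorm (h x) ^+ 2).
  have [ch _ _] := th => x; rewrite /=.
  apply: (@continuous_comp _ _ _ (fun x => rnorm (h x)) (fun t : R => t ^+ 2)).
    exact: rcont_rnorm.
  exact: exprn_continuous.
pose F x := rnorm (h x) ^+ 2 * fejer_rV gam M (x - x0).
have mF : measurable_fun [set: 'rV[R]_d] F.
  apply: measurable_funM.
    by apply/borel_measurable; exact: continuous_borel.
  exact: (measurableT_comp (measurable_fejer_rV gam M) (measurable_addrV _)).
have E x : rnorm (dirichlet gam M x0 x *: h x) ^+ 2 = M%:R ^+ d * F x.
  by rewrite rnormZ exprMn dirichlet_sqr// /F; ring.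
have lF : L1 F.
  have Md : 0 < (M%:R : R) ^+ d by rewrite exprn_gt0// ltr0n.
  have := (tame_in_L2 gam0 (tameM (rcont_dirichlet gam M x0) (dirichlet_le gam M x0) th)).
  move=> /in_L2P[_]; under eq_fun do rewrite E.
  move=> /(L1Z (M%:R ^+ d)^-1).
  by under eq_fun do rewrite mulrA mulVf ?gt_eqF// mul1r.
rewrite /sqn; under eq_rint do rewrite E.
rewrite rintZ//; congr (_ * _); rewrite -(rint_shift x0 mF).2.
by apply: eq_rint => x; rewrite /F addrK.
Qed.

(** With Dirichlet multipliers the weighted L^2 bound compares Fejer averages of |r_N|^2 and of
    |g|^2 around [x0]. The average for g is at most [Sg * Sg]; as the order grows, that for r_N
    tends to a sum over the coset of [x0], one term of which is |r_N(x0)|^2. *)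
Lemma residual_le N x0 : rnorm (residual N x0) ^+ 2 <= rho ^+ N * (Sg * Sg).
Proof.
have [b [S tN]] := tame_residual N.
have main M : (0 < M)%N ->
    gam ^- d * rint (fun x => rnorm (residual N (x + x0)) ^+ 2 * fejer_rV gam M x) <=
    rho ^+ N * (Sg * Sg).
  move=> M0.
  have := sqn_residual_le N (rcont_dirichlet gam M x0) (dirichlet_le gam M x0)
    (dirichlet_periodic gam0 M x0).
  rewrite (sqn_dirichlet _ tN M0) (sqn_dirichlet _ tg M0) mulrCA.
  (* The common factor M^d of the squared Dirichlet kernels cancels, which leaves a bound free of
     M. *)
  rewrite ler_pM2l ?exprn_gt0 ?ltr0n// => h1.
  apply: (@le_trans _ _ (rho ^+ N * (gam ^- d *
      rint (fun x => rnorm (g (x + x0)) ^+ 2 * fejer_rV gam M x)))).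
    by rewrite [leRHS]mulrCA ler_pM2l ?invr_gt0 ?exprn_gt0.
  rewrite ler_wpM2l ?exprn_ge0//.
  have [_ bS _] := tg.
  have bS2 := summable_le_sqr (summable_le_shift (ci x0) bS).
  apply: le_trans (ler_norm _) _.
  apply: (fejer_dominated gam0 M0 bS2 _ _).2.
    apply: measurable_funX; apply/borel_measurable; apply: continuous_borel.
    by apply: rcont_rnorm; apply: rcont_shift; have [] := tg.
  move=> x; rewrite ger0_norm ?sqr_ge0// ler_pXn2r ?nnegrE ?rnorm_ge0//; first exact: (tame_shift x0 x tg).
  by have [b0 _] := bS; exact: b0.
apply/ler_addgt0Pr => e e0.
have [cN bS _] := tN.
have bS2 := summable_le_sqr (summable_le_shift (ci x0) bS).
have cont : continuous (fun x : 'rV[R]_d => rnorm (residual N (x + x0)) ^+ 2).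
  move=> x; apply: (@continuous_comp _ _ _ (fun x : 'rV[R]_d => rnorm (residual N (x + x0)))
    (fun t : R => t ^+ 2)).
    by apply: rcont_rnorm; exact: rcont_shift.
  exact: exprn_continuous.
have [|M hM] := fejer_sum_limit gam0 cont _ bS2 e0.
  move=> x; rewrite ger0_norm ?sqr_ge0// ler_pXn2r ?nnegrE ?rnorm_ge0//; first exact: (tame_shift x0 x tN).
  by have [b0 _] := bS; exact: b0.
(* The order must also be large enough for the lattice point 0 to be among those summed. *)
have [M1 h1] := enumset_sub [fset (0 : I)]%fset.
have {}hM := hM (M + M1).+1 (leqW (leq_addr _ _)).
have {}h1 := h1 (M + M1).+1 (leqW (leq_addl _ _)).
have := main (M + M1).+1 (ltn0Sn _).
have : rnorm (residual N x0) ^+ 2 <=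
    \sum_(m <- enumset (M + M1).+1) rnorm (residual N (lat m + x0)) ^+ 2.
  apply: le_trans (sum_fset_le _ h1); last by move=> m; exact: sqr_ge0.
  by rewrite big_seq_fset1 lattice0 add0r.
move: hM; rewrite ler_norml => /andP[h2 _]; lra.
Qed.

Let sg := Num.sqrt rho.

Let sg_ge0 : 0 <= sg. Proof. exact: sqrtr_ge0. Qed.

Let sg_sqr : sg ^+ 2 = rho. Proof. by rewrite sqr_sqrtr. Qed.

Let sg_lt1 : sg < 1.
Proof. by rewrite -(@ltr_pXn2r _ 2) ?nnegrE// sg_sqr expr1n. Qed.

Let Sg_ge0 : 0 <= Sg.
Proof. by have [_ bS _] := tg; exact: le_trans (total_ge0 bS) (total_le bS). Qed.

Lemma residual_geometric N x : rnorm (residual N x) <= Sg * sg ^+ N.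
Proof.
rewrite -(@ler_pXn2r _ 2) ?nnegrE ?rnorm_ge0 ?mulr_ge0 ?exprn_ge0//.
by rewrite exprMn -exprM mulnC exprM sg_sqr mulrC expr2; exact: residual_le.
Qed.

Let Kg := B^-1 * Sg / (1 - sg).

Let Kg_ge0 : 0 <= Kg.
Proof. by rewrite divr_ge0 ?mulr_ge0 ?invr_ge0 ?(ltW B0)// subr_ge0 ltW. Qed.

Definition partial N x := (B^-1)%:C *: \sum_(j < N) residual j x.

Lemma partialS N x : partial N.+1 x = partial N x + (B^-1)%:C *: residual N x.
Proof. by rewrite /partial big_ord_recr/= scalerDr. Qed.

(** A geometric sum in closed form; keeping the subtracted power makes the induction close
    exactly. *)
Lemma partial_diff N p x : rnorm (partial (N + p) x - partial N x) <= Kg * (sg ^+ N - sg ^+ (N + p)).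
Proof.
elim: p => [|p IH]; first by rewrite addn0 !subrr mulr0 rnorm0.
rewrite addnS partialS addrAC; apply: le_trans (rnormD _ _) _.
have -> : Kg * (sg ^+ N - sg ^+ (N + p).+1) =
    Kg * (sg ^+ N - sg ^+ (N + p)) + B^-1 * (Sg * sg ^+ (N + p)).
  rewrite exprS /Kg; field; rewrite gt_eqF//= gt_eqF// subr_gt0//.
apply: lerD => //; rewrite rnormZ rnorm_real ger0_norm ?invr_ge0 ?(ltW B0)//.
by rewrite ler_wpM2l ?invr_ge0 ?(ltW B0)//; exact: residual_geometric.
Qed.

Lemma partial_diff_le N M x : (N <= M)%N -> rnorm (partial M x - partial N x) <= Kg * sg ^+ N.
Proof.
move=> /subnKC <-; apply: le_trans (partial_diff _ _ _) _.
by rewrite ler_wpM2l// gerBl exprn_ge0.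
Qed.

Lemma geometric_small e : 0 < e -> exists N, forall M, (N <= M)%N -> Kg * sg ^+ M <= e.
Proof.
move=> e0.
have : (fun n => Kg * sg ^+ n) @ \oo --> Kg * 0.
  by apply: cvgM; [exact: cvg_cst|apply: cvg_expr; rewrite ger0_norm].
rewrite mulr0 => /cvgrPdist_le/(_ _ e0)[N _ hN]; exists N => M NM.
have := hN M NM; rewrite /= sub0r normrN; apply: le_trans; exact: ler_norm.
Qed.

Definition partial_limit x : H := limn (partial^~ x).

Lemma partial_cvg x : partial^~ x @ \oo --> partial_limit x.
Proof.
apply: cauchy_rnorm_cvg => e e0; have e20 : 0 < e / 2 by lra.
have [N hN] := geometric_small e20; exists N => m n Nm Nn.
suff : rnorm (partial m x - partial n x) <= e / 2 by lra.
have [nm|mn] := leqP n m.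
  exact: le_trans (partial_diff_le x nm) (hN n Nn).
by rewrite rnorm_subC; exact: le_trans (partial_diff_le x (ltnW mn)) (hN m Nm).
Qed.

Lemma partial_limit_le N x : rnorm (partial_limit x - partial N x) <= Kg * sg ^+ N.
Proof.
rewrite rnorm_subC; apply: rnorm_limit_le (@partial_cvg x) _.
by exists N => M NM; rewrite rnorm_subC; exact: partial_diff_le.
Qed.

Lemma rcont_residual N : rcont (residual N).
Proof. by have [b [S []]] := tame_residual N. Qed.

Lemma rcont_partial_limit : rcont partial_limit.
Proof.
apply: (@rcont_uniform_limit _ _ _ partial).
  by move=> N; apply: rcontZ; [exact: rcont_cst|apply: rcont_sum => j; exact: rcont_residual].
move=> x e e0; have [N hN] := geometric_small e0; exists N.
by apply: filterE => y; exact: le_trans (partial_limit_le N y) (hN N (leqnn N)).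
Qed.

Variable gt : 'rV[R]_d -> H.
Hypotheses (gt2 : in_L2 gt) (wgt : weak_frame_operator dot g alpha beta gt g).

Let vt N x := gt x - partial N x.

Let vt2 N : in_L2 (vt N).
Proof.
apply: (in_L2B sepH) => //; apply: (in_L2Z sepH).
apply: (in_L2_sum sepH) => j.
by have [b [S tj]] := tame_residual j; exact: (tame_in_L2 gam0 tj).
Qed.

Let vtS N : vt N.+1 = fun x => vt N x - (B^-1)%:C *: residual N x.
Proof. by apply/funext => x; rewrite /vt partialS opprD addrA. Qed.

Let res2 N : in_L2 (residual N).
Proof. by have [b [S tN]] := tame_residual N; exact: (tame_in_L2 gam0 tN). Qed.

(** At N = 0 this is S gtilde = g. Subtracting r_N / B from the remainder subtracts S r_N / B from
    its image, which gives r_(N+1). *)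
Lemma weak_remainder N : weak_frame_operator dot g alpha beta (vt N) (residual N).
Proof.
elim: N => [|N IH].
  rewrite (_ : vt 0 = gt)//; apply/funext => x.
  by rewrite /vt /partial big_ord0 scaler0 subr0.
have [b [S tN]] := tame_residual N; have [b' [S' tW]] := tame_W tN.
rewrite vtS; apply: (weak_frame_operatorB hilb sepH g2) => //.
  exact: (tame_in_L2 gam0 tW).
exact: weak_W tN.
Qed.

Lemma sqn_remainder_le N : sqn (vt N) <= rho ^+ N * sqn (vt 0).
Proof.
elim: N => [|N IH]; first by rewrite expr0 mul1r.
rewrite vtS; apply: le_trans (weak_frame_contraction hilb sepH A0 AB upper lower
  (vt2 N) (res2 N) (weak_remainder N)) _.
by rewrite exprS -mulrA ler_wpM2l.
Qed.

(** The remainders tend pointwise to gtilde minus the uniform limit and have square norms tending to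
    0; by Fatou the square of that difference has integral 0. *)
Lemma ae_eq_partial_limit : {ae mu, forall x, gt x = partial_limit x}.
Proof.
have cl : Hmeasurable partial_limit.
  by move=> U oU; apply: (continuous_borel _ oU); apply/rcontP; exact: rcont_partial_limit.
have md : Hmeasurable (fun x => gt x - partial_limit x).
  have -> : (fun x => gt x - partial_limit x) = (fun x => gt x + (fun x => (-1) *: partial_limit x) x).
    by apply/funext => x; rewrite scaleN1r.
  apply: HmeasurableD => //; first exact: gt2.1.
  by apply: HmeasurableZ => //; exact: rcont_cst.
pose F x := (rnorm (gt x - partial_limit x) ^+ 2)%:E.
have mF : measurable_fun [set: 'rV[R]_d] F.
  by apply/measurable_EFinP; apply: measurable_funX; exact: Hmeasurable_rnorm.
have lim x : (fun N => (rnorm (vt N x) ^+ 2)%:E) @ \oo --> F x.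
  apply/fine_cvgP; split; first exact: nearW.
  have vl : (fun N => rnorm (vt N x)) @ \oo --> rnorm (gt x - partial_limit x).
    apply/cvgrPdist_le => e e0; have [N hN] := geometric_small e0.
    exists N => // M /= /hN; apply: le_trans; apply: le_trans (partial_limit_le M x).
    rewrite ler_norml; apply/andP; split.
      rewrite lerNl opprB lerBlDr.
      have -> : vt M x = (partial_limit x - partial M x) + (gt x - partial_limit x).
        by rewrite addrC addrA subrK.
      exact: rnormD.
    rewrite lerBlDr [X in _ <= X + _]rnorm_subC.
    have -> : gt x - partial_limit x = (partial M x - partial_limit x) + vt M x.
      by rewrite /vt [RHS]addrC addrA subrK.
    exact: rnormD.
  by rewrite /= expr2; under eq_fun do rewrite /= expr2; exact: cvgM.
have int0 : (\int[mu]_x F x = 0)%E.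
  apply/eqP; rewrite eq_le; apply/andP; split; last first.
    by apply: integral_ge0 => x _; rewrite lee_fin sqr_ge0.
  have := @fatou _ _ R mu setT measurableT (fun N x => (rnorm (vt N x) ^+ 2)%:E) _ _.
  have -> : (fun x => limn_einf (fun N => (rnorm (vt N x) ^+ 2)%:E)) = F.
    by apply/funext => x; exact: (cvg_limn_einf_sup (@lim x)).1.
  have e0 : (fun N => \int[mu]_x (rnorm (vt N x) ^+ 2)%:E)%E @ \oo --> 0%E.
    have -> : (fun N => \int[mu]_x (rnorm (vt N x) ^+ 2)%:E)%E = fun N => (sqn (vt N))%:E.
      by apply/funext => N; rewrite rintE//; have /in_L2P[] := vt2 N.
    apply/fine_cvgP; split; first exact: nearW.
    apply: (@squeeze_cvgr _ _ _ _ (fun=> 0) (fun N => rho ^+ N * sqn (vt 0))).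
    - by apply: nearW => N /=; rewrite sqn_ge0 sqn_remainder_le.
    - exact: cvg_cst.
    - rewrite -[X in _ --> X](mul0r (sqn (vt 0))); apply: cvgM; last exact: cvg_cst.
      by apply: cvg_expr; rewrite ger0_norm.
  have -> := (cvg_limn_einf_sup e0).1; apply.
    by move=> N; apply/measurable_EFinP; apply: measurable_funX; exact: Hmeasurable_rnorm (vt2 N).1.
  by move=> N x _; rewrite lee_fin sqr_ge0.
have /ae_eq_integral_abs : (\int[mu]_x `|F x| = 0)%E.
  by rewrite -[RHS]int0; apply: eq_integral => x _; rewrite /= ger0_norm ?sqr_ge0.
move=> /(_ measurableT mF); apply: filterS => x /= /(_ Logic.I) [].
move/eqP; rewrite sqrf_eq0 rnorm_eq0 subr_eq0 => /eqP //.
Qed.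

End iteration.

(** * Schur bounds from the amalgam norm *)

Section cubes.
Context {R : realType} {d : nat}.
Notation mu := (@lebesgue_rV R d).

Lemma box_measure_gt0 (a : 'rV[R]_d) (del : R) : 0 < del ->
  measurable [set y : 'rV[R]_d | forall i, y ord0 i \in `[a ord0 i, a ord0 i + del[] /\
  (0 < mu [set y : 'rV[R]_d | forall i, y ord0 i \in `[a ord0 i, (a ord0 i + del)%R[])%E.
Proof.
move=> del0; pose A (i : 'I_d) : set (measurableTypeR R) := [set` `[a ord0 i, a ord0 i + del[].
have mA i : measurable (A i) by exact: measurable_itv.
split.
  rewrite [X in measurable X](_ : _ =
    \bigcap_(i in setT) ((fun x : 'rV[R]_d => x ord0 i) @^-1` A i)).
    apply: fin_bigcap_measurable => // i _.
    by rewrite -[X in measurable X]setTI; apply: measurable_coord => //; exact: mA.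
  by apply/seteqP; split => x Ax i; [move=> _|]; exact: Ax.
rewrite (_ : [set y | _] = [set y : 'rV[R]_d | forall i, A i (y ord0 i)])//.
rewrite lebesgue_rV_box//.
rewrite (eq_bigr (fun=> del%:E)) => [|i _].
  by apply: (big_ind (fun z => 0 < z)%E) => [|p q|i _]; [exact: lte01|exact: mule_gt0|].
rewrite /A lebesgue_measure_itv/= lte_fin ltrDl del0.
by rewrite -EFinB addrAC subrr add0r.
Qed.

(** A violation at [x] persists, by continuity, on a small box with lower corner [x]. Since the cube
    is half-open, such a box fits inside it even when [x] is on a lower face, and it has positive
    measure. *)
Lemma ae_le_cube (F : 'rV[R]_d -> R) (alpha c : R) (a x : 'rV[R]_d) : continuous F ->
  {ae mu, forall y, cube alpha (y - a) -> F y <= c} -> cube alpha (x - a) -> F x <= c.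
Proof.
move=> cF [N [mN N0 subN]] xa; rewrite leNgt; apply/negP => cFx.
have : nbhs x (F @^-1` [set t | c < t]).
  by apply: cF; apply: open_nbhs_nbhs; split; [exact: open_gt|exact: cFx].
move=> /nbhs_ballP[e /= e0 sub].
(* The least distance to an upper face, capped by the radius [e] of the neighbourhood. *)
pose del := \big[Num.min/e]_(i < d) (alpha - (x - a) ord0 i).
have del0 : 0 < del.
  by apply: lt_bigmin => // i _; rewrite subr_gt0; have /andP[] := xa i.
have [mB B0] := box_measure_gt0 x del0.
have : (mu [set y : 'rV[R]_d | forall i, y ord0 i \in `[x ord0 i, (x ord0 i + del)%R[] <= mu N)%E.
  apply: le_measure; rewrite ?inE// => y yB; apply: subN => /= h.
  have ydel i : 0 <= y ord0 i - x ord0 i < del.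
    by have := yB i; rewrite in_itv/= subr_ge0 ltrBlDl.
  have : cube alpha (y - a).
    move=> i; rewrite !mxE; have := xa i; rewrite !mxE => /andP[x0 _].
    have /andP[y0 ydl] := ydel i.
    have : del <= alpha - (x - a) ord0 i by exact: bigmin_le.
    by rewrite !mxE => h1; apply/andP; split; lra.
  move=> /h; apply/negP; rewrite -ltNge; apply: sub.
  rewrite -ball_normE/=; apply/rV_norm_ltP => // i; rewrite !mxE distrC.
  have /andP[y0 ydl] := ydel i; rewrite ger0_norm//.
  by apply: lt_le_trans ydl _; exact: bigmin_le_id.
by rewrite N0 leNgt B0.
Qed.

Lemma cube_floor (alpha : R) (x : 'rV[R]_d) : 0 < alpha ->
  cube alpha (x - lattice alpha (\row_i Num.floor (x ord0 i / alpha))).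
Proof.
move=> a0 i; rewrite !mxE; have /andP[h1 h2] := floor_itv (x ord0 i / alpha).
move: h1 h2; rewrite ler_pdivlMr// ltr_pdivrMr// rmorphD/= => h1 h2; apply/andP; split; nra.
Qed.

End cubes.

Section amalgam.
Context {R : realType} {H : completeNormedModType R[i]} {d : nat}.
Notation mu := (@lebesgue_rV R d).
Notation I := ('rV[int]_d).

(** 1 = w(0) <= w(x) w(-x) = w(x)^2. *)
Lemma admissible_ge1 (w : 'rV[R]_d -> R) x : admissible w -> 1 <= w x.
Proof.
move=> [[_ w0 wN] wD w01 _]; have := wD x (- x); rewrite subrr w01 wN => h.
by have := w0 x; nra.
Qed.

Lemma esum_fset_le {K : choiceType} (a : K -> \bar R) (F : {fset K}) :
  (\sum_(k <- F) a k <= \esum_(k in [set: K]) a k)%E.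
Proof.
apply: esum_ge; exists [set` F]; first by split => //; exact: finite_fset.
by rewrite fsbig_finite ?set_fsetK//; exact: finite_fset.
Qed.

Lemma Linfnorm_ge0 (f : 'rV[R]_d -> H) : (0 <= Linfnorm f)%E.
Proof. exact: Lnorm_ge0. Qed.

(** The norm of exponent infinity is defined by cases on the total mass; this selects the essential
    supremum. *)
Lemma mu_setT_gt0 : (0 < mu setT)%E.
Proof.
have [mB B0] := @box_measure_gt0 R d 0 1 ltr01.
by apply: lt_le_trans B0 _; apply: le_measure; rewrite ?inE.
Qed.

Lemma Linfnorm_ae (f : 'rV[R]_d -> H) : {ae mu, forall x, ((rnorm (f x))%:E <= Linfnorm f)%E}.
Proof.
rewrite /Linfnorm unlock mu_setT_gt0.
have := @ess_sup_ge _ _ _ mu (abse \o (EFin \o rnorm \o f)); apply: filterS => x /=.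
by rewrite ger0_norm ?rnorm_ge0.
Qed.

(** As w >= 1, the amalgam norm dominates the plain sum of essential suprema over the cubes;
    continuity makes these true bounds at every point. *)
Lemma amalgam_cubes (w : 'rV[R]_d -> R) (alpha : R) (g : 'rV[R]_d -> H) :
  admissible w -> 0 < alpha -> in_amalgam w alpha g -> continuous g ->
  exists (b : I -> R) (S : R), summable_le b S /\
    forall x, rnorm (g x) <= b (\row_i Num.floor (x ord0 i / alpha)).
Proof.
move=> aw a0 [mg amg] cg.
pose N (k : I) := Linfnorm (fun x =>
  (translate (lattice alpha k) \1_(cube alpha) x)%:C%C *: g x).
have N0 k : (0 <= N k)%E by exact: Linfnorm_ge0.
have N_le k : (N k <= N k * (w (lattice alpha k))%:E)%E.
  by rewrite -[leLHS]mule1 lee_wpmul2l// lee_fin admissible_ge1.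
have fin (F : {fset I}) : (\sum_(k <- F) N k <= amalgam_norm w alpha g)%E.
  by apply: le_trans (esum_fset_le _ F); exact: lee_sum.
have Nfin k : N k \is a fin_num.
  rewrite ge0_fin_numE//; apply: le_lt_trans amg.
  by have := fin [fset k]%fset; rewrite big_seq_fset1.
have amg_fin : amalgam_norm w alpha g \is a fin_num.
  rewrite ge0_fin_numE//; have := fin fset0; by rewrite big_seq_fset0.
exists (fun k => fine (N k)), (fine (amalgam_norm w alpha g)); split.
  split => [k|F]; first exact: fine_ge0.
  rewrite -lee_fin fineK// -sumEFin; apply: le_trans (fin F).
  by apply: lee_sum => k _; rewrite fineK.
move=> x; set k := \row_i _.
apply: (@ae_le_cube _ _ (fun x => rnorm (g x)) alpha (fine (N k)) (lattice alpha k)).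
- by apply: rcont_rnorm; apply/rcontP.
- have := Linfnorm_ae (fun x => (translate (lattice alpha k) \1_(cube alpha) x)%:C%C *: g x).
  apply: filterS => y + yk; rewrite -/(N k) -[N k]fineK// lee_fin; apply: le_trans.
  by rewrite rnormZ /translate indicE mem_set// rnorm_real normr1 mul1r.
- exact: cube_floor.
Qed.

End amalgam.

Section schur.
Context {R : realType} {d : nat}.
Variables (alpha gam : R) (b : 'rV[int]_d -> R) (S : R).
Hypotheses (alpha0 : 0 < alpha) (gam0 : 0 < gam) (bS : summable_le b S).
Notation I := ('rV[int]_d).

Let L := (Num.trunc (4 * gam / alpha)).+1.
Let L2 := Num.trunc (alpha / gam).
Let T := {ffun 'I_d -> 'I_L.+1}.

Definition schur_index (m : I) : I :=
  \row_i Num.floor ((gam * (m ord0 i)%:~R - 2 * gam) / alpha).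

(* Points within [2 * gam] of [lattice gam m - lattice alpha k] lie in alpha-cubes whose
   index differs from [schur_index m - k] by at most [L] in each coordinate. *)
Definition schur_bound (m k : I) : R :=
  \sum_(e : T) b (schur_index m - k + \row_i (e i : nat)%:Z).

Let S0 : 0 <= S. Proof. exact: le_trans (total_ge0 bS) (total_le bS). Qed.

Lemma schur_bound_le (x : 'rV[R]_d) (m k : I) : `|x| < 2 * gam ->
  b (\row_i Num.floor ((x + lattice gam m - lattice alpha k) ord0 i / alpha)) <= schur_bound m k.
Proof.
move=> xg; have /rV_norm_ltP xi := xg.
pose f i := Num.floor ((x ord0 i + gam * (m ord0 i)%:~R) / alpha).
(* Within 2 gam of the lattice point a coordinate ranges over an interval of length 4 gam; [L]
   counts the alpha-steps in it, rounded up. *)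
have fJ i : schur_index m ord0 i <= f i < schur_index m ord0 i + L.+1%:Z.
  have := xi (ltac:(by rewrite mulr_gt0)) i; rewrite ltr_norml => /andP[x1 x2].
  rewrite mxE /f; set p := (_ - _) / alpha; set q := (_ + _) / alpha.
  have pq : p < q by rewrite /p /q ltr_pM2r ?invr_gt0//; lra.
  apply/andP; split; first exact: le_floor (ltW pq).
  rewrite floor_lt_int rmorphD/=.
  have /andP[_ p1] := floor_itv p.
  have hL : 4 * gam / alpha < L%:R by exact: truncnS_gt.
  have qp : q < p + 4 * gam / alpha.
    by rewrite /p /q -mulrDl ltr_pM2r ?invr_gt0//; lra.
  rewrite -[L.+1%:Z%:~R]/(L.+1%:R) -natr1; move: p1; rewrite rmorphD/=; lra.
have le_i i : (absz (f i - schur_index m ord0 i) < L.+1)%N by have := fJ i; lia.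
pose e : T := [ffun i => Ordinal (le_i i)].
rewrite /schur_bound (bigD1 e)//=.
have -> : schur_index m - k + \row_i (e i : nat)%:Z =
    \row_i Num.floor ((x + lattice gam m - lattice alpha k) ord0 i / alpha).
  have E1 i : (schur_index m - k + \row_i (e i : nat)%:Z) 0 i =
      schur_index m ord0 i - k ord0 i + absz (f i - schur_index m ord0 i).
    by rewrite !mxE ffunE; congr (_ - _ + _); rewrite /= mxE.
  apply/rowP => i; rewrite E1 [RHS]mxE.
  have -> : (x + lattice gam m - lattice alpha k) ord0 i =
      x ord0 i + gam * (m ord0 i)%:~R - alpha * (k ord0 i)%:~R by rewrite !mxE.
  have -> : (x ord0 i + gam * (m ord0 i)%:~R - alpha * (k ord0 i)%:~R) / alpha =
      (x ord0 i + gam * (m ord0 i)%:~R) / alpha + (- k ord0 i)%:~R.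
    by rewrite rmorphN/=; field; rewrite gt_eqF.
  rewrite floorDrz ?intr_int// intrKfloor -/(f i).
  by have := fJ i; move: (schur_index m ord0 i) (f i) (k _ i) => p q r /=; lia.
by rewrite lerDl sumr_ge0// => e' _; exact: bS.1.
Qed.

Lemma summable_le_sum (J : finType) (c : J -> I -> R) S' : (forall j, summable_le (c j) S') ->
  summable_le (fun i => \sum_(j : J) c j i) (#|J|%:R * S').
Proof.
move=> cS; split => [i|F]; first by rewrite sumr_ge0// => j _; exact: (cS j).1.
rewrite exchange_big/= mulr_natl -sumr_const; apply: ler_sum => j _; exact: (cS j).2.
Qed.

Lemma schur_row m : summable_le (schur_bound m) (#|T|%:R * S).
Proof.
apply: summable_le_sum => e; apply: summable_le_inj bS => k k'.
by move=> /addIr /addrI /oppr_inj.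
Qed.

(** [h] is at most #|J|-to-one, the label [r] separating the points of a fibre. *)
Lemma summable_le_fibers (J : finType) (h : I -> I) (r : I -> J) (b' : I -> R) S' :
  (forall m m', h m = h m' -> r m = r m' -> m = m') -> summable_le b' S' ->
  summable_le (fun m => b' (h m)) (#|J|%:R * S').
Proof.
move=> inj bS'; split => [m|F]; first exact: bS'.1.
rewrite (partition_big r xpredT)//= mulr_natl -sumr_const; apply: ler_sum => j _.
have := bS'.2 [fset h m | m in [fset m in F | r m == j]]%fset.
rewrite big_imfset/=; last first.
  by move=> m m'; rewrite !inE/= => /andP[_ /eqP rm] /andP[_ /eqP rm'] hh; apply: inj; rewrite ?rm.
by apply: le_trans; rewrite big_fset_condE.
Qed.

(* Two indices [m] with the same alpha-cube differ by less than [alpha / gam]. *)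
Lemma schur_index_inj m m' : schur_index m = schur_index m' ->
  (forall i, (m ord0 i == m' ord0 i %[mod L2.+1])%Z) -> m = m'.
Proof.
move=> /rowP jj mm; apply/rowP => i; have := jj i; rewrite !mxE => ff.
have /andP[h1 h2] := floor_itv ((gam * (m ord0 i)%:~R - 2 * gam) / alpha).
have /andP[h3 h4] := floor_itv ((gam * (m' ord0 i)%:~R - 2 * gam) / alpha).
rewrite ff in h1 h2.
move: h1 h2 h3 h4; rewrite !ler_pdivlMr// !ltr_pdivrMr// rmorphD/=.
set z := (Num.floor _)%:~R => h1 h2 h3 h4.
have hL : alpha / gam < L2.+1%:R by exact: truncnS_gt.
rewrite ltr_pdivrMr// in hL.
have lt1 : (m ord0 i - m' ord0 i)%:~R < L2.+1%:R :> R.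
  by rewrite -(ltr_pM2l gam0) rmorphB/= mulrBr; lra.
have lt2 : (m' ord0 i - m ord0 i)%:~R < L2.+1%:R :> R.
  by rewrite -(ltr_pM2l gam0) rmorphB/= mulrBr; lra.
move: lt1 lt2; rewrite -[L2.+1%:R]/(L2.+1%:Z%:~R) !ltr_int.
have := mm i; rewrite eqz_mod_dvd => /dvdzP[q] e1 e2 e3.
suff : m ord0 i = m' ord0 i by [].
move: e1 e2 e3; move: (m ord0 i) (m' ord0 i) (L2.+1%:Z) (ltn0Sn L2 : 0 < L2.+1%:Z) => p p' l l0 e1 e2 e3.
(* A multiple of [l] strictly between -l and l is 0. *)
clear -l0 e1 e2 e3.
have q1 : q < 1 by nia.
have q2 : -1 < q by nia.
have q0 : q = 0 by lia.
by move: e1; rewrite q0 mul0r => /eqP; rewrite subr_eq0 => /eqP.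
Qed.

(** When gam < alpha several [m] may share a cube index; residues modulo [L2.+1] tell them apart, so
    the fibres have bounded size. *)
Lemma schur_col k : summable_le (fun m => schur_bound m k)
  (#|T|%:R * (#|{ffun 'I_d -> 'I_L2.+1}|%:R * S)).
Proof.
apply: summable_le_sum => e.
pose r (m : I) : {ffun 'I_d -> 'I_L2.+1} := [ffun i => inord (absz (m ord0 i %% L2.+1%:Z)%Z)].
have : summable_le (fun m => b (m - k + \row_i (e i : nat)%:Z)) S.
  by apply: summable_le_inj bS => m m' /addIr /addIr.
apply: (summable_le_fibers (r := r)) => m m' jj /ffunP rr.
apply: schur_index_inj => // i; have := rr i; rewrite !ffunE => /(congr1 val).
have lt0 (q : int) : (absz (q %% L2.+1%:Z)%Z < L2.+1)%N by lia.
by rewrite /= !inordK// => h; lia.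
Qed.

Lemma schur_exists : exists C, (forall m, summable_le (schur_bound m) C) /\
  (forall k, summable_le (fun m => schur_bound m k) C).
Proof.
exists (#|T|%:R * S + #|T|%:R * (#|{ffun 'I_d -> 'I_L2.+1}|%:R * S)); split => [m|k].
  by apply: summable_leW (schur_row m) _; rewrite lerDl !mulr_ge0.
by apply: summable_leW (schur_col k) _; rewrite lerDr mulr_ge0.
Qed.

End schur.

(** * Frame inequalities through finite sums *)

Section frame_bounds.
Context {R : realType} {K : countType}.
Variable a : K -> R.
Hypothesis a0 : forall k, 0 <= a k.

Lemma esum_le_fset (X : R) : (\esum_(k in [set: K]) (a k)%:E <= X%:E)%E ->
  forall F : {fset K}, \sum_(k <- F) a k <= X.
Proof.
move=> le F; rewrite -lee_fin -sumEFin; apply: le_trans le; exact: esum_fset_le.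
Qed.

Lemma le_esum_fset (X e : R) : (X%:E <= \esum_(k in [set: K]) (a k)%:E)%E -> 0 < e ->
  exists F0 : {fset K}, forall F : {fset K}, (F0 `<=` F)%fset -> X - e <= \sum_(k <- F) a k.
Proof.
move=> le e0.
have : ((X - e)%:E < \esum_(k in [set: K]) (a k)%:E)%E.
  by apply: lt_le_trans le; rewrite lte_fin ltrBlDr ltrDl.
move=> /ereal_sup_gt[_ [A [finA _] <-]].
rewrite fsbig_finite// sumEFin lte_fin => /ltW h.
exists (fset_set A) => F AF; apply: le_trans h _; exact: sum_fset_le.
Qed.

End frame_bounds.

Theorem corollary5p2 (R : realType) (H : completeNormedModType R[i])
    (dot : {dot H for conjC}) (d : nat) (w : 'rV[R]_d -> R) (alpha beta : R)
    (g gtilde : 'rV[R]_d -> H) :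
  hilbert_norm dot -> separable H ->
  admissible w -> 0 < alpha -> 0 < beta ->
  in_amalgam w alpha g ->
  gabor_frame dot g alpha beta ->
  dual_window dot g alpha beta gtilde ->
  continuous g -> ae_continuous gtilde.

Proof.
move=> hilb sepH aw alpha0 beta0 ag [A [B0 [A0 B00 fr]]] [gt2 fop] cg.
have [b [S [bS gb]]] := amalgam_cubes aw alpha0 ag cg.
have gam0 : 0 < beta^-1 by rewrite invr_gt0.
have [C [crow ccol]] := schur_exists alpha0 gam0 bS.
pose c := schur_bound alpha beta^-1 b.
have rg : rcont g by apply/rcontP.
have v_le k m (x : 'rV[R]_d) : `|x| < 2 * beta^-1 ->
    rnorm (translate (lattice alpha k) g (x + lattice beta^-1 m)) <= c m k.
  by move=> xg; apply: le_trans (gb _) _; exact: (schur_bound_le alpha0 gam0 bS m k xg).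
have vcont k : rcont (translate (lattice alpha k) g) by exact: rcont_shift.
(* [g] is its own translate by 0, so column 0 of the Schur matrix serves as its cell bound. *)
have tg : tame beta^-1 g (fun m => c m 0) C.
  split => // m x xg; have := v_le 0 m x xg.
  by rewrite /translate lattice0 subr0.
have g2 := tame_in_L2 gam0 tg.
(* Enlarging the upper frame bound keeps it valid and secures A <= B, hence 0 <= 1 - A / B < 1. *)
pose B := Num.max A B0.
have AB : A <= B by rewrite le_max lexx.
have upper f : in_L2 f -> forall F : {fset 'rV[int]_d * 'rV[int]_d},
    \sum_(kn <- F) rnorm (L2dot dot f (gabor g alpha beta kn)) ^+ 2 <= B * sqn f.
  move=> lf; apply: esum_le_fset; have [_ /le_trans] := fr f lf; apply.
  by rewrite L2norm_sqn// -EFinM lee_fin ler_wpM2r ?sqn_ge0// le_max lexx orbT.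
have lower f : in_L2 f -> forall e : R, 0 < e -> exists F0 : {fset 'rV[int]_d * 'rV[int]_d},
    forall F : {fset 'rV[int]_d * 'rV[int]_d}, (F0 `<=` F)%fset ->
    A * sqn f - e <= \sum_(kn <- F) rnorm (L2dot dot f (gabor g alpha beta kn)) ^+ 2.
  move=> lf e e0; apply: le_esum_fset e0 => [kn|]; first exact: sqr_ge0.
  by have [+ _] := fr f lf; rewrite L2norm_sqn// -EFinM.
exists (partial_limit dot g alpha beta B).
  by apply/rcontP; exact: (rcont_partial_limit hilb sepH beta0 vcont v_le crow ccol tg A0 AB upper lower).
apply: (ae_eq_partial_limit hilb sepH beta0 vcont v_le crow ccol tg A0 AB upper lower gt2).
exact: (frame_operator_weak hilb sepH g2 gt2 fop).
Qed.
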